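(* Let $F$ be a field with $\mathrm{char}(F)=p\geq 5$ and cardinality $p^e$. Let $E$ be an elliptic curve in $\mathbb{P}^2_F$ given by a short Weierstrass equation, with identity element $\mathcal{O}$, and let $P\in E(F)\setminus\{\mathcal{O}\}$. Then there exists a subgroup $S$ of $\mathrm{Gal}(F/\mathbb{F}_p)$ such that $$\frac{|\mathrm{Aut}(G_{E,P}(F))|}{p^{18e^2}}=|S|\cdot|E[3](F)|\cdot\frac{|\mathrm{Aut}_{\mathcal{O}}(E)|}{|\mathrm{Aut}_{\mathcal{O}}(E)\cdot P|}\cdot\begin{cases}|\mathrm{GL}_2(F)| & \text{if } P\in E[2](F),\\ 2(p^e-1)^2 & \text{otherwise.}\end{cases}$$
   Context: A short Weierstrass equation is $y^2z=x^3+axz^2+bz^3$ with $a,b\in F$ and $4a^3+27b^2\neq0$; $\mathcal{O}=(0:1:0)$. $E[n]$ is the $n$-torsion subgroup of $E$ and $E[n](F)$ its $F$-rational points. $\mathrm{Aut}_{\mathcal{O}}(E)$ is the group of automorphisms (defined over $F$) of the projective curve $E$ fixing $\mathcal{O}$, and $\mathrm{Aut}_{\mathcal{O}}(E)\cdot P$ is the orbit of $P$ under it. $\mathrm{Aut}(G)$ denotes the automorphism group of the abstract group $G$. The group $G_{E,P}(F)$: for $P=(\lambda:\mu:1)\in E(F)\setminus\{\mathcal{O}\}$ put $$J_{E,P}=\begin{pmatrix} y_1-\lambda y_3 & y_2-\mu y_3 & 0\\ y_2+\mu y_3 & \lambda y_1+(a+\lambda^2)y_3 & y_1\\ 0 &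 y_1 & -y_3\end{pmatrix},\qquad B_{E,P}=\begin{pmatrix}0 & J_{E,P}\\ -J_{E,P}^{\mathrm t} & 0\end{pmatrix}.$$ Write $B_{E,P}=B_1y_1+B_2y_2+B_3y_3$ with $B_i\in\mathrm{Mat}_6(F)$ and let $t:F^6\times F^6\to F^3$, $t(u,v)=(u^{\mathrm t}B_1v,u^{\mathrm t}B_2v,u^{\mathrm t}B_3v)$. Then $G_{E,P}(F)$ is the group with underlying set $F^6\oplus F^3$ and multiplication $(v,w)\cdot(v',w')=(v+v',\,w+w'+\tfrac12 t(v,v'))$. *)

(* Defs.v *)
From HB Require Import structures.
From mathcomp Require Import all_boot all_order all_algebra all_fingroup all_field.
From mathcomp Require Import ring.
From mathcomp Require Import mpoly.
From mathcomp Require Import boolp classical_sets functions cardinality.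

Set Implicit Arguments.
Unset Strict Implicit.
Unset Printing Implicit Defensive.

Import GRing.Theory.
Local Open Scope ring_scope.

(* A point of y^2 z = x^3 + a x z^2 + b z^3 with z != 0 is (x : y : 1), encoded *)
(* as Some (x, y); the only point with z = 0 is (0 : 1 : 0), encoded as None.   *)
(* See [hcoordP] and [hcoord_inj].                                              *)
Section Curve.
Variables (K : fieldType) (a b : K).

Definition on_curve (Q : option (K * K)) : bool :=
  if Q is Some (x, y) then y ^+ 2 == x ^+ 3 + a * x + b else true.

Definition ecpoint : predArgType := {Q : option (K * K) | on_curve Q}.

Definition ec_zero : ecpoint := exist on_curve None isT.

Definition hcoord (Q : option (K * K)) : 'rV[K]_3 :=
  if Q is Some (x, y) then \row_(j < 3) [:: x; y; 1]`_j
  else \row_(j < 3) [:: 0; 1; 0]`_j.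

Lemma hcoordP (v : 'rV[K]_3) :
  let x := v 0 (inord 0) in let y := v 0 (inord 1) in let z := v 0 (inord 2) in
  v != 0 -> y ^+ 2 * z = x ^+ 3 + a * x * z ^+ 2 + b * z ^+ 3 ->
  exists2 Q, on_curve Q & exists2 c, c != 0 & v = c *: hcoord Q.
Proof.
move=> x y z v0 E.
have vE : v = \row_(j < 3) [:: x; y; z]`_j.
  apply/rowP=> j; rewrite !mxE /x /y /z.
  by case: j => [[|[|[|//]]] Hj] /=; congr (v 0 _); apply/val_inj; rewrite /= inordK.
have [z0|z0] := eqVneq z 0.
  have x0 : x = 0.
    have : x ^+ 3 = 0 by move: E; rewrite z0 !expr0n /= !mulr0 !addr0.
    by move/eqP; rewrite expf_eq0 => /andP[_ /eqP].
  exists None => //; exists y.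
    apply: contraNneq v0 => y0; apply/eqP/rowP=> j; rewrite vE x0 y0 z0 !mxE.
    by case: j => [[|[|[|//]]] Hj].
  apply/rowP=> j; rewrite vE !mxE x0 z0.
  by case: j => [[|[|[|//]]] Hj] /=; rewrite ?mulr0 ?mulr1.
exists (Some (x / z, y / z)).
  apply/eqP; apply: (mulIf (expf_neq0 3 z0)).
  have -> : (y / z) ^+ 2 * z ^+ 3 = y ^+ 2 * z by field.
  by rewrite E; field.
exists z => //; apply/rowP=> j; rewrite vE !mxE.
by case: j => [[|[|[|//]]] Hj] /=; rewrite ?mulr1 // mulrC divfK.
Qed.

Lemma hcoord_inj (Q R : option (K * K)) (c : K) :
  hcoord Q = c *: hcoord R -> Q = R.
Proof.
move=> /rowP H.
have := H (inord 0); have := H (inord 1); have := H (inord 2).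
case: Q R {H} => [[x y]|] [[x' y']|] //=; rewrite !mxE !inordK //= ?mulr0 ?mulr1.
- by move=> <-; rewrite !mul1r => -> ->.
- by move=> /eqP; rewrite oner_eq0.
- by move=> <- /eqP; rewrite mul0r oner_eq0.
Qed.

Definition ec_add_raw (P Q : option (K * K)) : option (K * K) :=
  match P, Q with
  | None, _ => Q
  | _, None => P
  | Some (x1, y1), Some (x2, y2) =>
      let third s := let x3 := s ^+ 2 - x1 - x2 in
                     Some (x3, s * (x1 - x3) - y1) in
      if x1 != x2 then third ((y2 - y1) / (x2 - x1))
      else if y1 == - y2 then None
      else third ((3 * x1 ^+ 2 + a) / (2 * y1))
  end.

Lemma ec_add_subproof (P Q : ecpoint) : on_curve (ec_add_raw (val P) (val Q)).
Proof.
case: P Q => [[[x1 y1]|] /= H1] [[[x2 y2]|] /= H2] //.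
move/eqP: H1 => H1; move/eqP: H2 => H2.
have [x12|x12] /= := eqVneq x1 x2.
  case: ifP => // /negbT y12 /=.
  have y1E : y1 = y2.
    have /eqP : y1 ^+ 2 = y2 ^+ 2 by rewrite H1 H2 x12.
    by rewrite eqf_sqr (negbTE y12) orbF => /eqP.
  have y0 : 2 * y1 != 0.
    by rewrite mulr_natl mulr2n addr_eq0 {2}y1E y12.
  have bE : b = y1 ^+ 2 - x1 ^+ 3 - a * x1 by rewrite H1; ring.
  rewrite -x12 bE; apply/eqP; field.
  by move: y0; rewrite mulf_eq0 negb_or => /andP[-> ->].
have d0 : x2 - x1 != 0 by rewrite subr_eq0 eq_sym.
have aE : a = (y2 ^+ 2 - y1 ^+ 2 - (x2 ^+ 3 - x1 ^+ 3)) / (x2 - x1).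
  by rewrite H1 H2; field.
have bE : b = y1 ^+ 2 - x1 ^+ 3 - a * x1 by rewrite H1; ring.
by apply/eqP; rewrite bE aE; field.
Qed.

Definition ec_add (P Q : ecpoint) : ecpoint :=
  exist on_curve _ (ec_add_subproof P Q).

End Curve.

Arguments ec_zero {K} a b.

Definition ec_tors (F : finFieldType) (a b : F) (n : nat) : {set ecpoint a b} :=
  [set Q | iter n (ec_add Q) (ec_zero a b) == ec_zero a b].

(* Morphisms defined over F are represented by the maps they induce on E(K),    *)
(* for iota : F -> K with K algebraically closed (as E is reduced, a morphism   *)
(* is determined by this map): near each R in E(K) such a map is given by three *)
(* forms of the same degree with coefficients in F, on the open set where they  *)
(* do not all vanish.                                                           *)
Section Automorphisms.
Variables (F : fieldType) (K : closedFieldType) (iota : {rmorphism F -> K}).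
Variables (a b : F).

Local Notation EK := (ecpoint (iota a) (iota b)).

Definition ec_map_raw (Q : option (F * F)) : option (K * K) :=
  omap (fun xy => (iota xy.1, iota xy.2)) Q.

Lemma ec_map_subproof (Q : ecpoint a b) :
  on_curve (iota a) (iota b) (ec_map_raw (val Q)).
Proof.
case: Q => [[[x y]|//] /= /eqP H].
by rewrite -!rmorphXn -rmorphM -!rmorphD -H.
Qed.

Definition ec_map (Q : ecpoint a b) : EK :=
  exist (on_curve (iota a) (iota b)) _ (ec_map_subproof Q).

Definition heval (f : 'I_3 -> {mpoly F[3]}) (Q : EK) : 'rV[K]_3 :=
  \row_i (map_mpoly iota (f i)).@[hcoord (val Q) 0].

Definition ec_morphism (phi : EK -> EK) : Prop :=
  forall R : EK, exists (d : nat) (f : 'I_3 -> {mpoly F[3]}),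
    [/\ forall i, f i \is d.-homog,
        heval f R != 0
      & forall Q : EK, heval f Q != 0 ->
          exists c : K, heval f Q = c *: hcoord (val (phi Q))].

Definition ec_automorphism (phi : EK -> EK) : Prop :=
  ec_morphism phi /\
  exists psi : EK -> EK, [/\ ec_morphism psi, cancel phi psi & cancel psi phi].

Definition ec_AutO : set (EK -> EK) :=
  [set phi | ec_automorphism phi /\
             phi (ec_zero (iota a) (iota b)) = ec_zero (iota a) (iota b)]%classic.

Definition ec_orbit (P : ecpoint a b) : set EK :=
  [set phi (ec_map P) | phi in ec_AutO]%classic.

End Automorphisms.

Arguments ec_AutO {F K} iota a b.
Arguments ec_orbit {F K} iota {a b} P.

Definition JEP (F : fieldType) (a lambda mu y1 y2 y3 : F) : 'M[F]_3 :=
  \matrix_(i < 3, j < 3)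
    (nth [::]
       [:: [:: y1 - lambda * y3; y2 - mu * y3; 0];
           [:: y2 + mu * y3; lambda * y1 + (a + lambda ^+ 2) * y3; y1];
           [:: 0; y1; - y3]] i)`_j.

Definition BEP (F : fieldType) (a lambda mu y1 y2 y3 : F) : 'M[F]_6 :=
  let J := JEP a lambda mu y1 y2 y3 in
  block_mx (0 : 'M_3) J (- J^T) (0 : 'M_3).

(* B is linear in (y1, y2, y3), so its coefficients are its values at the       *)
(* standard basis vectors.                                                      *)
Definition Bcoef (F : fieldType) (a lambda mu : F) (i : 'I_3) : 'M[F]_6 :=
  BEP a lambda mu (i == 0 :> nat)%:R (i == 1 :> nat)%:R (i == 2 :> nat)%:R.

Lemma BEP_coef (F : fieldType) (a lambda mu : F) (y : 'I_3 -> F) :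
  BEP a lambda mu (y (inord 0)) (y (inord 1)) (y (inord 2)) =
  \sum_(i < 3) y i *: Bcoef a lambda mu i.
Proof.
rewrite !big_ord_recl big_ord0 addr0 /Bcoef /BEP /=.
set y1 := y (inord 0); set y2 := y (inord 1); set y3 := y (inord 2).
have -> : y ord0 = y1 by congr y; apply/val_inj; rewrite /= inordK.
have -> : y (lift ord0 ord0) = y2 by congr y; apply/val_inj; rewrite /= inordK.
have -> : y (lift ord0 (lift ord0 ord0)) = y3.
  by congr y; apply/val_inj; rewrite /= inordK.
set J := JEP a lambda mu y1 y2 y3.
have JE : J = y1 *: JEP a lambda mu 1 0 0
              + (y2 *: JEP a lambda mu 0 1 0 + y3 *: JEP a lambda mu 0 0 1).
  apply/matrixP => i j; rewrite !mxE.
  case: i => [[|[|[|//]]] Hi]; case: j => [[|[|[|//]]] Hj] /=; ring.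
rewrite JE.
rewrite !(@scale_block_mx F 3 3 3 3) !(@add_block_mx F 3 3 3 3).
by rewrite !scaler0 !addr0 !linearD /= !linearZ /= ?scalerN.
Qed.

Definition tEP (F : fieldType) (a lambda mu : F) (u v : 'cV[F]_6) : 'cV[F]_3 :=
  \col_i (u^T *m Bcoef a lambda mu i *m v) 0 0.

Definition GEP (F : finFieldType) (a lambda mu : F) : predArgType :=
  ('cV[F]_6 * 'cV[F]_3)%type.

Section GEPGroup.
Variables (F : finFieldType) (a lambda mu : F).

Local Notation G := (GEP a lambda mu).
Local Notation t := (tEP a lambda mu).

HB.instance Definition _ := Finite.copy G ('cV[F]_6 * 'cV[F]_3)%type.

Definition GEP_mul (x y : G) : G :=
  (x.1 + y.1, x.2 + y.2 + 2^-1 *: t x.1 y.1).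

Definition GEP_one : G := (0, 0).

Definition GEP_inv (x : G) : G := (- x.1, - x.2 + 2^-1 *: t x.1 x.1).

Lemma tEPE u v i : t u v i 0 = (u^T *m Bcoef a lambda mu i *m v) 0 0.
Proof. by rewrite mxE. Qed.

Lemma tEPDl u u' v : t (u + u') v = t u v + t u' v.
Proof. by apply/colP=> i; rewrite [RHS]mxE !tEPE linearD /= !mulmxDl mxE. Qed.

Lemma tEPDr u v v' : t u (v + v') = t u v + t u v'.
Proof. by apply/colP=> i; rewrite [RHS]mxE !tEPE mulmxDr mxE. Qed.

Lemma tEPNl u v : t (- u) v = - t u v.
Proof. by apply/colP=> i; rewrite [RHS]mxE !tEPE linearN /= !mulNmx mxE. Qed.

Lemma tEP0l v : t 0 v = 0.
Proof. by apply/colP=> i; rewrite tEPE trmx0 !mul0mx !mxE. Qed.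

Lemma GEP_mulA : associative GEP_mul.
Proof.
move=> [v w] [v' w'] [v'' w'']; congr (_, _) => /=; first by rewrite addrA.
rewrite tEPDl tEPDr !scalerDr -!addrA; congr (_ + (_ + _)).
by rewrite [RHS]addrCA; congr (_ + _); rewrite addrCA [X in _ + X]addrC.
Qed.

Lemma GEP_mul1 : left_id GEP_one GEP_mul.
Proof.
by move=> [v w]; congr (_, _) => /=; rewrite ?tEP0l ?scaler0 ?addr0 ?add0r.
Qed.

Lemma GEP_mulV : left_inverse GEP_one GEP_inv GEP_mul.
Proof.
move=> [v w]; congr (_, _) => /=; first exact: addNr.
by rewrite tEPNl scalerN addrAC addrK addNr.
Qed.

HB.instance Definition _ := Finite_isGroup.Build G GEP_mulA GEP_mul1 GEP_mulV.

Lemma GEP_mulE (v v' : 'cV[F]_6) (w w' : 'cV[F]_3) :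
  (((v, w) : G) * ((v', w') : G))%g
    = (v + v', w + w' + 2^-1 *: tEP a lambda mu v v').
Proof. by []. Qed.

End GEPGroup.

(* Main.v *)
(* An automorphism of G = GEP is determined by an additive map F^6 -> F^3 and *)
(* a pair of additive bijections of F^6 and F^3 compatible with the bilinear  *)
(* map t; there are p^(18 e^2) maps of the first kind. The equations J_R M =  *)
(* N J_R' are linear in M, N and force M = N to be a scalar, which vanishes   *)
(* unless R = R'. Hence the centroid of t is F, the compatible pairs are      *)
(* semilinear, and S is the group of the field automorphisms that occur. For  *)
(* an F-linear pair (M, N) the determinant of the pencil shows that N         *)
(* preserves the cubic, so it maps O to a flex, i.e. to a point of E[3](F);   *)
(* every flex is reached by an explicit lift of the translation, and the N    *)
(* fixing O are the scalings (x, y) |-> (u^2 x, u^3 y) up to a factor. Such a *)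
(* scaling lifts iff it maps P to P or -P, and its lifts are counted with the *)
(* rigidity of the equations J_R M = N J_R' once more. Finally, an            *)
(* automorphism of the curve fixing O acts on the coordinate ring of E \ O;   *)
(* comparing pole orders at O with those of the inverse shows that it is a    *)
(* scaling, and it is defined over F because it commutes with Frobenius.      *)

Require Import Defs.
From HB Require Import structures.
From mathcomp Require Import all_boot all_order all_algebra all_fingroup all_field.
From mathcomp Require Import finmap mpoly.
From mathcomp Require Import boolp classical_sets functions cardinality.
From mathcomp Require Import ring zify.

Set Implicit Arguments.
Unset Strict Implicit.
Unset Printing Implicit Defensive.

Import GRing.Theory.
Local Open Scope ring_scope.

(** * Intertwiners of the pencil J *)

(** The determinant of [J] is the cubic, so the form [t] remembers the curve and, up to sign, the
    point. An automorphism of the group preserves the centre [F^3]. It therefore consists of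
    additive bijections of [F^6] and [F^3] compatible with [t], plus an arbitrary additive map
    [F^6 -> F^3]; the latter accounts for [p^(18 e^2)] ([card_addmaps]). The additive endomorphisms
    of [F^6] that are self-adjoint for [t] are the scalars of [F], so conjugating them by the
    automorphism gives a field automorphism [s] over which both bijections are semilinear
    ([gep_aut_shape]). What remains is a linear pseudo-isometry [(M, N)] from the form of [P] to
    that of its conjugate under [s]. The [s] that occur form the group [S], and for each of them
    there are as many pseudo-isometries as for [s = 1] ([card_Aut_GEP]).

    For [s = 1], [N] preserves the cubic up to a factor ([pisom_cubic]) and sends [O] to a rational
    flex, that is, to a point of [E[3](F)]. Translations by flexes lift ([J_transl]), so each flex
    is hit equally often ([card_pisom_self]). If [N] fixes [O], it is a multiple of a scaling
    [(x, y) |-> (u^2 x, u^3 y)] ([pisomO_shape]). Dividing the scaling out leaves a homothety [N]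
    and an [M] that intertwines the pencils of two points. By rigidity ([Jv_intertwine]) and since
    transposing [J] negates the point ([JvN]), such an [M] exists only if [u] maps [P] to [P] or
    [-P]. It then runs over [GL_2(F)] if [P = -P], and otherwise over the invertible diagonal or
    antidiagonal 2 x 2 matrices. Summing over [u] gives the stabiliser of [P] times the last factor
    of the formula ([card_pisomO_stab]).

    That stabiliser has order [|Aut_O(E)| / |Aut_O(E) P|] ([card_ec_orbit]), once the geometric
    automorphisms are known to be exactly the scalings ([ec_AutOE]). This rests on a count of pole
    orders at [O] ([cdeg_rigid]) and on Frobenius ([AutO_shape]). *)

Lemma ord3P (i : 'I_3) : [\/ i = 0, i = 1 | i = 2%:R].
Proof.
by case: i => [[|[|[|//]]] Hi]; [constructor 1|constructor 2|constructor 3];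
  apply/val_inj.
Qed.

Lemma det_mx22 (R : comNzRingType) (A : 'M[R]_2) :
  \det A = A 0 0 * A 1 1 - A 0 1 * A 1 0.
Proof.
rewrite (expand_det_row _ 0) !big_ord_recl big_ord0 addr0 /cofactor !det_mx11 !mxE.
rewrite expr0 mul1r expr1 mulN1r mulrN.
by congr (A _ _ * A _ _ - A _ _ * A _ _); apply/val_inj.
Qed.

Lemma det_mx33 (R : comNzRingType) (A : 'M[R]_3) :
  \det A = A 0 0 * (A 1 1 * A 2%:R 2%:R - A 1 2%:R * A 2%:R 1)
         - A 0 1 * (A 1 0 * A 2%:R 2%:R - A 1 2%:R * A 2%:R 0)
         + A 0 2%:R * (A 1 0 * A 2%:R 1 - A 1 1 * A 2%:R 0).
Proof.
rewrite (expand_det_row _ 0) !big_ord_recl big_ord0 /cofactor !det_mx22 !mxE.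
rewrite expr0 mul1r expr1 mulN1r mulrN addr0 addrA sqrrN expr1n mul1r.
by congr (A _ _ * (A _ _ * A _ _ - A _ _ * A _ _) - A _ _ *
   (A _ _ * A _ _ - A _ _ * A _ _) + A _ _ * (A _ _ * A _ _ - A _ _ * A _ _));
  apply/val_inj.
Qed.

Section Pencil.
Variable F : fieldType.
Implicit Types (a l m : F) (y : 'cV[F]_3).

Definition Jv a l m y := JEP a l m (y 0 0) (y 1 0) (y 2%:R 0).
Definition Bv a l m y := BEP a l m (y 0 0) (y 1 0) (y 2%:R 0).

Lemma JvE a l m y i j : Jv a l m y i j =
  (nth [::] [:: [:: y 0 0 - l * y 2%:R 0; y 1 0 - m * y 2%:R 0; 0];
               [:: y 1 0 + m * y 2%:R 0; l * y 0 0 + (a + l ^+ 2) * y 2%:R 0; y 0 0];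
               [:: 0; y 0 0; - y 2%:R 0]] i)`_j.
Proof. by rewrite mxE. Qed.

(** This symmetry is the source of every alternative between [P] and [-P] below. *)
Lemma JvN a l m y : (Jv a l m y)^T = Jv a l (- m) y.
Proof.
apply/matrixP=> i j; rewrite !mxE.
by case: (ord3P i) => ->; case: (ord3P j) => -> //=; rewrite ?mulNr ?opprK.
Qed.

Lemma JvZ a l m c y : Jv a l m (c *: y) = c *: Jv a l m y.
Proof.
apply/matrixP=> i j; rewrite !mxE.
by case: (ord3P i) => ->; case: (ord3P j) => -> //=; ring.
Qed.

Definition vec3 (x y z : F) : 'cV[F]_3 := \col_(i < 3) [:: x; y; z]`_i.

Lemma vec3_eta y : y = vec3 (y 0 0) (y 1 0) (y 2%:R 0).
Proof. by apply/colP=> i; rewrite mxE; case: (ord3P i) => ->. Qed.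

Lemma mx3_ext (A B : 'M[F]_3) :
  [/\ A 0 0 = B 0 0, A 0 1 = B 0 1 & A 0 2%:R = B 0 2%:R] ->
  [/\ A 1 0 = B 1 0, A 1 1 = B 1 1 & A 1 2%:R = B 1 2%:R] ->
  [/\ A 2%:R 0 = B 2%:R 0, A 2%:R 1 = B 2%:R 1 & A 2%:R 2%:R = B 2%:R 2%:R] ->
  A = B.
Proof.
move=> [? ? ?] [? ? ?] [? ? ?]; apply/matrixP=> i j.
by case: (ord3P i) => ->; case: (ord3P j) => ->.
Qed.

Lemma mulmx3E p q (A : 'M[F]_(p, 3)) (B : 'M[F]_(3, q)) i j :
  (A *m B) i j = A i 0 * B 0 j + A i 1 * B 1 j + A i 2%:R * B 2%:R j.
Proof.
rewrite mxE !big_ord_recl big_ord0 addr0 addrA.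
by congr (_ * _ + _ * _ + _ * _); congr fun_of_matrix; apply/val_inj.
Qed.

(** Comparing entries at the three basis vectors kills the off-diagonal entries of [A] and [B] and
    equates the diagonal ones. The entries (0,0) and (1,0) at [vec3 0 0 1] then carry [l] and
    [m]. *)
Lemma Jv_intertwine a l m l' m' (A B : 'M[F]_3) :
  (forall y, Jv a l m y *m A = B *m Jv a l' m' y) ->
  exists c, [/\ A = c%:M, B = c%:M & (c = 0) \/ (l = l' /\ m = m')].
Proof.
move=> H.
have E y i j : Jv a l m y i 0 * A 0 j + Jv a l m y i 1 * A 1 j + Jv a l m y i 2%:R * A 2%:R j
    = B i 0 * Jv a l' m' y 0 j + B i 1 * Jv a l' m' y 1 j + B i 2%:R * Jv a l' m' y 2%:R j.
  by rewrite -!mulmx3E H.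
have v3 (x y z : F) : (vec3 x y z 0 0 = x) * (vec3 x y z 1 0 = y) * (vec3 x y z 2%:R 0 = z).
  by rewrite !mxE.
have E1 := E (vec3 1 0 0); have E2 := E (vec3 0 1 0); have E3 := E (vec3 0 0 1).
have := (E1 0 0, E1 0 1, E1 0 2%:R, E1 1 0, E1 1 1, E1 1 2%:R,
  (E1 2%:R 0, E1 2%:R 1, E1 2%:R 2%:R)).
have := (E2 0 0, E2 0 1, E2 0 2%:R, E2 1 0, E2 1 1, E2 1 2%:R,
  (E2 2%:R 0, E2 2%:R 1, E2 2%:R 2%:R)).
have := (E3 0 0, E3 0 1, E3 0 2%:R, E3 1 0, E3 1 1, E3 1 2%:R,
  (E3 2%:R 0, E3 2%:R 1, E3 2%:R 2%:R)).
rewrite !JvE /= !v3.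
rewrite ?(mulr0,mulr1,mul0r,mul1r,addr0,add0r,subr0,sub0r,oppr0,mulN1r,mulrN1,mulNr,mulrN).
move=> [[[[[[e00 e01] e02] e10] e11] e12] [[e20 e21] e22]].
move=> [[[[[[f00 f01] f02] f10] f11] f12] [[f20 f21] f22]].
move=> [[[[[[g00 g01] g02] g10] g11] g12] [[g20 g21] g22]].
have a10 : A 1 0 = 0 by rewrite g20 -f21.
have b01 : B 0 1 = 0 by rewrite -f00.
have b02 : B 0 2%:R = 0 by apply/oppr_inj; rewrite -e02 f12 f02 !mulr0 subr0 oppr0.
have a01 : A 0 1 = 0 by rewrite g01 b01 b02 mul0r addr0.
have b10 : B 1 0 = 0 by rewrite -f11.
have b12 : B 1 2%:R = 0 by apply/oppr_inj; rewrite -e12 f12 f02 !mulr0 addr0 oppr0.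
have a20 : A 2%:R 0 = 0 by rewrite -b10 -g10 a10 mulr0 add0r.
have a21 : A 2%:R 1 = 0 by apply/oppr_inj; rewrite e21 -f20 -f21 !mul0r !oppr0 addr0.
have a11 : A 1 1 = A 0 0 by rewrite f01 g00.
have b22 : B 2%:R 2%:R = A 0 0 by rewrite -a11 g21 -f20 mul0r add0r.
have a22 : A 2%:R 2%:R = A 0 0 by apply/oppr_inj; rewrite e22 b22.
exists (A 0 0); split.
- by apply: mx3_ext; rewrite !mxE /= ?f12 ?f02 ?a10 ?a01 ?a20 ?a21 ?a11 ?a22.
- by apply: mx3_ext; rewrite !mxE /= -?g00 -?f10 ?b01 ?b02 ?b10 ?b12 -?f20 -?f21 ?b22.
have [|c0] := eqVneq (A 0 0) 0; first by left.
right; split; apply: (mulIf c0).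
  apply/oppr_inj; move: e00.
  by rewrite a10 b01 mulr0 mul0r subr0 addr0 -g00 => ->; rewrite mulrC.
by move: e10; rewrite a10 b10 mulr0 mul0r oppr0 addr0 add0r -f10 => ->; rewrite mulrC.
Qed.

Lemma BvE a l m y :
  Bv a l m y = block_mx 0 (Jv a l m y) (- Jv a l (- m) y) 0 :> 'M_(3 + 3).
Proof. by rewrite -JvN. Qed.

Lemma BvZ a l m c y : Bv a l m (c *: y) = c *: Bv a l m y.
Proof. by rewrite !BvE !JvZ (@scale_block_mx F 3 3 3 3) !scaler0 scalerN. Qed.

(** The 2 x 2 matrix with rows [(x, y)] and [(z, w)], tensored with the identity of [F^3]. *)
Definition smx (x y z w : F) : 'M[F]_6 :=
  block_mx x%:M y%:M z%:M w%:M : 'M_(3 + 3).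

Lemma smx_inj (x y z w x' y' z' w' : F) : smx x y z w = smx x' y' z' w' ->
  [/\ x = x', y = y', z = z' & w = w'].
Proof.
move/(@eq_block_mx F 3 3 3 3) => [].
by do 4![move/matrixP/(_ 0 0); rewrite !mxE /= !mulr1n => ->].
Qed.

Lemma Bv_smx a l m (x y z w : F) v :
  (smx x y z w)^T *m Bv a l m v *m smx x y z w =
  block_mx ((x * z) *: (Jv a l m v - Jv a l (- m) v))
           ((x * w) *: Jv a l m v - (y * z) *: Jv a l (- m) v)
           ((y * z) *: Jv a l m v - (x * w) *: Jv a l (- m) v)
           ((y * w) *: (Jv a l m v - Jv a l (- m) v)) :> 'M_(3 + 3).
Proof.
rewrite /smx BvE (@tr_block_mx F 3 3 3 3) !(@mulmx_block F 3 3 3 3 3 3).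
rewrite !tr_scalar_mx !mulmx0 !add0r !addr0 !mul_scalar_mx -!scalemxAl.
rewrite !mul_mx_scalar !scalerA !scalerN !scalerBr.
by congr (@block_mx F 3 3 3 3 _ _ _ _); rewrite addrC; congr (_ *: _ - _ *: _);
   rewrite mulrC.
Qed.

Lemma Bv_pisom_scalar a l m l' m' c (M : 'M[F]_6) :
  M \in unitmx -> (forall y, M^T *m Bv a l m y *m M = c *: Bv a l' m' y) ->
  exists x (y : F) z w, [/\ M = smx x y z w,
    x = 0 /\ w = 0 \/ l = l' /\ m = m' & y = 0 /\ z = 0 \/ l = l' /\ m = - m'].
Proof.
move=> Mu H.
(* Moving [M^T] to the other side makes the equation linear in [M] and [M'], so that it splits into
   four intertwining equations, one per block. *)
have {}H y : Bv a l m y *m M = (c *: invmx M^T) *m Bv a l' m' y.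
  rewrite -scalemxAl scalemxAr -H -!mulmxA mulKmx //.
  by rewrite unitmx_tr.
move: (c *: _) H => M' H.
rewrite -[M](@submxK F 3 3 3 3) -[M'](@submxK F 3 3 3 3) in H *.
move: (@ulsubmx F 3 3 3 3 M) (@ursubmx F 3 3 3 3 M) (@dlsubmx F 3 3 3 3 M)
  (@drsubmx F 3 3 3 3 M) => X Y Z W in H *.
move: (@ulsubmx F 3 3 3 3 M') (@ursubmx F 3 3 3 3 M') (@dlsubmx F 3 3 3 3 M')
  (@drsubmx F 3 3 3 3 M') => X' Y' Z' W' in H *.
have {}H y : [/\ Jv a l m y *m Z = - Y' *m Jv a l' (- m') y,
    Jv a l m y *m W = X' *m Jv a l' m' y,
    Jv a l (- m) y *m X = W' *m Jv a l' (- m') y &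
    Jv a l (- m) y *m Y = - Z' *m Jv a l' m' y].
  move: (H y); rewrite !BvE !(@mulmx_block F 3 3 3 3 3 3).
  rewrite !mul0mx !mulmx0 !add0r !addr0 => /(@eq_block_mx F 3 3 3 3) [].
  rewrite !mulmxN !mulNmx => -> -> /oppr_inj -> e.
  by split=> //; rewrite -e opprK.
have [z [-> _ z0]] : exists c, [/\ Z = c%:M, - Y' = c%:M & c = 0 \/ l = l' /\ m = - m'].
  by apply: (@Jv_intertwine a) => y; case: (H y).
have [w [-> _ w0]] : exists c, [/\ W = c%:M, X' = c%:M & c = 0 \/ l = l' /\ m = m'].
  by apply: (@Jv_intertwine a) => y; case: (H y).
have [x [-> _ x0]] : exists c, [/\ X = c%:M, W' = c%:M & c = 0 \/ l = l' /\ - m = - m'].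
  by apply: (@Jv_intertwine a) => y; case: (H y).
have [y [-> _ y0]] : exists c, [/\ Y = c%:M, - Z' = c%:M & c = 0 \/ l = l' /\ - m = m'].
  by apply: (@Jv_intertwine a) => y; case: (H y).
exists x, y, z, w; split=> //.
  by case: x0 => [?|[? /oppr_inj]]; [case: w0|]; auto.
by case: y0 => [?|[? <-]]; [case: z0|rewrite opprK]; auto.
Qed.

End Pencil.

(** * Pseudo-isometries that act on [F^3] by a homothety *)

Section ScalarPisom.
Variable F : finFieldType.
Implicit Types (a l m : F).
Hypothesis two_neq0 : 2 != 0 :> F.

(** The target point may differ from the source, because dividing out a scaling of the curve moves
    the point. *)
Definition scalpisom a l m l' m' : {set 'M[F]_6 * F} :=
  [set p | [&& p.1 \in unitmx, p.2 != 0 &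
     [forall y, p.1^T *m Bv a l m y *m p.1 == p.2 *: Bv a l' m' y]]].

Lemma scalpisomP a l m l' m' M c :
  reflect [/\ M \in unitmx, c != 0 &
             forall y, M^T *m Bv a l m y *m M = c *: Bv a l' m' y]
          ((M, c) \in scalpisom a l m l' m').
Proof.
rewrite inE /=; apply: (iffP and3P) => -[? ?].
  by move/forallP=> H; split=> // y; apply/eqP.
by move=> H; split=> //; apply/forallP=> y; apply/eqP.
Qed.

Lemma smx_unit (x y z w : F) : (smx x y z w \in unitmx) = (x * w - y * z != 0).
Proof.
have mulE (x1 y1 z1 w1 x2 y2 z2 w2 : F) : smx x1 y1 z1 w1 *m smx x2 y2 z2 w2 =
    smx (x1 * x2 + y1 * z2) (x1 * y2 + y1 * w2) (z1 * x2 + w1 * z2) (z1 * y2 + w1 * w2).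
  by rewrite /smx (@mulmx_block F 3 3 3 3 3 3) -!scalar_mxM -!raddfD.
have m1E (x1 : F) : smx x1 0 0 x1 = x1%:M.
  by rewrite /smx (raddf0 (@scalar_mx F 3)) -(@scalar_mx_block F 3 3).
have m00 : smx (0 : F) 0 0 0 = 0 by rewrite (m1E 0) raddf0.
have adj : smx x y z w *m smx w (- y) (- z) x = (x * w - y * z)%:M.
  by rewrite mulE -m1E; congr smx; ring.
apply/idP/idP => [u|d0].
  (* A unit with vanishing [x * w - y * z] would have zero adjugate, hence be zero itself. *)
  apply: contraTneq u => d0; apply/negP=> u.
  have : smx w (- y) (- z) x = 0.
    by apply: (can_inj (mulKmx u)); rewrite adj d0 mulmx0 raddf0.
  rewrite -[RHS]m00 => /smx_inj [w0 /eqP y0 /eqP z0 x0].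
  move: y0 z0 u; rewrite !oppr_eq0 => /eqP -> /eqP ->.
  by rewrite x0 w0 m00 unitmxE det0 unitr0.
have : (smx x y z w *m smx w (- y) (- z) x) \in unitmx.
  by rewrite adj unitmxE det_scalar unitfE expf_eq0.
by rewrite unitmx_mul => /andP[].
Qed.

Lemma Bv_neq0 a l m : Bv a l m (vec3 1 0 0) != 0.
Proof.
apply/eqP=> /matrixP/(_ (lshift 3 (1 : 'I_3)) (rshift 3 (2%:R : 'I_3))).
by rewrite BvE (@block_mxEur F 3 3 3 3) !mxE => /eqP; rewrite /= oner_eq0.
Qed.

Lemma Bv_scale_inj a l m (c d : F) :
  (forall y, c *: Bv a l m y = d *: Bv a l m y) -> c = d.
Proof.
move/(_ (vec3 1 0 0))/eqP; rewrite -subr_eq0 -scalerBl scaler_eq0.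
by rewrite (negPf (Bv_neq0 _ _ _)) orbF subr_eq0 => /eqP.
Qed.

Lemma Bv_smx_diag a l m (x w : F) y :
  (smx x 0 0 w)^T *m Bv a l m y *m smx x 0 0 w = (x * w) *: Bv a l m y.
Proof.
rewrite Bv_smx BvE (@scale_block_mx F 3 3 3 3).
by rewrite !(mulr0, mul0r, scale0r, scaler0, sub0r, subr0, scalerN).
Qed.

Lemma Bv_smx_antidiag a l m (x z : F) y :
  (smx 0 x z 0)^T *m Bv a l m y *m smx 0 x z 0 = (- (x * z)) *: Bv a l (- m) y.
Proof.
rewrite Bv_smx BvE (@scale_block_mx F 3 3 3 3) opprK.
by rewrite !(mulr0, mul0r, scale0r, scaler0, sub0r, subr0, scalerN, scaleNr, opprK).
Qed.

Lemma Bv_smx_sym a l (x z w y : F) v :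
  (smx x y z w)^T *m Bv a l 0 v *m smx x y z w = (x * w - y * z) *: Bv a l 0 v.
Proof.
rewrite Bv_smx BvE oppr0 (@scale_block_mx F 3 3 3 3) !subrr !scaler0.
by rewrite !scalerN !scalerBl opprB.
Qed.

Lemma neq_opp m : m != 0 -> m <> - m.
Proof.
move=> m0 /eqP; rewrite -addr_eq0 -mulr2n -mulr_natl mulf_eq0 (negPf two_neq0).
by rewrite (negPf m0).
Qed.

Lemma scalpisom_shape a l m l' m' M c : (M, c) \in scalpisom a l m l' m' ->
  exists (x y z w : F), [/\ M = smx x y z w, x * w - y * z != 0,
    x = 0 /\ w = 0 \/ l = l' /\ m = m' & y = 0 /\ z = 0 \/ l = l' /\ m = - m'].
Proof.
case/scalpisomP=> Mu _ /(Bv_pisom_scalar Mu) [x [y [z [w [eM ? ?]]]]].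
by exists x, y, z, w; split=> //; rewrite -smx_unit -eM.
Qed.

(** For [m = 0] the pencil [J] is symmetric, so every invertible 2 x 2 matrix acts, with its
    determinant as factor. The factor is determined by [M] because the form is nonzero. *)
Lemma card_scalpisom0 a l l' m' :
  #|scalpisom a l 0 l' m'| = (((l' == l) && (m' == 0%R)) * #|'GL_2[F]%g|)%N.
Proof.
case: (boolP (_ && _)) => [/andP[/eqP -> /eqP ->]|neq]; last first.
  apply/eqP; rewrite mul0n cards_eq0; apply/eqP/setP=> -[M c]; rewrite [RHS]inE.
  apply: contraNF neq => /scalpisom_shape [x [y [z [w []]]]].
  case=> [_ d0 [[x0 _]|[-> <-]] [[y0 _]|[ll' /esym m0]]]; rewrite ?eqxx //.
    by rewrite x0 y0 !mul0r subr0 eqxx in d0.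
  by rewrite ll' -oppr_eq0 m0 !eqxx.
rewrite mul1n; pose f (A : {'GL_2[F]}) :=
  (smx (GLval A 0 0) (GLval A 0 1) (GLval A 1 0) (GLval A 1 1), \det (GLval A)).
have f_inj : injective f.
  move=> A A' [/smx_inj [e0 e1 e2 e3] _]; apply/val_inj/matrixP=> i j /=.
  by case: i j => [[|[|//]] Hi] [[|[|//]] Hj];
    [move: e0|move: e1|move: e2|move: e3]; congr (_ = _); congr fun_of_matrix; apply/val_inj.
rewrite -(card_imset _ f_inj); apply: eq_card => -[M c].
apply/idP/imsetP => [Mc|[A _ [-> ->]]].
  have /scalpisom_shape [x [y [z [w [eM d0 _ _]]]]] := Mc.
  pose A : 'M[F]_2 := \matrix_(i, j) (if i == 0 then if j == 0 then x else y
                            else if j == 0 then z else w).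
  have dA : \det A = x * w - y * z by rewrite det_mx22 !mxE.
  have uA : A \is a GRing.unit by rewrite unitmxE dA unitfE.
  exists (FinRing.Unit uA); first by rewrite !inE.
  rewrite /f /= dA !mxE /= -eM; congr pair.
  apply: (@Bv_scale_inj a l 0) => v; case/scalpisomP: Mc => _ _ <-.
  by rewrite eM Bv_smx_sym.
have uA : GLval A \in unitmx := GL_unit A.
apply/scalpisomP; split.
- by rewrite smx_unit -det_mx22 -unitfE -unitmxE.
- by rewrite -unitfE -unitmxE.
by move=> v; rewrite Bv_smx_sym det_mx22.
Qed.

(** Since [m] and [-m] differ, only diagonal matrices (target [P]) or antidiagonal ones (target
    [-P]) survive; either kind has two free nonzero parameters. *)
Lemma card_scalpisom a l m l' m' : m != 0 ->
  #|scalpisom a l m l' m'| =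
  (((l' == l) && ((m' == m) || (m' == - m))) * (#|F|.-1) ^ 2)%N.
Proof.
move=> m0; case: (boolP (_ && _)) => [/andP[/eqP -> mm']|neq]; last first.
  apply/eqP; rewrite mul0n cards_eq0; apply/eqP/setP=> -[M c]; rewrite [RHS]inE.
  apply: contraNF neq => /scalpisom_shape [x [y [z [w []]]]].
  case=> [_ d0 [[x0 _]|[-> <-]] [[y0 _]|[ll' m'E]]]; rewrite ?eqxx //.
    by rewrite x0 y0 !mul0r subr0 eqxx in d0.
  by rewrite ll' m'E opprK !eqxx orbT.
rewrite mul1n.
have cardX : #|[set x : F * F | (x.1 != 0) && (x.2 != 0)]| = (#|F|.-1 ^ 2)%N.
  rewrite -mulnn -(cardC1 (0 : F)) -cardX; apply: eq_card => -[x y].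
  by rewrite !inE.
rewrite -cardX.
case/orP: mm' => /eqP ->.
  have f_inj : injective (fun x : F * F => (smx x.1 0 0 x.2, x.1 * x.2)).
    by move=> [x y] [x' y'] /= [/smx_inj [-> _ _ ->]].
  rewrite -(card_imset _ f_inj); apply: eq_card => -[M c].
  apply/idP/imsetP => [Mc|[[x w]]].
    have /scalpisom_shape [x [y [z [w [eM d0 _ yz0]]]]] := Mc.
    have {yz0}[y0 z0] : y = 0 /\ z = 0 by case: yz0 => [|[_ /(neq_opp m0)]].
    rewrite {}y0 {}z0 mulr0 subr0 mulf_eq0 negb_or in eM d0 *.
    exists (x, w); first by rewrite inE.
    rewrite eM; congr pair; apply: (@Bv_scale_inj a l m) => v.
    by case/scalpisomP: Mc => _ _ <-; rewrite eM Bv_smx_diag.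
  rewrite inE /= => /andP[x0 w0] [-> ->].
  apply/scalpisomP; split; rewrite ?smx_unit ?mulr0 ?subr0 ?mulf_neq0 //.
  by move=> v; rewrite Bv_smx_diag.
have f_inj : injective (fun x : F * F => (smx 0 x.1 x.2 0, - (x.1 * x.2))).
  by move=> [x y] [x' y'] /= [/smx_inj [_ -> -> _]].
rewrite -(card_imset _ f_inj); apply: eq_card => -[M c].
apply/idP/imsetP => [Mc|[[y z]]].
  have /scalpisom_shape [x [y [z [w [eM d0 xw0 _]]]]] := Mc.
  have {xw0}[x0 w0] : x = 0 /\ w = 0 by case: xw0 => [|[_ /(neq_opp m0)]].
  rewrite {}x0 {}w0 mulr0 sub0r oppr_eq0 mulf_eq0 negb_or in eM d0 *.
  exists (y, z); first by rewrite inE.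
  rewrite eM; congr pair; apply: (@Bv_scale_inj a l (- m)) => v.
  by case/scalpisomP: Mc => _ _ <-; rewrite eM Bv_smx_antidiag.
rewrite inE /= => /andP[x0 w0] [-> ->].
apply/scalpisomP; split; rewrite ?smx_unit ?mulr0 ?sub0r ?oppr_eq0 ?mulf_neq0 //.
by move=> v; rewrite Bv_smx_antidiag.
Qed.

End ScalarPisom.

(** * Pseudo-isometries, scalings and translations *)

Section Pisom.
Variable F : finFieldType.
Implicit Types (th : F * F * F) (M : 'M[F]_6) (N : 'M[F]_3).

Definition Bt th y := Bv th.1.1 th.1.2 th.2 y.

(* For (M, N) in pisom th th', v |-> M v and w |-> N^T w intertwine the        *)
(* bilinear maps tEP of th' and th: N is the transpose of the map on F^3.      *)
Definition pisom th th' : {set 'M[F]_6 * 'M[F]_3} :=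
  [set p | [&& p.1 \in unitmx, p.2 \in unitmx &
     [forall y, p.1^T *m Bt th y *m p.1 == Bt th' (p.2 *m y)]]].

Lemma pisomP th th' M N :
  reflect [/\ M \in unitmx, N \in unitmx &
             forall y, M^T *m Bt th y *m M = Bt th' (N *m y)]
          ((M, N) \in pisom th th').
Proof.
rewrite inE /=; apply: (iffP and3P) => -[? ?].
  by move/forallP=> H; split=> // y; apply/eqP.
by move=> H; split=> //; apply/forallP=> y; apply/eqP.
Qed.

Lemma pisom1 th : (1%:M, 1%:M) \in pisom th th.
Proof. by apply/pisomP; split; rewrite ?unitmx1 // => y; rewrite trmx1 !mul1mx mulmx1. Qed.

Lemma pisom_mul th1 th2 th3 M N M' N' :
  (M, N) \in pisom th1 th2 -> (M', N') \in pisom th2 th3 ->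
  (M *m M', N' *m N) \in pisom th1 th3.
Proof.
move=> /pisomP[Mu Nu H] /pisomP[Mu' Nu' H']; apply/pisomP.
split=> [||y]; rewrite ?unitmx_mul ?Mu ?Nu ?Mu' ?Nu' //.
by rewrite -[N' *m N *m y]mulmxA -H' -H trmx_mul !mulmxA.
Qed.

Lemma pisom_inv th1 th2 M N :
  (M, N) \in pisom th1 th2 -> (invmx M, invmx N) \in pisom th2 th1.
Proof.
move=> /pisomP[Mu Nu H]; apply/pisomP.
split=> [||y]; rewrite ?unitmx_inv //.
by rewrite -{1}[y](mulKVmx Nu) -H trmx_inv !mulmxA mulVmx ?unitmx_tr // mul1mx mulmxK.
Qed.

Lemma card_pisom th th' : pisom th th' != finset.set0 -> #|pisom th th'| = #|pisom th th|.
Proof.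
case/set0Pn=> -[M0 N0] H0; have /pisomP[Mu Nu _] := H0.
pose f (p : 'M[F]_6 * 'M[F]_3) := (p.1 *m M0, N0 *m p.2).
have f_inj : injective f.
  move=> [M N] [M' N'] [/(can_inj (mulmxK Mu)) -> eN].
  by rewrite (can_inj (mulKmx Nu) eN).
transitivity #|f @: pisom th th|; last exact: card_imset.
apply: eq_card => -[M N].
apply/idP/imsetP => [H|[[M' N'] H [-> ->]]]; last exact: pisom_mul H H0.
exists (M *m invmx M0, invmx N0 *m N); last by rewrite /f /= mulmxKV // mulKVmx.
by apply: pisom_mul H (pisom_inv H0).
Qed.

End Pisom.

(** * Lifting the scalings [(x, y) |-> (u^2 x, u^3 y)] *)

Section Scaling.
Variable F : finFieldType.
Implicit Types (a l m u c : F) (y : 'cV[F]_3).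

Definition dg3 (x y z : F) : 'M[F]_3 := diag_mx (\row_i [:: x; y; z]`_i).

Lemma dg3E (x y z : F) i j : dg3 x y z i j = ([:: x; y; z]`_i) *+ (i == j).
Proof. by rewrite !mxE. Qed.

Lemma dg3_unit (x y z : F) : x != 0 -> y != 0 -> z != 0 -> dg3 x y z \in unitmx.
Proof.
move=> x0 y0 z0; rewrite unitmxE det_diag unitfE !big_ord_recl big_ord0 !mxE /=.
by rewrite !mulf_neq0 ?oner_eq0.
Qed.

Definition dg6 u : 'M[F]_6 := block_mx (dg3 u (u ^+ 2) 1) 0 0 (dg3 u (u ^+ 2) 1) : 'M_(3 + 3).

Lemma dg6_unit u : u != 0 -> dg6 u \in unitmx.
Proof.
move=> u0; rewrite unitmxE /dg6 (@det_ublock F 3 3) unitrM andbb.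
by rewrite -unitmxE dg3_unit ?expf_neq0 ?oner_eq0.
Qed.

(** Rows and columns get the weights 1, 2, 0, which add up to the weights of the entries. Only the
    entry (1,1), which contains [a + l ^+ 2], uses [u ^+ 4 * a = a]. *)
Lemma Jv_scaling a l m u y : u != 0 -> u ^+ 4 * a = a ->
  Jv a l m (dg3 (u ^+ 2) (u ^+ 3) 1 *m y) =
  dg3 u (u ^+ 2) 1 *m Jv a (l / u ^+ 2) (m / u ^+ 3) y *m dg3 u (u ^+ 2) 1.
Proof.
move=> u0 ua; rewrite -[in LHS]ua.
apply: mx3_ext; split; rewrite !mulmx3E !JvE !mulmx3E !dg3E /= ?mulr1n ?mulr0n; by field.
Qed.

Lemma Bv_scaling a l m u y : u != 0 -> u ^+ 4 * a = a ->
  Bv a l m (dg3 (u ^+ 2) (u ^+ 3) 1 *m y) =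
  dg6 u *m Bv a (l / u ^+ 2) (m / u ^+ 3) y *m dg6 u.
Proof.
move=> u0 ua; rewrite !BvE !Jv_scaling // !(@mulmx_block F 3 3 3 3 3 3).
by rewrite !(mulmx0, mul0mx, addr0, add0r, mulmxN, mulNmx, mulNr).
Qed.

Lemma dg6_tr u : (dg6 u)^T = dg6 u.
Proof. rewrite /dg6 (@tr_block_mx F 3 3 3 3) !trmx0 /dg3 !tr_diag_mx /=; reflexivity.
Qed.

End Scaling.

(** * Lifting the translation by a finite flex [(s, t)] whose tangent has slope [m] *)

Section Translation.
Variable F : fieldType.
Hypothesis two_neq0 : 2 != 0 :> F.

Variables (s t m a : F).
Hypotheses (t0 : t != 0) (mE : m ^+ 2 = 3 * s) (aE : a = 2 * t * m - 3 * s ^+ 2).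

Implicit Types (y : 'cV[F]_3).

Definition mat3 (r0 r1 r2 : seq F) : 'M[F]_3 :=
  \matrix_(i < 3, j < 3) (nth [::] [:: r0; r1; r2] i)`_j.

(* The tangent lines at the flexes O, (s, t), (s, -t) are C = 0, B = 0, A = 0 *)
(* with A = y + t z + m X, B = - (y - t z - m X), C = - 2 t z, X = x - s z,   *)
(* and the cubic is ABC = 2 t X^3 with A + B + C = 2 m X: translation by       *)
(* (s, t) permutes A, B, C cyclically and fixes X.                            *)
Let A y := y 1 0 + t * y 2%:R 0 + m * (y 0 0 - s * y 2%:R 0).
Let B y := - (y 1 0 - t * y 2%:R 0 - m * (y 0 0 - s * y 2%:R 0)).
Let C y := - 2 * t * y 2%:R 0.
Let X y := y 0 0 - s * y 2%:R 0.

(** Solved from [A -> B -> C -> A] with [X] fixed. The middle column is [-1 / (2 t)] times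
    [(s, t, 1)], so [O] goes to the flex. *)
Definition transl : 'M[F]_3 :=
  mat3 [:: 1 - s * m / (2 * t); - s / (2 * t); - s - s * (t - m * s) / (2 * t)]
       [:: m / 2; - 1 / 2; 3 / 2 * t - s * m / 2]
       [:: - m / (2 * t); - 1 / (2 * t); - (t - m * s) / (2 * t)].

Lemma translE y :
  [/\ A (transl *m y) = B y, B (transl *m y) = C y, C (transl *m y) = A y &
      X (transl *m y) = X y].
Proof.
split; rewrite /A /B /C /X !mulmx3E !mxE /=; field; rewrite ?t0 ?two_neq0 //.
Qed.

Lemma mat3_unit (r0 r1 r2 : seq F) :
  r0`_0 * (r1`_1 * r2`_2 - r1`_2 * r2`_1) - r0`_1 * (r1`_0 * r2`_2 - r1`_2 * r2`_0)
   + r0`_2 * (r1`_0 * r2`_1 - r1`_1 * r2`_0) != 0 ->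
  mat3 r0 r1 r2 \in unitmx.
Proof.
by rewrite unitmxE unitfE det_mx33 !mxE.
Qed.

Lemma transl_unit : transl \in unitmx.
Proof.
apply: mat3_unit => /=.
set d := (X in X != 0); have -> : d = 1 by rewrite /d; field; rewrite ?t0 ?two_neq0.
exact: oner_neq0.
Qed.

Variables (l mu : F).
Hypothesis three_neq0 : 3 != 0 :> F.
Hypothesis onP : mu ^+ 2 = (t + m * (l - s)) ^+ 2 + (l - s) ^+ 3.

Let xi := l - s.
(** The height at [x = l] of the tangent at [(s, t)], minus [mu]: it vanishes exactly when the point
    [(l, mu)] lies on that tangent. *)
Let k := t - mu + m * xi.

(** Covariance under [T] need only be checked on an equivalent pencil [K], chosen so that it is
    visible there. *)
Lemma pencil_transport (J K : 'cV[F]_3 -> 'M[F]_3) (T L R E1 E2 : 'M[F]_3) :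
  [/\ L \in unitmx, R \in unitmx, E1 \in unitmx & E2 \in unitmx] ->
  (forall y, L *m J y *m R = K y) -> (forall y, K y = E1 *m K (T *m y) *m E2) ->
  exists U V, [/\ U \in unitmx, V \in unitmx & forall y, U *m J y *m V = J (T *m y)].
Proof.
move=> [Lu Ru Eu1 Eu2] HK HT.
exists (invmx L *m invmx E1 *m L), (R *m invmx E2 *m invmx R).
split=> [||y]; rewrite ?unitmx_mul ?unitmx_inv ?Lu ?Ru ?Eu1 ?Eu2 //.
have JE z : J z = invmx L *m K z *m invmx R.
  by rewrite -HK !mulmxA mulVmx // mul1mx mulmxK.
have KE : K (T *m y) = invmx E1 *m K y *m invmx E2.
  by rewrite (HT y) !mulmxA mulVmx // mul1mx mulmxK.
by rewrite [J (T *m y)]JE KE -HK !mulmxA.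
Qed.

(** A pencil equivalent to [J] whose entries are multiples of [A], [B], [C], [X]; the cyclic
    permutation of these is undone by the monomial matrices [E1] and [E2] below. *)
Let K y := mat3 [:: - B y; xi * X y; X y / (2 * t)]
                [:: X y; A y; - xi / (2 * t * k) * X y]
                [:: xi * X y; k * X y; C y / (2 * t)].

Lemma J_transl_generic : k != 0 ->
  exists U V, [/\ U \in unitmx, V \in unitmx &
    forall y, U *m Jv a l mu y *m V = Jv a l mu (transl *m y)].
Proof.
move=> k0; pose E := xi ^+ 2 + 2 * m * k.
(* The curve equation at [(l, mu)] reads [k (2 t + 2 m xi - k) = - xi^3]. Solving it for [t] leaves
   [m], [k], [xi] as independent parameters, so [field] can decide the matrix identities. *)
have tE : t = (k ^+ 2 - 2 * m * k * xi - xi ^+ 3) / (2 * k).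
  have kk : k * (2 * t + 2 * m * xi - k) = - xi ^+ 3.
    have -> : k * (2 * t + 2 * m * xi - k) = (t + m * xi) ^+ 2 - mu ^+ 2.
      by rewrite /k; ring.
    by rewrite onP -/xi; ring.
  have -> : xi ^+ 3 = - (k * (2 * t + 2 * m * xi - k)) by rewrite kk opprK.
  by field; rewrite k0 two_neq0.
have lE : l = xi + s by rewrite /xi subrK.
have muE : mu = t + m * xi - k by rewrite /k; ring.
have sE : s = m ^+ 2 / 3 by rewrite mE; field.
pose L := mat3 [:: (k * m - E) / (2 * t * k); k / (2 * t * k); k * s / (2 * t * k)]
               [:: (k - xi * m) / (2 * t * k); - xi / (2 * t * k); - xi * s / (2 * t * k)]
               [:: 0; 0; 1].
pose R := mat3 [:: k - m * xi; E - m * k; 0] [:: xi; k; 0] [:: s * xi; s * k; 1].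
pose E1 := mat3 [:: 0; 1; 0] [:: 0; 0; - 1 / k] [:: - 1; 0; 0].
pose E2 := mat3 [:: 0; 0; 1 / (2 * t)] [:: - 1; 0; 0] [:: 0; - 2 * t * k; 0].
have n0 : k ^+ 2 - 2 * m * k * xi - xi ^+ 3 != 0.
  by apply: contraNneq t0; rewrite tE => ->; rewrite mul0r.
apply: (@pencil_transport (Jv a l mu) K transl L R E1 E2).
- split; apply: mat3_unit => /=.
  + set d := (X in X != 0); have -> : d = - 1 / (2 * t * k).
      by rewrite /d /E tE; field; rewrite k0 n0 two_neq0.
    by rewrite mulf_neq0 ?invr_neq0 ?oppr_eq0 ?oner_neq0 ?mulf_neq0.
  + set d := (X in X != 0); have -> : d = 2 * t * k.
      by rewrite /d /E tE; field; rewrite k0 two_neq0.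
    by rewrite !mulf_neq0.
  + set d := (X in X != 0); have -> : d = 1 / k by rewrite /d; field.
    by rewrite mulf_neq0 ?invr_neq0 ?oner_neq0.
  + set d := (X in X != 0); have -> : d = k by rewrite /d; field; rewrite t0 two_neq0.
    by [].
- move=> y; rewrite /K /A /B /C /X.
  apply: mx3_ext; split; rewrite !mulmx3E !JvE !mxE /= muE lE aE sE /E tE;
    field; rewrite ?k0 ?n0 ?two_neq0 ?three_neq0 //.
move=> y; rewrite /K; have [-> -> -> ->] := translE y.
apply: mx3_ext; split; rewrite !mulmx3E !mxE /=.
all: by field; rewrite ?k0 ?t0 ?two_neq0.
Qed.

Let K0 y := mat3 [:: A y; 0; X y] [:: X y; - B y; 0] [:: 0; X y; C y / (2 * t)].

(* Here k = 0 means that (l, mu) is the flex (s, t) itself. *)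
Lemma J_transl_special : k = 0 ->
  exists U V, [/\ U \in unitmx, V \in unitmx &
    forall y, U *m Jv a l mu y *m V = Jv a l mu (transl *m y)].
Proof.
move=> k0.
have muE' : mu = t + m * xi by rewrite -[LHS]addr0 -k0 /k; ring.
have xi0 : xi = 0.
  have /eqP : xi ^+ 3 = 0.
    by apply: (addrI (mu ^+ 2)); rewrite addr0 [RHS]onP muE' -/xi.
  by rewrite expf_eq0 => /eqP.
have lE : l = s by rewrite -[LHS](subrK s) -/xi xi0 add0r.
have muE : mu = t by rewrite muE' xi0 mulr0 addr0.
have sE : s = m ^+ 2 / 3 by rewrite mE; field.
pose L := mat3 [:: m; 1; s] [:: 1; 0; 0] [:: 0; 0; 1].
pose R := mat3 [:: 1; - m; 0] [:: 0; 1; 0] [:: 0; s; 1].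
pose E1 := mat3 [:: 0; 0; 1] [:: 1 / (2 * t); 0; 0] [:: 0; - 1 / (2 * t); 0].
pose E2 := mat3 [:: 0; - 2 * t; 0] [:: 0; 0; 1] [:: 2 * t; 0; 0].
have tt0 : 2 * t != 0 by rewrite mulf_neq0.
apply: (@pencil_transport (Jv a l mu) K0 transl L R E1 E2).
- split; apply: mat3_unit => /=.
  + set d := (X in X != 0); have -> : d = - 1 by rewrite /d; ring.
    by rewrite oppr_eq0 oner_neq0.
  + set d := (X in X != 0); have -> : d = 1 by rewrite /d; ring.
    by rewrite oner_neq0.
  + set d := (X in X != 0); have -> : d = - (2 * t)^-1 ^+ 2 by rewrite /d; field; rewrite t0.
    by rewrite oppr_eq0 expf_neq0 ?invr_neq0.
  + set d := (X in X != 0); have -> : d = - (2 * t) ^+ 2 by rewrite /d; ring.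
    by rewrite oppr_eq0 expf_neq0.
- move=> y; rewrite /K0 /A /B /C /X.
  apply: mx3_ext; split; rewrite !mulmx3E !JvE !mxE /= lE muE aE sE;
    field; rewrite ?t0 ?two_neq0 ?three_neq0 //.
move=> y; rewrite /K0; have [-> -> -> ->] := translE y.
apply: mx3_ext; split; rewrite !mulmx3E !mxE /=;
  field; rewrite ?t0 ?two_neq0 //.
Qed.

Lemma J_transl :
  exists U V, [/\ U \in unitmx, V \in unitmx &
    forall y, U *m Jv a l mu y *m V = Jv a l mu (transl *m y)].
Proof. by case: (eqVneq k 0) => [/J_transl_special|/J_transl_generic]. Qed.

Lemma B_transl :
  exists M : 'M[F]_6, M \in unitmx /\
    forall y, M^T *m Bv a l mu y *m M = Bv a l mu (transl *m y).
Proof.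
have [U [V [Uu Vu H]]] := J_transl.
exists (block_mx U^T 0 0 V : 'M_(3 + 3)); split.
  by rewrite unitmxE (@det_ublock F 3 3) unitrM -!unitmxE unitmx_tr Uu.
move=> y; rewrite !BvE (@tr_block_mx F 3 3 3 3) !(@mulmx_block F 3 3 3 3 3 3).
rewrite !(trmx0, trmxK, mul0mx, mulmx0, addr0, add0r) H mulmxN mulNmx.
by rewrite -!(JvN _ _ mu) -H !trmx_mul !mulmxA.
Qed.

End Translation.

(** * Counting the linear pseudo-isometries *)

Section Cubic.

Definition cubic (R : comNzRingType) (a b x y z : R) : R :=
  y ^+ 2 * z - x ^+ 3 - a * x * z ^+ 2 - b * z ^+ 3.

Lemma det_Jv (F : fieldType) (a b l m : F) y : m ^+ 2 = l ^+ 3 + a * l + b ->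
  \det (Jv a l m y) = cubic a b (y 0 0) (y 1 0) (y 2%:R 0).
Proof.
move=> E; rewrite det_mx33 !JvE /= /cubic.
have -> : b = m ^+ 2 - l ^+ 3 - a * l by rewrite E; ring.
ring.
Qed.

(** Swapping the two block columns by [S] makes the matrix block diagonal. Both blocks have the
    cubic as determinant up to sign, since [(l, -m)] lies on the curve as well. *)
Lemma det_Bv (F : fieldType) (a b l m : F) : m ^+ 2 = l ^+ 3 + a * l + b ->
  exists2 c, c != 0 & forall y,
  \det (Bv a l m y) * c = cubic a b (y 0 0) (y 1 0) (y 2%:R 0) ^+ 2.
Proof.
move=> E; pose S : 'M[F]_6 := block_mx 0 1%:M 1%:M 0 : 'M_(3 + 3).
have SS : S *m S = 1%:M.
  rewrite /S (@mulmx_block F 3 3 3 3 3 3) !mulmx0 !mul0mx !mul1mx !addr0 !add0r.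
  by rewrite -(@scalar_mx_block F 3 3).
exists (- \det S).
  rewrite oppr_eq0 -unitfE -unitmxE.
  by have [] := mulmx1_unit SS.
move=> y; rewrite mulrN -det_mulmx /S BvE (@mulmx_block F 3 3 3 3 3 3).
rewrite !mulmx0 !mul0mx !mulmx1 !addr0 !add0r (@det_ublock F 3 3).
have E' : (- m) ^+ 2 = l ^+ 3 + a * l + b by rewrite sqrrN.
by rewrite -scaleN1r detZ (det_Jv y E) (det_Jv y E'); ring.
Qed.

Lemma Bv_lin (F : fieldType) (a l m : F) y :
  Bv a l m y = y 0 0 *: Bv a l m (vec3 1 0 0) + y 1 0 *: Bv a l m (vec3 0 1 0)
     + y 2%:R 0 *: Bv a l m (vec3 0 0 1).
Proof.
have JD l' m' : Jv a l' m' y = y 0 0 *: Jv a l' m' (vec3 1 0 0)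
    + y 1 0 *: Jv a l' m' (vec3 0 1 0) + y 2%:R 0 *: Jv a l' m' (vec3 0 0 1).
  apply: mx3_ext; split; rewrite JvE !mxE /=; ring.
rewrite !BvE !(@scale_block_mx F 3 3 3 3) !(@add_block_mx F 3 3 3 3).
by rewrite !scaler0 !addr0 !scalerN -!opprD -!JD.
Qed.

Lemma BvD (F : fieldType) (a l m : F) y y' :
  Bv a l m (y + y') = Bv a l m y + Bv a l m y'.
Proof.
rewrite [LHS]Bv_lin [Bv a l m y]Bv_lin [Bv a l m y']Bv_lin !mxE.
move: (Bv _ _ _ _) (Bv _ _ _ _) (Bv _ _ _ _) => U V W.
by rewrite !scalerDl [RHS]addrACA [X in _ = X + _]addrACA.
Qed.

Lemma map_Bv (F L : fieldType) (f : {rmorphism F -> L}) (a l m : F) (x y z : F) :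
  map_mx f (Bv a l m (vec3 x y z)) = Bv (f a) (f l) (f m) (vec3 (f x) (f y) (f z)).
Proof.
have mJ m' : map_mx f (Jv a l m' (vec3 x y z)) =
    Jv (f a) (f l) (f m') (vec3 (f x) (f y) (f z)).
  by apply: mx3_ext; split; rewrite JvE !mxE /=; rewrite ?rmorph0; ring.
by rewrite !BvE (@map_block_mx F L f 3 3 3 3) raddfN /= !mJ !raddf0 rmorphN.
Qed.

(** Both sides are linear in [y], so the basis vectors suffice. The lemma serves both for the
    extension to rational functions and for twisting by a field automorphism. *)
Lemma pisom_extend (F : finFieldType) (L : fieldType) (f : {rmorphism F -> L})
    th th' M N y : (M, N) \in pisom th th' ->
  (map_mx f M)^T *m Bv (f th.1.1) (f th.1.2) (f th.2) y *m map_mx f M =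
  Bv (f th'.1.1) (f th'.1.2) (f th'.2) (map_mx f N *m y).
Proof.
case/pisomP=> _ _ H.
have E x0 y0 z0 : let v := vec3 (f x0) (f y0) (f z0) in
    (map_mx f M)^T *m Bv (f th.1.1) (f th.1.2) (f th.2) v *m map_mx f M =
    Bv (f th'.1.1) (f th'.1.2) (f th'.2) (map_mx f N *m v).
  have := congr1 (map_mx f) (H (vec3 x0 y0 z0)).
  rewrite /Bt [N *m _]vec3_eta !map_mxM map_trmx !map_Bv /= => ->; congr Bv.
  apply/colP=> i; rewrite !mulmx3E !mxE /=.
  by case: (ord3P i) => -> /=; rewrite !rmorphD !rmorphM.
have := (E 1 0 0, E 0 1 0, E 0 0 1); rewrite /= !rmorph0 !rmorph1.
case=> -[e1 e2] e3; rewrite [Bv _ _ _ y]Bv_lin !mulmxDr !mulmxDl.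
rewrite -!scalemxAr -!scalemxAl e1 e2 e3 -!BvZ -!BvD; congr Bv.
rewrite !scalemxAr -!mulmxDr; congr (_ *m _); apply/colP=> i; rewrite !mxE.
by case: (ord3P i) => -> /=; ring.
Qed.

Lemma polyCX_eq0 (R : idomainType) (c : R) (q : {poly R}) :
  c%:P + 'X * q = 0 -> c = 0 /\ q = 0.
Proof.
rewrite addrC mulrC => H; have c0 : c = 0.
  by have := congr1 (fun p : {poly R} => p`_0) H; rewrite coefD coefMX coefC coef0 add0r.
split=> //; move/eqP: H; rewrite c0 addr0 mulf_eq0 polyX_eq0 orbF.
by move/eqP.
Qed.

(* Substituting (X^4, 1, X) sends the monomials of a ternary cubic to distinct *)
(* powers of X, so that its coefficients can be compared.                      *)
Lemma cubic_coefs (F : fieldType) (a b D p1 p2 p3 q1 q2 q3 r1 r2 r3 : F) :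
  let ev (p q r : F) : {poly F} := p%:P * 'X^4 + q%:P + r%:P * 'X in
  cubic a%:P b%:P (ev p1 q1 r1) (ev p2 q2 r2) (ev p3 q3 r3)
    = D%:P * cubic a%:P b%:P 'X^4 1 'X ->
  [/\ cubic a b q1 q2 q3 = 0,
      2 * q2 * p2 * q3 + q2 ^+ 2 * p3 - 3 * q1 ^+ 2 * p1
        - a * (p1 * q3 ^+ 2 + 2 * q1 * q3 * p3) - 3 * b * q3 ^+ 2 * p3 = 0 &
      p2 ^+ 2 * q3 + 2 * q2 * p2 * p3 - 3 * q1 * p1 ^+ 2
        - a * (q1 * p3 ^+ 2 + 2 * p1 * p3 * q3) - 3 * b * q3 * p3 ^+ 2 = 0] /\
  [/\ cubic a b p1 p2 p3 = - D,
     2 * q2 * r2 * q3 + q2 ^+ 2 * r3 - 3 * q1 ^+ 2 * r1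
        - a * (r1 * q3 ^+ 2 + 2 * q1 * q3 * r3) - 3 * b * q3 ^+ 2 * r3 = D,
     r2 ^+ 2 * q3 + 2 * q2 * r2 * r3 - 3 * q1 * r1 ^+ 2
        - a * (q1 * r3 ^+ 2 + 2 * r1 * r3 * q3) - 3 * b * q3 * r3 ^+ 2 = 0 &
     cubic a b r1 r2 r3 = - b * D] /\
  [/\ 2 * p2 * r2 * q3 + 2 * p2 * q2 * r3 + 2 * q2 * r2 * p3 - 6 * p1 * q1 * r1
        - 2 * a * (p1 * q3 * r3 + q1 * p3 * r3 + r1 * p3 * q3)
        - 6 * b * p3 * q3 * r3 = 0,
     p2 ^+ 2 * r3 + 2 * p2 * r2 * p3 - 3 * p1 ^+ 2 * r1
        - a * (r1 * p3 ^+ 2 + 2 * p1 * p3 * r3) - 3 * b * p3 ^+ 2 * r3 = 0 &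
     r2 ^+ 2 * p3 + 2 * p2 * r2 * r3 - 3 * p1 * r1 ^+ 2
        - a * (p1 * r3 ^+ 2 + 2 * r1 * p3 * r3) - 3 * b * p3 * r3 ^+ 2 = - a * D].
Proof.
move=> ev /eqP; rewrite -subr_eq0 => /eqP.
(* [cij] is the coefficient of [X^(4 i + j)]. The right-hand cubic contributes only in degrees 1, 3,
   6 and 12. *)
set c00 := cubic a b q1 _ _; set c10 := (X in _ -> [/\ _, X = _ & _] /\ _).
set c20 := (X in _ -> [/\ _, _ & X = _] /\ _).
set c30 := cubic a b p1 _ _; set c01 := (X in _ -> _ /\ [/\ _, X = _, _ & _] /\ _).
set c02 := (X in _ -> _ /\ [/\ _, _, X = _ & _] /\ _); set c03 := cubic a b r1 _ _.
set c11 := (X in _ -> _ /\ _ /\ [/\ X = _, _ & _]).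
set c21 := (X in _ -> _ /\ _ /\ [/\ _, X = _ & _]).
set c12 := (X in _ -> _ /\ _ /\ [/\ _, _ & X = _]).
rewrite (_ : _ - _ = c00%:P + 'X * ((c01 - D)%:P + 'X * (c02%:P + 'X *
  ((c03 + b * D)%:P + 'X * (c10%:P + 'X * (c11%:P + 'X * ((c12 + a * D)%:P + 'X *
  (0%:P + 'X * (c20%:P + 'X * (c21%:P + 'X * (0%:P + 'X * (0%:P + 'X *
  ((c30 + D)%:P + 'X * 0))))))))))))); last first.
  by rewrite /ev /c00 /c01 /c02 /c03 /c10 /c11 /c12 /c20 /c21 /c30 /cubic; ring.
case/polyCX_eq0=> e00; case/polyCX_eq0=> e01; case/polyCX_eq0=> e02; case/polyCX_eq0=> e03;
case/polyCX_eq0=> e10; case/polyCX_eq0=> e11; case/polyCX_eq0=> e12; case/polyCX_eq0=> _;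
case/polyCX_eq0=> e20; case/polyCX_eq0=> e21; case/polyCX_eq0=> _; case/polyCX_eq0=> _;
case/polyCX_eq0=> e30 _.
split; [by split | split; split => //].
- by apply/eqP; rewrite -subr_eq0 opprK e30.
- by apply/eqP; rewrite -subr_eq0 e01.
- by apply/eqP; rewrite -subr_eq0 mulNr opprK e03.
- by apply/eqP; rewrite -subr_eq0 mulNr opprK e12.
Qed.

(** Values over a finite field do not determine polynomials, so determinants are compared over the
    fractions of [F[X]], at the point [(X^4, 1, X)]. *)
Lemma pisom_cubic (F : finFieldType) (a b l m : F) (M : 'M[F]_6) (N : 'M[F]_3) :
  m ^+ 2 = l ^+ 3 + a * l + b -> (M, N) \in pisom (a, l, m) (a, l, m) ->
  let ev i : {poly F} := (N i 0)%:P * 'X^4 + (N i 1)%:P + (N i 2%:R)%:P * 'X in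
  exists2 D, D != 0 &
    cubic a%:P b%:P (ev 0) (ev 1) (ev 2%:R) = D%:P * cubic a%:P b%:P 'X^4 1 'X.
Proof.
move=> onP MN ev; have /pisomP[Mu _ _] := MN.
pose L := {fraction {poly F}}; pose f : {rmorphism F -> L} := (@tofrac {poly F}) \o polyC.
have onP' : f m ^+ 2 = f l ^+ 3 + f a * f l + f b.
  by rewrite -!(rmorphXn, rmorphM, rmorphD) onP.
have [c c0 detE] := det_Bv onP'.
have := pisom_extend f (vec3 (tofrac 'X^4) (tofrac 1) (tofrac 'X)) MN.
move/(congr1 (fun A => \det A * c)); rewrite detE.
rewrite !det_mulmx det_tr det_map_mx; set dM := \det M; set y := vec3 _ _ _.
have dM0 : dM != 0 by rewrite -unitfE -unitmxE.
rewrite (_ : _ * _ * _ * c = f dM ^+ 2 * (\det (Bv (f a) (f l) (f m) y) * c)); last by ring.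
have frac_cubic p q r : cubic (f a) (f b) (tofrac p) (tofrac q) (tofrac r) =
    tofrac (cubic a%:P b%:P p q r).
  by rewrite /cubic !(rmorphB, rmorphM, rmorphXn).
have evE i : (map_mx f N *m y) i 0 = tofrac (ev i).
  by rewrite mulmx3E !mxE /= -!rmorphM -!rmorphD mulr1.
rewrite detE !evE !mxE /= !frac_cubic -exprMn.
(* Both sides are squares, so the cubics agree up to a sign, which is absorbed in [D]. *)
rewrite -rmorphM -!rmorphXn => /eqP; rewrite tofrac_eq eqf_sqr => /orP[] /eqP E.
  by exists dM.
by exists (- dM); rewrite ?oppr_eq0 // rmorphN mulNr E opprK.
Qed.


End Cubic.

(** * Flexes and 3-torsion points *)

Section Flex.
Variables (F : finFieldType) (a b : F).
Hypotheses (two_neq0 : 2 != 0 :> F) (three_neq0 : 3 != 0 :> F).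
Hypothesis smoothE : 4 * a ^+ 3 + 27 * b ^+ 2 != 0.

Lemma smooth_pt (s t : F) : t ^+ 2 = s ^+ 3 + a * s + b -> t = 0 ->
  3 * s ^+ 2 + a != 0.
Proof.
move=> E t0; apply: contraNneq smoothE => E'.
have aE : a = - (3 * s ^+ 2) by apply/eqP; rewrite -addr_eq0 addrC E'.
have bE : b = 2 * s ^+ 3.
  by rewrite -[b](addKr (s ^+ 3 + a * s)) -E t0 aE; ring.
by rewrite aE bE; apply/eqP; ring.
Qed.

(** For a finite point, the last condition says that the tangent meets the curve three times at
    [(s, t)]: the square of the slope is the sum of the three abscissas. *)
Definition flex_pt (Q : option (F * F)) : Prop :=
  if Q is Some (s, t) then
    [/\ t ^+ 2 = s ^+ 3 + a * s + b, t != 0 &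
        ((3 * s ^+ 2 + a) / (2 * t)) ^+ 2 = 3 * s]
  else True.

Lemma ec_tors3P (Q : ecpoint a b) : reflect (flex_pt (val Q)) (Q \in ec_tors a b 3).
Proof.
rewrite inE -val_eqE /=; case: Q => [[[s t]|]] /= onQ; last first.
  by rewrite eqxx; constructor.
rewrite eqxx /=; have [tN|tN] := eqVneq t (- t).
  by rewrite /=; constructor=> -[_ /(neq_opp two_neq0)].
set q := (3 * s ^+ 2 + a) / _.
(* The abscissa of [2 Q] is [q^2 - 2 s]; it equals [s], that is [2 Q = Q] or [2 Q = - Q], exactly
   when [q^2 = 3 s]. *)
have -> : q ^+ 2 - s - s = s + (q ^+ 2 - 3 * s) by ring.
have t0 : t != 0 by apply: contra_neq tN => ->; rewrite oppr0.
rewrite /=; have [e|ne] := eqVneq s _.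
  have qs : q ^+ 2 - 3 * s = 0 by apply: (addrI s); rewrite -e addr0.
  rewrite qs addr0 subrr mulr0 sub0r opprK eqxx /=; constructor; split=> //.
    exact/eqP.
  by apply/eqP; rewrite -subr_eq0 qs.
rewrite /=; constructor=> -[_ _ e]; case/eqP: ne.
by rewrite e subrr addr0.
Qed.

Lemma ec_tors2P (Q : ecpoint a b) : (Q \in ec_tors a b 2) =
  (if val Q is Some (s, t) then t == 0 else true).
Proof.
rewrite inE -val_eqE /=; case: Q => [[[s t]|]] /= onQ; last by rewrite eqxx.
rewrite eqxx /=; have [->|t0] := eqVneq t 0; first by rewrite oppr0 eqxx.
by have /eqP/negPf -> := neq_opp two_neq0 t0.
Qed.

(** All triples with [z = 0] give [None]; on the cubic only [O] is of this kind. *)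
Definition ratio_pt (x y z : F) : option (F * F) :=
  if z == 0 then None else Some (x / z, y / z).

(** The three equations say that the cubic, restricted to the line through [q] and [p], vanishes to
    order three at [q]. The line is the image of the flex tangent [z = 0] at [O]. *)
Lemma flex_of_coefs (p1 p2 p3 q1 q2 q3 : F) :
  cubic a b q1 q2 q3 = 0 ->
  2 * q2 * p2 * q3 + q2 ^+ 2 * p3 - 3 * q1 ^+ 2 * p1
    - a * (p1 * q3 ^+ 2 + 2 * q1 * q3 * p3) - 3 * b * q3 ^+ 2 * p3 = 0 ->
  p2 ^+ 2 * q3 + 2 * q2 * p2 * p3 - 3 * q1 * p1 ^+ 2
    - a * (q1 * p3 ^+ 2 + 2 * p1 * p3 * q3) - 3 * b * q3 * p3 ^+ 2 = 0 ->
  (forall c, ~ (p1 = c * q1 /\ p2 = c * q2 /\ p3 = c * q3)) ->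
  flex_pt (ratio_pt q1 q2 q3).
Proof.
move=> e0 e1 e2 indep; rewrite /ratio_pt; have [//|q30 /=] := eqVneq q3 0.
pose s := q1 / q3; pose t := q2 / q3; pose k := p3 / q3.
(* Replacing [p] by [p - k q] keeps the line and selects its point at infinity [(v : w : 0)]; then
   [f1] is tangency and [f2] the third order of contact. *)
pose v := p1 - k * q1; pose w := p2 - k * q2.
rewrite -/s -/t.
have q1E : q1 = s * q3 by rewrite divfK.
have q2E : q2 = t * q3 by rewrite divfK.
have p1E : p1 = v + k * q1 by rewrite subrK.
have p2E : p2 = w + k * q2 by rewrite subrK.
have p3E : p3 = k * q3 by rewrite divfK.
have vw : ~ (v = 0 /\ w = 0).
  by case=> v0 w0; apply: (indep k); rewrite p1E p2E v0 w0 !add0r.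
have onQ : t ^+ 2 = s ^+ 3 + a * s + b.
  apply/eqP; rewrite -subr_eq0; apply/eqP/(mulfI (expf_neq0 3 q30)).
  by rewrite mulr0 -e0 /cubic q1E q2E; ring.
have f1 : 2 * t * w = (3 * s ^+ 2 + a) * v.
  apply/eqP; rewrite -subr_eq0; apply/eqP/(mulfI (expf_neq0 2 q30)).
  rewrite mulr0 -[RHS](subrr 0) -{1}e1 -(mulr0 (3 * k)) -e0 /cubic.
  by rewrite p1E p2E p3E q1E q2E; ring.
have f2 : w ^+ 2 = 3 * s * v ^+ 2.
  apply/eqP; rewrite -subr_eq0; apply/eqP/(mulfI q30).
  have : q3 ^+ 2 * (2 * t * w - (3 * s ^+ 2 + a) * v) = 0 by rewrite f1 subrr mulr0.
  move=> f1'; rewrite mulr0 -[RHS](subrr 0) -{1}e2.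
  have -> : 0 = 2 * k * (q3 ^+ 2 * (2 * t * w - (3 * s ^+ 2 + a) * v))
           + 3 * k ^+ 2 * cubic a b q1 q2 q3 by rewrite f1' e0 !mulr0 addr0.
  by rewrite /cubic p1E p2E p3E q1E q2E; ring.
have v0 : v != 0.
  apply/eqP=> v0; apply: vw; split=> //; apply/eqP.
  by move/eqP: f2; rewrite v0 expr0n mulr0 expf_eq0.
have t0 : t != 0.
  apply/eqP=> t0; have := smooth_pt onQ t0.
  by rewrite -(inj_eq (mulIf v0)) -f1 t0 !(mulr0, mul0r) eqxx.
split=> //; have -> : (3 * s ^+ 2 + a) / (2 * t) = w / v.
  apply/eqP; rewrite eqr_div ?(mulf_neq0 two_neq0 t0) //; apply/eqP.
  by rewrite -f1; ring.
by rewrite expr_div_n f2 mulfK // expf_neq0.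
Qed.

End Flex.

(** * Self-pseudo-isometries, sorted by the image of [O] *)

Section CountPisom.
Variables (F : finFieldType) (a b l m : F).
Hypotheses (two_neq0 : 2 != 0 :> F) (three_neq0 : 3 != 0 :> F).
Hypothesis smoothE : 4 * a ^+ 3 + 27 * b ^+ 2 != 0.
Hypothesis onP : m ^+ 2 = l ^+ 3 + a * l + b.

Let th := (a, l, m).

(** The [u] for which [(x, y) |-> (u^2 x, u^3 y)] preserves the curve. *)
Definition ec_units : {set F} := [set u | [&& u != 0, u ^+ 4 * a == a & u ^+ 6 * b == b]].

(** The second column of [N] is the image of [(0 : 1 : 0)], so these are the pairs whose [N] fixes
    [O]. *)
Definition pisomO := [set p in pisom th th | (p.2 0 1 == 0) && (p.2 2%:R 1 == 0)].

Lemma col1_neq0 (N : 'M[F]_3) : N \in unitmx -> col 1 N != 0.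
Proof.
move=> Nu; apply/eqP=> N0; have /matrixP/(_ 1 0) : col 1 (1%:M : 'M[F]_3) = 0.
  by rewrite colE -(mulVmx Nu) -mulmxA -colE N0 mulmx0.
by rewrite !mxE /= => /eqP; rewrite oner_eq0.
Qed.

Lemma unit_indep (N : 'M[F]_3) c : N \in unitmx ->
  ~ (N 0 0 = c * N 0 1 /\ N 1 0 = c * N 1 1 /\ N 2%:R 0 = c * N 2%:R 1).
Proof.
move=> Nu [e0 [e1 e2]].
have E : N *m vec3 1 (- c) 0 = 0.
  apply/colP=> i; rewrite mulmx3E !mxE /= mulr1 mulr0 addr0 mulrN mulrC.
  by case: (ord3P i) => ->; rewrite ?e0 ?e1 ?e2 mulrC subrr.
have /colP/(_ 0) : vec3 1 (- c) 0 = 0 by rewrite -(mulKmx Nu (vec3 _ _ _)) E mulmx0.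
by rewrite !mxE /= => /eqP; rewrite oner_eq0.
Qed.

(** Comparing the coefficients of the cubic kills all off-diagonal entries of [N] and leaves
    [q2^2 r3 = p1^3] on the diagonal, a cuspidal cubic parametrised by [u]. *)
Lemma pisomO_shape M N : (M, N) \in pisomO ->
  exists u c, [/\ u \in ec_units, c != 0 & N = c *: dg3 (u ^+ 2) (u ^+ 3) 1].
Proof.
rewrite inE => /andP[MN] /= /andP[/eqP q10 /eqP q30].
have [D D0 /cubic_coefs] := pisom_cubic onP MN.
rewrite q10 q30; set q2 := N 1 1.
set p1 := N 0 0; set p2 := N 1 0; set p3 := N 2%:R 0.
set r1 := N 0 2%:R; set r2 := N 1 2%:R; set r3 := N 2%:R 2%:R.
case=> -[_ e10 _] [[e30 e01 e02 e03] [e11 e21 e12]].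
have q20 : q2 != 0.
  have /pisomP[_ /col1_neq0 Nu _] := MN; apply: contraNneq Nu => q20.
  by apply/eqP/colP=> i; rewrite !mxE; case: (ord3P i) => ->.
have p30 : p3 = 0.
  apply: (mulfI (expf_neq0 2 q20)); rewrite mulr0 -[RHS]e10; ring.
have DE : D = p1 ^+ 3.
  by apply: oppr_inj; rewrite -e30 /cubic p30; ring.
have p10 : p1 != 0 by move: D0; rewrite DE expf_eq0.
have r3E : q2 ^+ 2 * r3 = p1 ^+ 3 by rewrite -DE -e01; ring.
have r30 : r3 != 0.
  by apply: contraNneq D0 => r30; rewrite DE -r3E r30 mulr0.
have r20 : r2 = 0.
  apply: (mulfI (mulf_neq0 (mulf_neq0 two_neq0 q20) r30)).
  rewrite mulr0 -[RHS]e02; ring.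
have p20 : p2 = 0.
  apply: (mulfI (mulf_neq0 (mulf_neq0 two_neq0 q20) r30)).
  rewrite mulr0 -[RHS]e11 p30; ring.
have r10 : r1 = 0.
  apply: (mulfI (mulf_neq0 three_neq0 (expf_neq0 2 p10))).
  rewrite mulr0 -[RHS]oppr0 -[in RHS]e21 p20 p30; ring.
have aE : a * p1 ^+ 2 = a * r3 ^+ 2.
  apply: (mulfI p10); apply: oppr_inj.
  have -> : - (p1 * (a * p1 ^+ 2)) = - a * D by rewrite DE; ring.
  by rewrite -e12 p20 p30 r10 r20; ring.
have bE : b * p1 ^+ 3 = b * r3 ^+ 3.
  apply: oppr_inj; rewrite -mulNr -DE -e03 /cubic r10 r20; ring.
(* The diagonal is [p1 : q2 : r3 = u^2 : u^3 : 1]. *)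
pose u := q2 / p1.
have u2 : u ^+ 2 = p1 / r3.
  rewrite /u; apply/eqP; rewrite expr_div_n eqr_div ?expf_neq0 //.
  by rewrite r3E -exprS.
have u3 : u ^+ 3 = q2 / r3 by rewrite exprSr u2 /u; field; rewrite p10 r30.
exists u, r3; split => //.
  rewrite inE mulf_neq0 ?invr_neq0 //=.
  rewrite (exprM u 2 2) (exprM u 2 3) u2 !expr_div_n; apply/andP; split; apply/eqP.
    by rewrite mulrAC [_ * a]mulrC aE mulfK // expf_neq0.
  by rewrite mulrAC [_ * b]mulrC bE mulfK // expf_neq0.
apply: mx3_ext; split; rewrite mxE dg3E /= ?mulr0n ?mulr0 ?mulr1n //.
- by rewrite u2 mulrC divfK.
- by rewrite u3 mulrC divfK.
by rewrite mulr1.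
Qed.

(** Every element factors uniquely into a homothetic pseudo-isometry from [P] to
    [(l / u^2, m / u^3)] and the lift [dg6 u] of the scaling. *)
Lemma card_pisomO : #|pisomO| =
  \sum_(u in ec_units) #|scalpisom a l m (l / u ^+ 2) (m / u ^+ 3)|.
Proof.
pose W := [set x : F * ('M[F]_6 * F) | (x.1 \in ec_units) &&
  (x.2 \in scalpisom a l m (l / x.1 ^+ 2) (m / x.1 ^+ 3))].
pose g (x : F * ('M[F]_6 * F)) := (x.2.1 *m dg6 x.1, x.2.2 *: dg3 (x.1 ^+ 2) (x.1 ^+ 3) 1).
have -> : pisomO = g @: W.
  apply/setP=> -[M N]; apply/idP/imsetP => [MN|[[u [M' c]]]].
    have [u [c [Uu c0 NE]]] := pisomO_shape MN.
    have := Uu; rewrite inE => /and3P[u0 /eqP u4 _].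
    exists (u, (M *m invmx (dg6 u), c)).
      rewrite inE /= Uu; apply/scalpisomP; move: MN; rewrite inE => /andP[/pisomP[Mu _ H] _].
      split=> [||y]; rewrite ?unitmx_mul ?unitmx_inv ?Mu ?dg6_unit //.
      rewrite trmx_mul trmx_inv dg6_tr !mulmxA -(mulmxA _ M^T) -(mulmxA _ _ M) H NE.
      rewrite -scalemxAl /Bt /= BvZ Bv_scaling // -scalemxAr -scalemxAl !mulmxA.
      by rewrite mulVmx ?dg6_unit // mul1mx mulmxK ?dg6_unit.
    by rewrite /g /= NE mulmxKV ?dg6_unit.
  rewrite inE /= => /andP[Uu /scalpisomP[Mu c0 H]] [-> ->].
  move: Uu; rewrite inE => /and3P[u0 /eqP u4 _].
  rewrite !inE /= !mxE /= !mulr0n !mulr0 eqxx !andbT; apply/and3P; split.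
  - by rewrite unitmx_mul Mu dg6_unit.
  - rewrite unitmxE detZ unitrM -unitmxE dg3_unit ?expf_neq0 ?oner_neq0 // andbT.
    by rewrite unitfE expf_neq0.
  apply/forallP=> y; apply/eqP.
  rewrite trmx_mul dg6_tr -scalemxAl /Bt /= BvZ Bv_scaling //.
  rewrite !mulmxA -(mulmxA _ M'^T) -(mulmxA _ _ M') H.
  by rewrite -scalemxAr -scalemxAl.
rewrite card_in_imset; last first.
  move=> [u [M c]] [u' [M' c']]; rewrite !inE /= => /andP[/and3P[u0 _ _] /and3P[_ c0 _]] _.
  case=> eM eN.
  have cc : c = c'.
    by have := congr1 (fun A : 'M[F]_3 => A 2%:R 2%:R) eN; rewrite !mxE /= !mulr1n !mulr1.
  have E2 := congr1 (fun A : 'M[F]_3 => A 0 0) eN.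
  have E3 := congr1 (fun A : 'M[F]_3 => A 1 1) eN.
  rewrite !mxE /= !mulr1n -cc in E2 E3.
  have {E2}E2 := mulfI c0 E2; have {E3}E3 := mulfI c0 E3.
  have uu : u = u'.
    by apply: (mulfI (expf_neq0 2 u0)); rewrite -exprSr E3 E2 exprSr.
  by rewrite -uu in eM *; rewrite (can_inj (mulmxK (dg6_unit u0)) eM) cc.
transitivity (\sum_(u in ec_units)
    \sum_(x in scalpisom a l m (l / u ^+ 2) (m / u ^+ 3)) 1)%N; last first.
  by apply: eq_bigr => u _; rewrite sum1_card.
by rewrite pair_big_dep -sum1_card /=; apply: eq_bigl => x; rewrite inE.
Qed.

Definition ec_units_stab : {set F} :=
  [set u in ec_units | (u ^+ 2 * l == l) && (u ^+ 3 * m == m)].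

Lemma eq_div_scale (x c : F) : c != 0 -> (x / c == x) = (c * x == x).
Proof.
move=> c0; rewrite -(inj_eq (mulIf c0)) divfK // eq_sym.
by rewrite mulrC.
Qed.

(** A [u] contributes exactly when it maps [P] to [P] or [-P]. If [m = 0] these [u] form the
    stabiliser. Otherwise they form the disjoint union of the stabiliser and its negative, which
    yields the factor 2. *)
Lemma card_pisomO_stab :
  #|pisomO| = (#|ec_units_stab| * (if m == 0%R then #|'GL_2[F]%g| else 2 * (#|F|.-1) ^ 2))%N.
Proof.
rewrite card_pisomO.
have stabE u : u \in ec_units ->
    (u \in ec_units_stab) = ((l / u ^+ 2 == l) && (m / u ^+ 3 == m)).
  move=> Uu; rewrite inE Uu /=; move: Uu; rewrite inE => /andP[u0 _].
  by rewrite !eq_div_scale ?expf_neq0.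
have [m0|m0] := eqVneq m 0.
  rewrite m0; under eq_bigr => u _ do rewrite card_scalpisom0 // mul0r.
  rewrite -big_distrl /=; congr (_ * _)%N.
  rewrite -sum1_card big_mkcond [RHS]big_mkcond; apply: eq_bigr => u _.
  case: ifP => [Uu|Uu]; last by rewrite inE Uu.
  by rewrite stabE // m0 mul0r !eqxx !andbT; case: (_ == _).
under eq_bigr => u _ do rewrite card_scalpisom //.
rewrite -big_distrl /= mulnA; congr (_ * _)%N.
have negU u : u \in ec_units -> - u \in ec_units.
  by rewrite !inE oppr_eq0 (exprM (- u) 2 2) (exprM (- u) 2 3) sqrrN -!exprM.
have -> : (#|ec_units_stab| * 2)%N = (#|ec_units_stab| + #|[set - u | u in ec_units_stab]|)%N.
  by rewrite card_imset ?muln2 ?addnn //; apply: oppr_inj.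
rewrite -!sum1_card (big_mkcond (mem ec_units)) (big_mkcond (mem ec_units_stab)).
rewrite (big_mkcond (mem (imset _ _))) -big_split /=; apply: eq_bigr => u _.
have -> : (u \in [set - u0 | u0 in ec_units_stab]) = (- u \in ec_units_stab).
  by rewrite -{1}[u]opprK (mem_imset _ _ oppr_inj).
case: (boolP (u \in ec_units)) => Uu; last first.
  have -> : (u \in ec_units_stab) = false by apply: contraNF Uu; rewrite inE => /andP[].
  have -> // : (- u \in ec_units_stab) = false.
  by apply: contraNF Uu; rewrite inE => /andP[/negU]; rewrite opprK.
rewrite !stabE ?negU // sqrrN.
have -> : (- u) ^+ 3 = - u ^+ 3 by ring.
rewrite invrN mulrN eqr_oppLR; case: (l / _ == l) => //=.
have [->|] := eqVneq (m / u ^+ 3) m; last by case: (_ == _).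
by have /eqP/negPf -> := neq_opp two_neq0 m0.
Qed.

(* The image of O = (0 : 1 : 0) under the projectivity N. *)
Definition ec_pt (N : 'M[F]_3) := ratio_pt (N 0 1) (N 1 1) (N 2%:R 1).

Lemma ec_pt_scale (N N' : 'M[F]_3) c : c != 0 -> col 1 N = c *: col 1 N' -> ec_pt N = ec_pt N'.
Proof.
move=> c0 /colP E; rewrite /ec_pt /ratio_pt.
have e i : N i 1 = c * N' i 1 by have := E i; rewrite !mxE.
rewrite !e mulf_eq0 (negPf c0) /=; case: eqP => // _.
by rewrite -!mulf_div divff // !mul1r.
Qed.

Lemma ec_pt_scale_inv (N N' : 'M[F]_3) : ec_pt N != None -> ec_pt N = ec_pt N' ->
  exists c, col 1 N = c *: col 1 N'.
Proof.
rewrite /ec_pt /ratio_pt; have [//|z0 _] := eqVneq (N 2%:R 1) 0.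
have [//|z0' [ex ey]] := eqVneq (N' 2%:R 1) 0.
exists (N 2%:R 1 / N' 2%:R 1); apply/colP=> i; rewrite !mxE.
case: (ord3P i) => ->; last by rewrite divfK.
  by rewrite mulrAC -mulrA -ex mulrC divfK.
by rewrite mulrAC -mulrA -ey mulrC divfK.
Qed.

Lemma ec_pt_flex M N : (M, N) \in pisom th th -> flex_pt a b (ec_pt N).
Proof.
move=> MN; have [D D0 /cubic_coefs [[e0 e1 e2] _]] := pisom_cubic onP MN.
have /pisomP[_ Nu _] := MN.
apply: flex_of_coefs e0 e1 e2 _ => // c; exact: unit_indep.
Qed.

Lemma ec_pt_None M N : (M, N) \in pisom th th -> (ec_pt N == None) = ((M, N) \in pisomO).
Proof.
move=> MN; rewrite inE MN /ec_pt /ratio_pt /=; have [q3|q3] := eqVneq (N 2%:R 1) 0;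
  last by rewrite andbF.
have [D D0 /cubic_coefs [[e0 _ _] _]] := pisom_cubic onP MN.
move: e0; rewrite q3 /cubic => e0; have /eqP : N 0 1 ^+ 3 = 0.
  by rewrite -[RHS]oppr0 -[in RHS]e0; ring.
by rewrite expf_eq0 /= => ->.
Qed.

Lemma pisom_transl (Q : F * F) : flex_pt a b (Some Q) ->
  exists M N, (M, N) \in pisom th th /\ ec_pt N = Some Q.
Proof.
case: Q => s t /= [onQ t0]; set k := _ / _ => kE.
have aE : a = 2 * t * k - 3 * s ^+ 2 by rewrite /k; field; rewrite t0 two_neq0.
(* Expanded at the flex, the curve is [y^2 = (t + k (x - s))^2 + (x - s)^3]. *)
have onP' : m ^+ 2 = (t + k * (l - s)) ^+ 2 + (l - s) ^+ 3.
  rewrite onP -[b](addKr (s ^+ 3 + a * s)) -onQ.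
  have -> : (t + k * (l - s)) ^+ 2 = t ^+ 2 + 2 * t * k * (l - s) + k ^+ 2 * (l - s) ^+ 2.
    by ring.
  by rewrite kE aE; ring.
have [M [Mu H]] := B_transl two_neq0 t0 kE aE three_neq0 onP'.
exists M, (transl s t k); split.
  by apply/pisomP; split; rewrite // transl_unit.
rewrite /ec_pt /ratio_pt !mxE /=.
have -> : (- 1 / (2 * t) == 0) = false.
  by rewrite mulf_eq0 invr_eq0 oppr_eq0 oner_eq0 mulf_eq0 (negPf two_neq0) (negPf t0).
by congr (Some (_, _)); field; rewrite t0 ?two_neq0 ?oppr_eq0 ?oner_neq0.
Qed.

(** Composition with one lift of the translation from [O] to [Q] carries [pisomO] onto the fibre
    over [Q]. *)
Lemma card_pisom_fiber (Q : option (F * F)) : flex_pt a b Q ->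
  #|[set p in pisom th th | ec_pt p.2 == Q]| = #|pisomO|.
Proof.
case: Q => [Q|] HQ; last first.
  apply: eq_card => -[M N]; rewrite inE /=.
  case: (boolP ((M, N) \in pisom th th)) => MN; first by rewrite (ec_pt_None MN).
  by rewrite /pisomO inE (negPf MN).
have [M0 [N0 [MN0 NQ]]] := pisom_transl HQ; have /pisomP[Mu Nu _] := MN0.
pose g (p : 'M[F]_6 * 'M[F]_3) := (p.1 *m M0, N0 *m p.2).
have g_inj : injective g.
  move=> [M N] [M' N'] [/(can_inj (mulmxK Mu)) -> eN].
  by rewrite (can_inj (mulKmx Nu) eN).
rewrite -(card_imset pisomO g_inj); apply: eq_card => -[M N].
have colO p : p \in pisomO -> exists2 c, c != 0 & col 1 p.2 = c *: col 1 1%:M.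
  rewrite inE => /andP[pI /andP[/eqP q1 /eqP q3]]; exists (p.2 1 1); last first.
    apply/colP=> i; rewrite !mxE; case: (ord3P i) => -> /=; rewrite ?q1 ?q3 ?mulr0 ?mulr1 //.
  case: p pI q1 q3 => M1 N1 /pisomP[_ /col1_neq0 N1u _] /= q1 q3.
  apply: contraNneq N1u => q2; apply/eqP/colP=> i; rewrite !mxE.
  by case: (ord3P i) => ->.
apply/idP/imsetP => [|[p pO [-> ->]]].
  rewrite inE => /andP[MN /= /eqP NQ'].
  exists (M *m invmx M0, invmx N0 *m N); last by rewrite /g /= mulmxKV // mulKVmx.
  have MN' : (M *m invmx M0, invmx N0 *m N) \in pisom th th := pisom_mul MN (pisom_inv MN0).
  have [c cE] : exists c, col 1 N = c *: col 1 N0.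
    by apply: ec_pt_scale_inv; rewrite NQ' ?NQ.
  rewrite inE MN' /=; have E : col 1 (invmx N0 *m N) = c *: col 1 1%:M.
    by rewrite !colE -mulmxA -colE cE -scalemxAr colE mulmxA mulVmx.
  have e i : (invmx N0 *m N) i 1 = c * (1%:M : 'M[F]_3) i 1.
    by have /colP/(_ i) := E; rewrite !mxE.
  by rewrite !e !mxE /= mulr0 eqxx.
have [c c0 cE] := colO p pO.
have pI : p \in pisom th th by move: (pO : p \in pisomO); rewrite /pisomO inE => /andP[].
rewrite inE; apply/andP; split.
  by case: p pI {pO cE} => M1 N1 pI; apply: pisom_mul pI MN0.
rewrite /= -NQ; apply/eqP; apply: (ec_pt_scale c0).
by rewrite !colE -mulmxA -colE cE -scalemxAr colE mulmxA mulmx1.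
Qed.

Lemma card_pisom_self : #|pisom th th| = (#|ec_tors a b 3| * #|pisomO|)%N.
Proof.
rewrite -sum_nat_const -[LHS]sum1_card.
have tE (p : 'M[F]_6 * 'M[F]_3) : p \in pisom th th ->
    exists2 Q, Q \in ec_tors a b 3 & val Q = ec_pt p.2.
  case: p => M N MN; have H := ec_pt_flex MN.
  have onQ : on_curve a b (ec_pt N).
    by case: (ec_pt N) H => //= -[s t] [/eqP].
  by exists (exist (on_curve a b) _ onQ) => //; apply/(ec_tors3P two_neq0).
pose h (p : 'M[F]_6 * 'M[F]_3) : ecpoint a b := insubd (ec_zero a b) (ec_pt p.2).
rewrite (partition_big h (mem (ec_tors a b 3))); last first.
  by move=> p pI; have [Q Qt E] := tE p pI; rewrite /h -E valKd.
apply: eq_bigr => Q Qt; rewrite -(@card_pisom_fiber (val Q)); last exact/(ec_tors3P two_neq0).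
rewrite -sum1_card; apply: eq_bigl => p; rewrite [RHS]inE.
case: (boolP (p \in pisom th th)) => [pI|//]; have [Q' _ E] := tE p pI.
by rewrite /h -E valKd -val_eqE.
Qed.

End CountPisom.

(** * Automorphisms of the group *)

Section CommutatorForm.
Variables (F : fieldType) (a l m : F).
Local Notation t := (tEP a l m).
Local Notation B := (Bv a l m).
Implicit Types (u v : 'cV[F]_6) (w y : 'cV[F]_3).

Lemma tEP_Bv u v y : (y^T *m t u v) 0 0 = (u^T *m B y *m v) 0 0.
Proof.
have yE : B y = \sum_(i < 3) y i 0 *: Bcoef a l m i.
  have <- := BEP_coef a l m (fun i => y i 0); rewrite /Bv.
  have -> : inord 0 = 0 :> 'I_3 by apply/val_inj; rewrite /= inordK.
  have -> : inord 1 = 1 :> 'I_3 by apply/val_inj; rewrite /= inordK.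
  by have -> : inord 2 = 2%:R :> 'I_3 by apply/val_inj; rewrite /= inordK.
rewrite yE mulmx_sumr mulmx_suml summxE mxE; apply: eq_bigr => i _.
by rewrite [y^T 0 i]mxE [t u v i 0]mxE -scalemxAr -scalemxAl [RHS]mxE.
Qed.

Lemma tEP_ext w w' : (forall y, (y^T *m w) 0 0 = (y^T *m w') 0 0) -> w = w'.
Proof.
move=> H; apply/colP=> i; have := H (delta_mx i 0).
by rewrite trmx_delta -!rowE !mxE.
Qed.

Lemma Bv_tr y : (B y)^T = - B y.
Proof.
rewrite BvE (@tr_block_mx F 3 3 3 3) (@opp_block_mx F 3 3 3 3) !trmx0 !oppr0.
by rewrite [(- _)^T]linearN /= !JvN !opprK.
Qed.

Lemma tEP_alt u v : t u v = - t v u.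
Proof.
apply: tEP_ext => y; rewrite mulmxN [RHS]mxE !tEP_Bv.
have -> : (u^T *m B y *m v) 0 0 = ((u^T *m B y *m v)^T) 0 0 by rewrite [RHS]mxE.
by rewrite !trmx_mul trmxK Bv_tr mulNmx mulmxN mxE mulmxA.
Qed.

Lemma tEPZl c u v : t (c *: u) v = c *: t u v.
Proof.
apply: tEP_ext => y.
by rewrite -scalemxAr [RHS]mxE !tEP_Bv linearZ /= -!scalemxAl mxE.
Qed.

Lemma tEPZr c u v : t u (c *: v) = c *: t u v.
Proof. by rewrite tEP_alt tEPZl tEP_alt scalerN opprK. Qed.

(** One invertible member of the pencil is enough for [t] to be nondegenerate; at [(1, 0, 0)] the
    determinant is -1 for every [P]. *)
Lemma Jv1_unit : Jv a l m (vec3 1 0 0) \in unitmx.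
Proof.
rewrite unitmxE unitfE det_mx33 !JvE /= !mxE /=.
set d := (X in X != 0); have -> : d = - 1 by rewrite /d; ring.
by rewrite oppr_eq0 oner_neq0.
Qed.
End CommutatorForm.

Section CommutatorFormRigidity.
Variables (F : fieldType) (a l m : F).
Local Notation t := (tEP a l m).
Local Notation B := (Bv a l m).
Implicit Types (u v : 'cV[F]_6) (w y : 'cV[F]_3).

Lemma Bv1_inj v : B (vec3 1 0 0) *m v = 0 -> v = 0.
Proof.
rewrite BvE -[v](@vsubmxK F 3 3 1) (@mul_block_col F 3 3 3 3 1) !mul0mx add0r addr0 mulNmx.
have z : 0 = col_mx 0 0 :> 'cV[F]_(3 + 3) by rewrite col_mx0.
rewrite [X in _ = X]z => /(@eq_col_mx F 3 3 1) [ed eu].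
have -> : usubmx (v : 'cV_(3 + 3)) = 0.
  apply: (can_inj (mulKmx (Jv1_unit a l (- m)))); apply: oppr_inj.
  by rewrite eu mulmx0 oppr0.
have -> : dsubmx (v : 'cV_(3 + 3)) = 0.
  by apply: (can_inj (mulKmx (Jv1_unit a l m))); rewrite ed mulmx0.
by rewrite -z.
Qed.

Lemma form_mx_eq0 (A : 'M[F]_6) : (forall u v, (u^T *m A *m v) 0 0 = 0) -> A = 0.
Proof.
move=> H; apply/matrixP=> i j; have := H (delta_mx i 0) (delta_mx j 0).
by rewrite trmx_delta -rowE -colE !mxE.
Qed.

Lemma tEP_nondeg v : (forall u, t u v = 0) -> v = 0.
Proof.
move=> H; apply: Bv1_inj; apply/colP=> i; rewrite [RHS]mxE.
have := tEP_Bv a l m (delta_mx i 0) v (vec3 1 0 0).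
by rewrite H mulmx0 [LHS]mxE trmx_delta -mulmxA -rowE [RHS]mxE.
Qed.

Definition stdl (i : 'I_3) : 'cV[F]_6 := delta_mx (lshift 3 i : 'I_(3 + 3)) 0.
Definition stdr (i : 'I_3) : 'cV[F]_6 := delta_mx (rshift 3 i : 'I_(3 + 3)) 0.

Lemma tEP_std i j y : (y^T *m t (stdl i) (stdr j)) 0 0 = Jv a l m y i j.
Proof.
rewrite tEP_Bv /stdl /stdr trmx_delta -rowE -colE [LHS]mxE [LHS]mxE.
by rewrite BvE (@block_mxEur F 3 3 3 3).
Qed.

Lemma tEP_span w : exists c1 c2 c3,
  w = t (stdl 1) (c1 *: stdr 2%:R) + t (stdl 0) (c2 *: stdr 1) + t (stdl 2%:R) (c3 *: stdr 2%:R).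
Proof.
(* The entries (1,2), (0,1) and (2,2) of [J] are [y1], [y2 - m y3] and [- y3], which span all linear
   forms; the third coefficient corrects the term [- m y3]. *)
exists (w 0 0), (w 1 0), (- (w 2%:R 0 + m * w 1 0)).
apply: tEP_ext => y; rewrite !tEPZr !mulmxDr -!scalemxAr.
rewrite ![(_ + _ : matrix _ _ _) 0 0]mxE ![(_ *: _ : matrix _ _ _) 0 0]mxE.
rewrite !tEP_std !JvE /= mulmx3E !mxE; ring.
Qed.

Hypothesis two_neq0 : 2 != 0 :> F.

(** The blocks of [A] intertwine pencils, hence are scalar by [Jv_intertwine]. Each off-diagonal
    block is also minus its transpose, so it vanishes because 2 is invertible. *)
Lemma Bv_centroid (A : 'M[F]_6) : (forall y, B y *m A = A^T *m B y) -> exists c, A = c%:M.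
Proof.
rewrite -[A](@submxK F 3 3 3 3).
move: (@ulsubmx F 3 3 3 3 A) (@ursubmx F 3 3 3 3 A) (@dlsubmx F 3 3 3 3 A)
  (@drsubmx F 3 3 3 3 A) => X Y Z W H.
have {}H y : [/\ Jv a l m y *m Z = - Z^T *m Jv a l (- m) y,
    Jv a l m y *m W = X^T *m Jv a l m y &
    Jv a l (- m) y *m Y = - Y^T *m Jv a l m y].
  move: (H y); rewrite (@tr_block_mx F 3 3 3 3) BvE !(@mulmx_block F 3 3 3 3 3 3).
  rewrite !mul0mx !mulmx0 !add0r !addr0 => /(@eq_block_mx F 3 3 3 3) [-> -> _].
  by rewrite !mulmxN !mulNmx => <-; rewrite opprK.
have skew (c : F) (V : 'M[F]_3) : V = c%:M -> - V^T = c%:M -> V = 0.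
  move=> ->; rewrite tr_scalar_mx => /matrixP/(_ 0 0); rewrite !mxE /= !mulr1n => /eqP.
  rewrite eq_sym -addr_eq0 -mulr2n -mulr_natl mulf_eq0 (negPf two_neq0) => /eqP ->.
  by rewrite raddf0.
have [z [eZ eZt _]] : exists c, [/\ Z = c%:M, - Z^T = c%:M & c = 0 \/ l = l /\ m = - m].
  by apply: (@Jv_intertwine _ a) => y; case: (H y).
have [w [eW eX _]] : exists c, [/\ W = c%:M, X^T = c%:M & c = 0 \/ l = l /\ m = m].
  by apply: (@Jv_intertwine _ a) => y; case: (H y).
have [y [eY eYt _]] : exists c, [/\ Y = c%:M, - Y^T = c%:M & c = 0 \/ l = l /\ - m = m].
  by apply: (@Jv_intertwine _ a) => y; case: (H y).
exists w; rewrite (skew _ _ eZ eZt) (skew _ _ eY eYt) eW -[X]trmxK eX tr_scalar_mx.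
by rewrite -(@scalar_mx_block F 3 3).
Qed.

Lemma semilinear_mx (s : {rmorphism F -> F}) n k (f : 'cV[F]_n -> 'cV[F]_k) :
  {morph f : x y / x + y} -> (forall c x, f (c *: x) = s c *: f x) ->
  exists M : 'M[F]_(k, n), forall x, f x = M *m map_mx s x.
Proof.
move=> fD fZ; have f0 : f 0 = 0 by rewrite -[0](scale0r 0) fZ rmorph0 scale0r.
exists (\matrix_(i, j) f (delta_mx j 0) i 0) => x; apply/colP=> i.
have xE : x = \sum_j x j 0 *: delta_mx j 0.
  by rewrite {1}[x]matrix_sum_delta; apply: eq_bigr => j _; rewrite big_ord1.
rewrite [in LHS]xE (big_morph f fD f0) summxE mxE; apply: eq_bigr => j _.
by rewrite fZ !mxE mulrC.
Qed.

End CommutatorFormRigidity.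

Lemma zmod_split_half (U : zmodType) (x y x' y' : U) :
  x + y = x' + y' -> x - y = x' - y' -> y + y = y' + y'.
Proof.
move=> E E'; have D (c d : U) : (c + d) - (c - d) = d + d.
  by rewrite opprB addrC addrA subrK.
by rewrite -(D x) -(D x') E E'.
Qed.

Lemma unitmx_of_ker (F : fieldType) n (A : 'M[F]_n) :
  (forall v : 'cV[F]_n, A *m v = 0 -> v = 0) -> A \in unitmx.
Proof.
move=> H; rewrite -unitmx_tr -row_free_unit; apply: inj_row_free => v vA.
by apply: trmx_inj; rewrite trmx0; apply: H; rewrite -[A]trmxK -trmx_mul vA trmx0.
Qed.

Lemma map_tEP (F L : fieldType) (s : {rmorphism F -> L}) (a l m : F) u v :
  map_mx s (tEP a l m u v) = tEP (s a) (s l) (s m) (map_mx s u) (map_mx s v).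
Proof.
have BE (K : fieldType) (a' l' m' : K) i : Bcoef a' l' m' i =
    Bv a' l' m' (vec3 (i == 0 :> nat)%:R (i == 1 :> nat)%:R (i == 2 :> nat)%:R).
  by rewrite /Bv !mxE.
apply/colP=> i; rewrite [LHS]mxE [tEP a l m u v i 0]mxE [RHS]mxE !BE.
have E (A : 'M[F]_1) : s (A 0 0) = map_mx s A 0 0 by rewrite mxE.
by rewrite E !map_mxM map_trmx map_Bv !rmorph_nat.
Qed.

(** * From a group automorphism to a field automorphism and a pseudo-isometry *)

Section AutShape.
Variables (F : finFieldType) (a l m : F).
Hypothesis two_neq0 : 2 != 0 :> F.
Local Notation t := (tEP a l m).
Local Notation G := (GEP a l m).
Local Notation V := 'cV[F]_6.
Local Notation W := 'cV[F]_3.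

Definition ptheta (s : F -> F) := (s a, s l, s m).

Lemma half_half (U : lmodType F) (x : U) : 2^-1 *: x + 2^-1 *: x = x.
Proof. by rewrite -scalerDl (_ : _ + _ = 1) ?scale1r //; field. Qed.

Variable f : G -> G.
Hypotheses (f_inj : injective f) (fM : forall x y : G, f (x * y)%g = (f x * f y)%g).

Let pr (v : V) (w : W) : G := (v, w).
Let mulE (v v' : V) (w w' : W) : (pr v w * pr v' w')%g = pr (v + v') (w + w' + 2^-1 *: t v v').
Proof. by []. Qed.

Let al v := (f (pr v 0)).1.
Let h v := (f (pr v 0)).2.
Let be w := (f (pr 0 w)).2.

Lemma GEP_central (x : G) : (forall y, (x * y)%g = (y * x)%g) <-> x.1 = 0.
Proof.
case: x => v w /=; split=> [H|->].
  apply: (@tEP_nondeg F a l m) => u; have [_] := H (pr u 0).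
  rewrite add0r addr0 => /addrI; rewrite (tEP_alt a l m u) scalerN => E.
  by rewrite -[t v u]half_half {1}E addNr oppr0.
move=> [v' w']; rewrite !mulE tEP0l (tEP_alt a l m v') tEP0l oppr0 scaler0.
by rewrite addrC (addrC w).
Qed.

Lemma gep_aut_bij : bijective f. Proof. exact: injF_bij f_inj. Qed.

Lemma gep_aut_center w : (f (pr 0 w)).1 = 0.
Proof.
apply/GEP_central => y; have [g fK gK] := gep_aut_bij.
by rewrite -[y]gK -!fM; congr f; apply: (GEP_central (pr 0 w)).2.
Qed.

Lemma gep_aut_split v w : f (pr v w) = pr (al v) (h v + be w).
Proof.
have -> : pr v w = (pr v 0 * pr 0 w)%g.
  by rewrite mulE (tEP_alt a l m) tEP0l oppr0 scaler0 !addr0 add0r.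
rewrite fM [f (pr v 0)]surjective_pairing [f (pr 0 w)]surjective_pairing gep_aut_center.
by rewrite -/(al v) -/(h v) -/(be w) mulE (tEP_alt a l m _ 0) tEP0l oppr0 scaler0 !addr0.
Qed.

Lemma gep_aut_add v v' : al (v + v') = al v + al v' /\
  h (v + v') + be (2^-1 *: t v v') = h v + h v' + 2^-1 *: t (al v) (al v').
Proof.
have := fM (pr v 0) (pr v' 0); rewrite mulE !gep_aut_split addr0 add0r mulE.
have gep_aut_center0 : be 0 = 0.
  have := fM (pr 0 0) (pr 0 0); rewrite mulE tEP0l scaler0 !addr0.
  rewrite [f (pr 0 0)]surjective_pairing gep_aut_center -/(be 0) mulE tEP0l scaler0 !addr0.
  by case=> /esym/eqP; rewrite -subr_eq0 addrK => /eqP.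
by rewrite gep_aut_center0 !addr0 => -[-> ->].
Qed.

Lemma gep_aut_centerD : {morph be : w w' / w + w'}.
Proof.
move=> w w'; have := fM (pr 0 w) (pr 0 w'); rewrite mulE tEP0l scaler0 !addr0.
rewrite [f (pr 0 w)]surjective_pairing [f (pr 0 w')]surjective_pairing !gep_aut_center.
rewrite -/(be w) -/(be w') mulE tEP0l scaler0 !addr0 => E.
by rewrite /be E.
Qed.

Lemma gep_aut_fstD : {morph al : v v' / v + v'}.
Proof. by move=> v v'; case: (gep_aut_add v v'). Qed.

Lemma gep_aut_center0 : be 0 = 0.
Proof. by have /eqP := gep_aut_centerD 0 0; rewrite addr0 eq_sym -subr_eq0 addrK => /eqP. Qed.

Lemma gep_aut_centerN w : be (- w) = - be w.
Proof. by apply/eqP; rewrite -addr_eq0 -gep_aut_centerD addNr gep_aut_center0. Qed.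

(** Exchanging [v] and [v'] in [gep_aut_add] changes only the sign of the [t] terms, so subtracting
    isolates them. *)
Lemma gep_aut_tEP v v' : be (t v v') = t (al v) (al v').
Proof.
have [_ E] := gep_aut_add v v'.
have E' : h (v + v') - be (2^-1 *: t v v') = h v + h v' - 2^-1 *: t (al v) (al v').
  have [_] := gep_aut_add v' v; rewrite (tEP_alt a l m v') (tEP_alt a l m (al v')).
  rewrite !scalerN gep_aut_centerN.
  by rewrite (addrC v') (addrC (h v')).
by rewrite -[t v v']half_half gep_aut_centerD (zmod_split_half E E') half_half.
Qed.

Lemma gep_aut_sndD : {morph h : v v' / v + v'}.
Proof.
move=> v v'; have [_ E] := gep_aut_add v v'.
suff half w : be (2^-1 *: w) = 2^-1 *: be w.
  by move: E; rewrite half gep_aut_tEP => /addIr.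
by rewrite -[in RHS](half_half w) gep_aut_centerD scalerDr half_half.
Qed.

Lemma gep_aut_center_inj : injective be.
Proof.
move=> w w' E; have : f (pr 0 w) = f (pr 0 w').
  by rewrite [LHS]surjective_pairing [RHS]surjective_pairing !gep_aut_center -!/(be _) E.
by move/f_inj=> [].
Qed.

Lemma gep_aut_fst_inj : injective al.
Proof.
move=> v v' E; apply/eqP; rewrite -subr_eq0; apply/eqP.
have al0 : al (v - v') = 0.
  by apply: (addIr (al v')); rewrite -gep_aut_fstD subrK add0r.
(* By finiteness [be] is onto, so an image with zero first component already comes from the
   centre. *)
have [g _ gK] := injF_bij gep_aut_center_inj.
have : f (pr (v - v') 0) = f (pr 0 (g (h (v - v')))).
  rewrite gep_aut_split gep_aut_center0 addr0 al0 [RHS]surjective_pairing gep_aut_center.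
  by rewrite -/(be _) gK.
by move/f_inj=> [].
Qed.

(** Multiplication by [c] is self-adjoint for [t], so its conjugate [A] under [al] is too; by
    [Bv_centroid] it is a scalar [d]. The claim for [be] follows because values of [t] span
    [F^3]. *)
Lemma gep_aut_scale c : exists d, (forall v, al (c *: v) = d *: al v) /\
  (forall w, be (c *: w) = d *: be w).
Proof.
have [g gK Kg] := injF_bij gep_aut_fst_inj.
pose A v := al (c *: g v).
have gD : {morph g : v v' / v + v'}.
  by move=> v v'; apply: gep_aut_fst_inj; rewrite gep_aut_fstD !Kg.
have AD : {morph A : v v' / v + v'} by move=> v v'; rewrite /A gD scalerDr gep_aut_fstD.
have tA u v : t (A u) v = t u (A v).
  by rewrite -{1}[v]Kg -{2}[u]Kg -!gep_aut_tEP tEPZl tEPZr.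
(* Self-adjointness and nondegeneracy upgrade the additive map [A] to an [F]-linear one. *)
have AZ d v : A (d *: v) = d *: A v.
  apply/eqP; rewrite -subr_eq0; apply/eqP/(@tEP_nondeg F a l m) => u.
  by rewrite tEPDr -scaleNr tEPZr -tA tEPZr -tEPZr scaleNr tEPZr tA subrr.
have [MA AE] := semilinear_mx (s := idfun) AD AZ.
have {}AE v : A v = MA *m v by rewrite AE map_mx_id.
have [y|d dE] := @Bv_centroid F a l m two_neq0 MA.
  apply/eqP; rewrite -subr_eq0; apply/eqP/form_mx_eq0 => u v.
  rewrite mulmxBr mulmxBl [LHS]mxE [X in _ + X]mxE; apply/eqP; rewrite subr_eq0; apply/eqP.
  rewrite mulmxA -[_ *m _ *m v]mulmxA -AE -tEP_Bv -tA tEP_Bv AE trmx_mul.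
  by rewrite !mulmxA.
have alZ v : al (c *: v) = d *: al v.
  by rewrite -[v in LHS]gK -/(A _) AE dE mul_scalar_mx.
have beZ u v : be (c *: t u v) = d *: be (t u v) by rewrite -tEPZl !gep_aut_tEP alZ tEPZl.
exists d; split=> // w; have [c1 [c2 [c3 ->]]] := tEP_span a l m w.
by rewrite !scalerDr !gep_aut_centerD !beZ !scalerDr.
Qed.

(** The correspondence from [c] to [d] in [gep_aut_scale] is a ring morphism, as is seen on the
    nonzero vector [be w0]. Hence [al] and [be] are semilinear and have matrices. *)
Lemma gep_aut_shape : exists (s : {rmorphism F -> F}) (M : 'M[F]_6) (N : 'M[F]_3),
  [/\ (M, N) \in pisom (a, l, m) (ptheta s), {morph h : v v' / v + v'} &
      forall v w, f (pr v w) = pr (M *m map_mx s v) (h v + N^T *m map_mx s w)].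
Proof.
have [s sE] := boolp.choice gep_aut_scale.
have alZ c v : al (c *: v) = s c *: al v by case: (sE c).
have beZ c w : be (c *: w) = s c *: be w by case: (sE c).
pose w0 := vec3 (1 : F) 0 0.
have w00 : be w0 != 0.
  rewrite -gep_aut_center0 (inj_eq gep_aut_center_inj); apply/eqP=> /colP/(_ 0); rewrite !mxE /=.
  by apply/eqP; rewrite oner_neq0.
have w0_inj c d : c *: be w0 = d *: be w0 -> c = d.
  move/eqP; rewrite -subr_eq0 -scalerBl scaler_eq0 (negPf w00) orbF subr_eq0.
  by move/eqP.
have sB : zmod_morphism s.
  move=> c d; apply: w0_inj; rewrite -beZ !scalerBl gep_aut_centerD gep_aut_centerN !beZ.
  by [].
have sM : monoid_morphism s.
  split; first by apply: w0_inj; rewrite -beZ !scale1r.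
  by move=> c d; apply: w0_inj; rewrite -beZ -!scalerA !beZ.
pose sa := GRing.isZmodMorphism.Build F F s sB.
pose sm := GRing.isMonoidMorphism.Build F F s sM.
pose S : {rmorphism F -> F} := HB.pack s sa sm.
have [M alE] := semilinear_mx (s := S) gep_aut_fstD alZ.
have [N beE] := semilinear_mx (s := S) gep_aut_centerD beZ.
exists S, M, N^T; split; [|exact: gep_aut_sndD|by move=> v w; rewrite gep_aut_split alE beE trmxK].
have s_surj n (x : 'cV[F]_n) : exists v, x = map_mx S v.
  have [g _ Kg] := injF_bij (fmorph_inj S).
  by exists (map_mx g x); apply/colP=> i; rewrite !mxE [RHS]Kg.
apply/pisomP; split=> [||y].
- apply: unitmx_of_ker => x; have [v ->] := s_surj _ x.
  rewrite -alE => av; have -> : v = 0; last by rewrite map_mx0.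
  by apply: gep_aut_fst_inj; rewrite av alE map_mx0 mulmx0.
- rewrite unitmx_tr; apply: unitmx_of_ker => x; have [v ->] := s_surj _ x.
  rewrite -beE => av; have -> : v = 0; last by rewrite map_mx0.
  by apply: gep_aut_center_inj; rewrite av gep_aut_center0.
apply/eqP; rewrite -subr_eq0; apply/eqP/form_mx_eq0 => x x'.
have [u ->] := s_surj _ x; have [v ->] := s_surj _ x'.
rewrite mulmxBr mulmxBl [LHS]mxE [X in _ + X]mxE; apply/eqP; rewrite subr_eq0; apply/eqP.
rewrite !mulmxA -trmx_mul -alE -[_ *m M *m _]mulmxA -alE -tEP_Bv -gep_aut_tEP beE mulmxA.
have -> : y^T *m N = (N^T *m y)^T by rewrite trmx_mul trmxK.
by rewrite map_tEP; apply: tEP_Bv.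
Qed.

End AutShape.

Section AutConstruct.
Variables (F : finFieldType) (a l m : F) (s : {rmorphism F -> F}).
Variables (M : 'M[F]_6) (N : 'M[F]_3) (h : 'cV[F]_6 -> 'cV[F]_3).
Hypothesis MN : (M, N) \in pisom (a, l, m) (ptheta a l m s).
Hypothesis hD : {morph h : v v' / v + v'}.
Local Notation t := (tEP a l m).
Local Notation G := (GEP a l m).

Let f (x : G) : G := (M *m map_mx s x.1, h x.1 + N^T *m map_mx s x.2).

Lemma aut_inj : injective f.
Proof.
have /pisomP[Mu Nu _] := MN.
move=> [v w] [v' w'] [/(can_inj (mulKmx Mu))/map_mx_inj ->] /addrI.
have Nu' : N^T \in unitmx by rewrite unitmx_tr.
by move/(can_inj (mulKmx Nu'))/map_mx_inj => ->.
Qed.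

Lemma aut_mul (x y : G) : f (x * y)%g = (f x * f y)%g.
Proof.
have /pisomP[_ _ H] := MN.
case: x y => v w [v' w']; rewrite /f /= !GEP_mulE /=; congr pair.
  by rewrite map_mxD mulmxDr.
have tE : t (M *m map_mx s v) (M *m map_mx s v') = N^T *m map_mx s (t v v').
  apply: tEP_ext => y; rewrite tEP_Bv [in RHS]mulmxA -[in RHS]trmx_mul map_tEP.
  by have Hy := H y; rewrite /Bt /= in Hy; rewrite [RHS]tEP_Bv -Hy trmx_mul !mulmxA.
rewrite tE hD !map_mxD !mulmxDr map_mxZ fmorphV rmorph_nat -scalemxAr.
by rewrite addrA; congr (_ + _); rewrite addrACA addrA.
Qed.

End AutConstruct.

Lemma card_Aut_ffun (gT : finGroupType) :
  #|Aut [set: gT]| = #|[set f : {ffun gT -> gT} |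
     injectiveb f && [forall x, forall y, f (x * y)%g == (f x * f y)%g]]|.
Proof.
rewrite -(card_imset _ val_inj); apply: eq_card => f; apply/imsetP/idP => [[s sA ->]|].
  have /morphicP sM := Aut_morphic (sA : s \in Aut [set: gT]); rewrite inE.
  apply/andP; split; first exact: (valP s).
  by apply/forallP=> x; apply/forallP=> y; have := sM x y; rewrite !inE !pvalE => ->.
rewrite inE => /andP[fi /forallP fM]; exists (Perm fi) => //.
apply/setIdP; split; first by apply/fintype.subsetP=> x _; rewrite inE.
apply/morphicP=> x y _ _; have /forallP/(_ y)/eqP := fM x.
by rewrite -!pvalE.
Qed.

(** * Field endomorphisms of [F] as elements of the Galois group over the prime field *)

Section GalMor.
Variables (F : finFieldType) (p : nat) (charF : p \in [pchar F]).
Local Notation L := (pPrimeCharType charF).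

Lemma gal_rmorphism (g : gal_of {: L}) :
  {s : {rmorphism F -> F} | forall x : F, s x = (g : L -> L) x}.
Proof.
have gB : zmod_morphism (g : F -> F) by move=> x y; apply: (raddfB (g : L -> L)).
have gM : monoid_morphism (g : F -> F).
  by split; [exact: (rmorph1 (g : L -> L))|move=> x y; apply: (rmorphM (g : L -> L))].
pose sa := GRing.isZmodMorphism.Build F F (g : F -> F) gB.
pose sm := GRing.isMonoidMorphism.Build F F (g : F -> F) gM.
by exists (HB.pack (g : F -> F) sa sm : {rmorphism F -> F}).
Qed.

(** Scalars of the prime field are images of integers, so a ring morphism is automatically linear
    over it. *)
Lemma rmorphism_gal (s : {rmorphism F -> F}) :
  {g : gal_of {: L} | forall x : F, s x = (g : L -> L) x}.
Proof.
have sL : linear (s : L -> L).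
  move=> c x y; rewrite -mulr_algl -[in RHS]mulr_algl.
  have -> : s (c%:A * x + y) = s (c%:A : L) * s x + s y by rewrite rmorphD rmorphM.
  by rewrite /GRing.scale /= /pprimeChar_scale mulr1 rmorph_nat.
pose sl := GRing.isLinear.Build 'F_p L L *:%R (s : L -> L) sL.
pose S : {linear L -> L} := HB.pack (s : L -> L) sl.
have kS : kHom 1 {: L} (linfun S).
  apply/kHom_monoid_morphism; split; first by rewrite lfunE /= rmorph1.
  by move=> x y; rewrite !lfunE /= rmorphM.
rewrite -kAutfE in kS; have [g _ gE] := kAut_to_gal kS.
by exists g => x; rewrite -gE ?memvf // lfunE.
Qed.

Lemma gal_full (S : {set gal_of {: L}}) : S \subset 'Gal({: L} / 1)%g.
Proof. by apply/fintype.subsetP=> g _; rewrite gal_kHom ?sub1v // k1AHom. Qed.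

Lemma gal_eq (g g' : gal_of {: L}) : (forall x, (g : L -> L) x = (g' : L -> L) x) -> g = g'.
Proof. by move=> H; apply/eqP/gal_eqP => x _. Qed.

Lemma gal_mulE (g g' : gal_of {: L}) (x : L) :
  ((g * g')%g : L -> L) x = (g' : L -> L) ((g : L -> L) x).
Proof. exact: galM (memvf x). Qed.

End GalMor.

(** * Counting the additive maps from [F^6] to [F^3] *)

Section CardAdd.
Variables (F : finFieldType) (p e : nat) (charF : p \in [pchar F]).
Hypothesis cardF : #|F| = (p ^ e)%N.
Local Notation L := (pPrimeCharType charF).
Local Notation V := 'cV[F]_6.
Local Notation W := 'cV[F]_3.

Definition addmaps : {set {ffun V -> W}} :=
  [set h : {ffun V -> W} | [forall v, forall v', h (v + v') == h v + h v']].

Lemma addmapsP (h : {ffun V -> W}) : reflect {morph h : v v' / v + v'} (h \in addmaps).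
Proof.
rewrite inE; apply: (iffP forallP) => [H v v'|H v]; first by have /forallP/(_ v')/eqP := H v.
by apply/forallP=> v'; rewrite H.
Qed.

Lemma dimL : \dim {: L} = e.
Proof.
rewrite pprimeChar_dimf cardF pfactorK //; exact: pcharf_prime charF.
Qed.

(** Additive maps are linear over the prime field: they are given freely by their values on the
    [6 e] vectors [ebas j k], with [p^(3 e)] choices for each. *)
Lemma card_addmaps : #|addmaps| = (p ^ (18 * e ^ 2))%N.
Proof.
pose b := vbasis {: L}; pose n := \dim {: L}.
pose ev (eta : {ffun 'I_6 * 'I_n -> W}) : {ffun V -> W} :=
  [ffun v : V => \sum_j \sum_k eta (j, k) *+ (coord b k (v j 0 : L) : 'F_p)].
(* Coordinates in ['F_p] act through their natural number representatives, which is additive because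
   [p] kills [W]. *)
have Wp (w : W) : w *+ p = 0.
  by apply/matrixP=> i j; rewrite mulmxnE mxE (mulrn_pchar charF).
have pp : prime p := pcharf_prime charF.
have Wmod (w : W) k : w *+ (k %% p) = w *+ k.
  by rewrite [in RHS](divn_eq k p) mulrnDr mulnC mulrnA Wp mul0rn add0r.
have FpD (w : W) (c d : 'F_p) : w *+ ((c + d)%R : 'F_p) = w *+ c + w *+ d.
  rewrite -mulrnDr -[RHS]Wmod; congr (_ *+ (_ %% _)); exact: Fp_cast.
have ev_add eta : ev eta \in addmaps.
  apply/addmapsP=> v v'; rewrite !ffunE -big_split; apply: eq_bigr => j _.
  rewrite -big_split; apply: eq_bigr => k _ /=.
  by rewrite [(v + v') j 0]mxE (raddfD (coord b k)) FpD.
pose ebas (j : 'I_6) (k : 'I_n) : V := (b`_k : F) *: delta_mx j 0.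
have bfree : free b := basis_free (vbasisP {: L}).
have decomp (v : V) : v = \sum_j \sum_k ebas j k *+ (coord b k (v j 0 : L) : 'F_p).
  rewrite {1}[v]matrix_sum_delta; apply: eq_bigr => j _; rewrite big_ord1.
  rewrite {1}(coord_vbasis (memvf (v j 0 : L))) scaler_suml; apply: eq_bigr => k _.
  rewrite /ebas scalerMnl; congr (_ *: _).
  by rewrite {1}/GRing.scale /= /pprimeChar_scale mulr_natl.
have h_decomp (h : {ffun V -> W}) (v : V) : h \in addmaps ->
    h v = \sum_j \sum_k h (ebas j k) *+ (coord b k (v j 0 : L) : 'F_p).
  move/addmapsP=> hD; have h0 : h 0 = 0.
    by have /eqP := hD 0 0; rewrite addr0 eq_sym -subr_eq0 addrK => /eqP.
  have hMn x c : h (x *+ c) = h x *+ c.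
    by elim: c => [|c IH]; rewrite ?mulr0n // !mulrS hD IH.
  rewrite {1}[v]decomp (big_morph h hD h0); apply: eq_bigr => j _.
  by rewrite (big_morph h hD h0); apply: eq_bigr => k _; rewrite hMn.
have ev_bas eta j k : ev eta (ebas j k) = eta (j, k).
  rewrite ffunE (bigD1 j) //= (bigD1 k) //= !mxE !eqxx mulr1.
  rewrite coord_free // eqxx.
  rewrite [X in _ + X + _]big1 => [|k' k'k]; last by rewrite coord_free // 1?eq_sym (negPf k'k).
  rewrite big1 => [|j' j'j]; last first.
    by apply: big1 => k' _; rewrite !mxE (negPf j'j) mulr0 linear0.
  by rewrite !addr0.
have ev_inj : injective ev.
  by move=> eta eta' E; apply/ffunP=> -[j k]; rewrite -!ev_bas E.
have -> : addmaps = ev @: [set: {ffun 'I_6 * 'I_n -> W}].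
  apply/setP=> h; apply/idP/imsetP => [hA|[eta _ ->]]; last exact: ev_add.
  exists [ffun jk => h (ebas jk.1 jk.2)]; first by rewrite inE.
  apply/ffunP=> v; rewrite (h_decomp h v hA) ffunE; apply: eq_bigr => j _.
  by apply: eq_bigr => k _; rewrite ffunE.
rewrite card_imset // cardsT card_ffun card_prod !card_ord card_mx cardF /n dimL -!expnM.
congr (_ ^ _)%N; lia.
Qed.

End CardAdd.

(** * Counting group automorphisms; the subgroup [S] *)

Section CardAut.
Variables (F : finFieldType) (p e : nat) (charF : p \in [pchar F]).
Hypothesis cardF : #|F| = (p ^ e)%N.
Variables (a l m : F).
Hypothesis two_neq0 : 2 != 0 :> F.
Local Notation L := (pPrimeCharType charF).
Local Notation G := (GEP a l m).
Local Notation V := 'cV[F]_6.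
Local Notation W := 'cV[F]_3.
Local Notation th := (a, l, m).

Definition gmor (g : gal_of {: L}) : {rmorphism F -> F} := sval (gal_rmorphism g).

Lemma gmorE g x : gmor g x = (g : L -> L) x.
Proof. exact: (svalP (gal_rmorphism g)). Qed.

Lemma ptheta_ext (s s' : F -> F) : s =1 s' -> ptheta a l m s = ptheta a l m s'.
Proof. by move=> E; rewrite /ptheta !E. Qed.

Definition aut_of (x : gal_of {: L} * ('M[F]_6 * 'M[F]_3) * {ffun V -> W}) : {ffun G -> G} :=
  [ffun z : G => (x.1.2.1 *m map_mx (gmor x.1.1) z.1,
                  x.2 z.1 + x.1.2.2^T *m map_mx (gmor x.1.1) z.2) : G].

Definition autdata : {set gal_of {: L} * ('M[F]_6 * 'M[F]_3) * {ffun V -> W}} :=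
  [set x | (x.1.2 \in pisom th (ptheta a l m (gmor x.1.1))) && (x.2 \in addmaps F)].

Lemma aut_of_inj : {in autdata &, injective aut_of}.
Proof.
move=> [[g [M N]] h] [[g' [M' N']] h']; rewrite ![_ \in autdata]inE /=.
move=> /andP[/pisomP[Mu Nu _] hA] /andP[/pisomP[Mu' Nu' _] hA'].
move/ffunP=> E.
have E1 (v : V) : M *m map_mx (gmor g) v = M' *m map_mx (gmor g') v.
  by have := E (v, 0); rewrite !ffunE => -[].
have hE : h = h'.
  apply/ffunP=> v; have := E (v, 0); rewrite !ffunE /= => -[_].
  by rewrite !map_mx0 !mulmx0 !addr0.
have E2 (w : W) : N^T *m map_mx (gmor g) w = N'^T *m map_mx (gmor g') w.
  by have := E (0, w); rewrite !ffunE /= hE => -[_ /addrI].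
(* The standard basis vectors are fixed by field morphisms, so the matrices are compared
   columnwise. *)
have matE k n (A A' : 'M[F]_(k, n)) : (forall v : 'cV_n,
    A *m map_mx (gmor g) v = A' *m map_mx (gmor g') v) -> A = A'.
  move=> H; apply/matrixP=> i j; have /colP/(_ i) := H (delta_mx j 0).
  by rewrite !map_delta_mx -!colE !mxE.
have MM : M = M' := matE _ _ _ _ E1.
have NN : N = N' by apply: trmx_inj; apply: matE E2.
have gg : g = g'.
  apply: gal_eq => x; rewrite -!gmorE.
  have := E1 (const_mx x); rewrite -MM => /(can_inj (mulKmx Mu)) /colP /(_ 0).
  by rewrite !mxE.
by rewrite MM NN gg hE.
Qed.

Lemma card_Aut_sum : #|Aut [set: G]| =
  ((\sum_(g : gal_of {: L}) #|pisom th (ptheta a l m (gmor g))|) * p ^ (18 * e ^ 2))%N.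
Proof.
rewrite card_Aut_ffun.
transitivity #|autdata|; last first.
  rewrite -(card_addmaps charF cardF) big_distrl /= -sum1_card.
  transitivity (\sum_g \sum_(q in pisom th (ptheta a l m (gmor g)))
     \sum_(h in addmaps F) 1)%N; last first.
    by apply: eq_bigr => g _; rewrite !sum_nat_const muln1.
  rewrite pair_big_dep /= pair_big_dep /=; apply: eq_bigl => -[[g q] h].
  by rewrite inE.
rewrite -(card_in_imset aut_of_inj); apply: eq_card => f; rewrite inE.
apply/andP/imsetP => [[/injectiveP f_inj /forallP fM]|[[[g [M N]] h]]].
  have fM' (x y : G) : f (x * y)%g = (f x * f y)%g by have /forallP/(_ y)/eqP := fM x.
  have [s [M [N [MN hD E]]]] := gep_aut_shape two_neq0 f_inj fM'.
  have [g gE] := rmorphism_gal charF s.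
  have sg x : s x = gmor g x by rewrite gE gmorE.
  exists (g, (M, N), [ffun v : V => (f (v, 0)).2]).
    rewrite inE /= -(ptheta_ext sg) MN /=; apply/addmapsP=> v v'.
    by rewrite !ffunE; apply: hD.
  have ms n (x : 'cV[F]_n) : map_mx (gmor g) x = map_mx s x.
    by apply/matrixP=> i j; rewrite !mxE sg.
  by apply/ffunP=> -[v w]; rewrite !ffunE /= !ms; apply: E.
rewrite inE /= => /andP[MN /addmapsP hD] ->; split.
  by apply/injectiveP=> x y; rewrite !ffunE; apply: (aut_inj MN).
apply/forallP=> x; apply/forallP=> y; rewrite !ffunE; apply/eqP.
exact: (aut_mul MN).
Qed.

(** The subgroup [S] of the theorem. *)
Definition galS : {set gal_of {: L}} :=
  [set g | pisom th (ptheta a l m (gmor g)) != finset.set0].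

Lemma galS_group : group_set galS.
Proof.
apply/group_setP; split.
  rewrite inE; apply/finset.set0Pn; exists (1%:M, 1%:M).
  have -> : ptheta a l m (gmor 1%g) = th; last exact: pisom1.
  by rewrite /ptheta !gmorE !gal_id.
move=> g h; rewrite ![_ \in galS]inE => /finset.set0Pn[[M N] MN] /finset.set0Pn[[M' N'] MN'].
apply/finset.set0Pn; exists (M' *m map_mx (gmor h) M, map_mx (gmor h) N *m N').
(* Applying [h] to a pseudo-isometry from [th] to its [g]-conjugate gives one from the [h]-conjugate
   to the [g * h]-conjugate. *)
apply: pisom_mul MN' _.
have -> : ptheta a l m (gmor (g * h)%g) =
    (gmor h (gmor g a), gmor h (gmor g l), gmor h (gmor g m)).
  have ghE x : gmor (g * h)%g x = gmor h (gmor g x).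
    by rewrite (gmorE (g * h)%g) (gmorE h) (gmorE g) gal_mulE.
  by rewrite /ptheta !ghE.
have /pisomP[Mu Nu _] := MN.
apply/pisomP; split; rewrite ?map_unitmx // => y.
exact: (pisom_extend (gmor h) y MN).
Qed.

Lemma card_Aut_GEP : exists S : {group gal_of {: L}},
  #|Aut [set: G]| = (#|S| * #|pisom th th| * p ^ (18 * e ^ 2))%N.
Proof.
exists (Group galS_group); rewrite card_Aut_sum; congr (_ * _)%N.
rewrite -sum_nat_const [RHS]big_mkcond /=; apply: eq_bigr => g _.
rewrite inE; case: ifP => [|/negbFE/eqP ->]; last by rewrite cards0.
exact: card_pisom.
Qed.

End CardAut.

(** * Automorphisms of the curve *)

Section DegreeArithmetic.
Local Open Scope nat_scope.

(** In these lemmas [n] and [m] stand for the pole orders of two functions [X] and [Y] with [Y^2]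
    cubic in [X]. Then [P(X)] has a pole of order [i n] and [Y Q(X)] one of order [m + j n], and the
    coordinate [x] has order 2. *)
Lemma deg_odd n m j : m + m = 3 * n -> 0 < n -> m + j * n <> 2.
Proof. by case: j => [|[|j]]; [lia|lia|nia]. Qed.

Lemma deg_even n m i : m + m = 3 * n -> 0 < n -> i * n = 2 -> n = 2.
Proof. by case: i => [|[|i]]; [lia|lia|nia]. Qed.

Lemma deg_parity n m i j : m + m = 3 * n -> 0 < n -> i * n <> m + j * n.
Proof.
move=> mE n0 E; have /eqP : n * (2 * i) = n * (3 + 2 * j) by lia.
by rewrite eqn_pmul2l //; lia.
Qed.

End DegreeArithmetic.

(** * The coordinate ring of the curve without [O]: regular functions and pole orders *)

Section CoordRing.
Variable K : closedFieldType.
Hypotheses (two_neq0 : 2 != 0 :> K).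
Implicit Types (p q : {poly K}) (x y : K).

Lemma poly_eq0_all p : (forall x, p.[x] = 0) -> p = 0.
Proof.
move=> H; apply/eqP/contraT => p0.
have [s1|/closed_rootP[x]] := eqVneq (size (p + 1)) 1%N; last first.
  by rewrite /root hornerD hornerC H add0r oner_eq0.
have /size_poly1P[c c0 pE] : size (p + 1) == 1%N by rewrite s1.
have pE' : p = (c - 1)%:P by rewrite polyCB -pE addrK.
by have := H 0; rewrite pE' hornerC => E; move: p0; rewrite pE' E eqxx.
Qed.

Variable cub : {poly K}.
Hypothesis size_cub : size cub = 4%N.

Lemma cub_neq0 : cub != 0. Proof. by rewrite -size_poly_eq0 size_cub. Qed.

Lemma sqrt_exists (c : K) : exists y, y ^+ 2 = c.
Proof.
have /closed_rootP[y] : size ('X^2 - c%:P) != 1%N by rewrite size_XnsubC.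
by rewrite /root !hornerE subr_eq0 => /eqP <-; exists y.
Qed.

(* An element p + y q of the coordinate ring of y^2 = cub(x), as a function,   *)
(* and its norm to K[x], whose degree is the order of the pole at infinity.     *)
Definition cev p q x y := p.[x] + y * q.[x].
Definition cnrm p q := p ^+ 2 - cub * q ^+ 2.

Lemma cev_eq0 p q : (forall x y, y ^+ 2 = cub.[x] -> cev p q x y = 0) -> p = 0 /\ q = 0.
Proof.
move=> H.
have pz : p = 0.
  apply: poly_eq0_all => x; have [y yE] := sqrt_exists cub.[x].
  have h1 := H x y yE; have h2 : cev p q x (- y) = 0 by apply: H; rewrite sqrrN.
  apply: (mulfI two_neq0); rewrite mulr0 -[RHS]addr0 -{1}h1 -h2 /cev; ring.
split=> //; have /eqP : cub * q ^+ 2 = 0.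
  apply: poly_eq0_all => x; have [y yE] := sqrt_exists cub.[x].
  rewrite hornerM horner_exp -yE -exprMn; have := H x y yE.
  by rewrite /cev pz horner0 add0r => ->; rewrite expr0n.
by rewrite mulf_eq0 (negPf cub_neq0) expf_eq0 => /eqP.
Qed.

Lemma cev_inj p q p' q' :
  (forall x y, y ^+ 2 = cub.[x] -> cev p q x y = cev p' q' x y) -> p = p' /\ q = q'.
Proof.
move=> H; have [] := @cev_eq0 (p - p') (q - q').
  move=> x y yE; have := H x y yE; rewrite /cev !(hornerD, hornerN) => E.
  by rewrite mulrBr addrACA E -opprD subrr.
by move/eqP; rewrite subr_eq0 => /eqP -> /eqP; rewrite subr_eq0 => /eqP ->.
Qed.

Lemma cevM p q p' q' x y : y ^+ 2 = cub.[x] ->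
  cev p q x y * cev p' q' x y = cev (p * p' + cub * q * q') (p * q' + p' * q) x y.
Proof. by move=> E; rewrite /cev !(hornerD, hornerM) -E; ring. Qed.

Lemma cevD p q p' q' x y : cev p q x y + cev p' q' x y = cev (p + p') (q + q') x y.
Proof. by rewrite /cev !hornerD; ring. Qed.

Lemma cnrmM p q p' q' :
  cnrm (p * p' + cub * q * q') (p * q' + p' * q) = cnrm p q * cnrm p' q'.
Proof. by rewrite /cnrm; ring. Qed.

Lemma cnrm_ev p q x y : y ^+ 2 = cub.[x] ->
  (cnrm p q).[x] = cev p q x y * cev p q x (- y).
Proof.
by move=> E; rewrite /cnrm /cev !(hornerD, hornerN, hornerM, horner_exp) -E; ring.
Qed.

Lemma size_sq p : size (p ^+ 2) = (2 * size p).-1.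
Proof.
have [->|p0] := eqVneq p 0; first by rewrite expr0n /= size_poly0.
by rewrite expr2 size_mul // mul2n addnn.
Qed.

Lemma size_cubsq q : size (cub * q ^+ 2) = if q == 0 then 0%N else (2 * size q + 2)%N.
Proof.
case: eqP => [->|/eqP q0]; first by rewrite expr0n mulr0 size_poly0.
rewrite size_mul ?cub_neq0 ?expf_neq0 // size_cub size_sq.
have : (0 < size q)%N by rewrite size_poly_gt0.
lia.
Qed.

(** The degrees of [p ^+ 2] and [cub * q ^+ 2] have different parity, so leading terms never
    cancel. *)
Lemma size_cnrm p q :
  size (cnrm p q) = maxn (2 * size p).-1 (if q == 0 then 0%N else (2 * size q + 2)%N).
Proof.
rewrite /cnrm -size_cubsq -size_sq.
have : (size (p ^+ 2) != size (cub * q ^+ 2)) || (q == 0).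
  by rewrite size_sq size_cubsq; case: (q == 0); rewrite ?orbT ?orbF //; lia.
case/orP=> [ne|/eqP ->]; last by rewrite expr0n mulr0 subr0 size_poly0 maxn0.
case: (ltngtP (size (p ^+ 2)) (size (cub * q ^+ 2))) ne => // lt _.
  by rewrite addrC size_polyDl ?size_polyN.
by rewrite size_polyDl ?size_polyN.
Qed.

Lemma cnrm_ultra p q p' q' : (size (cnrm p' q') < size (cnrm p q))%N ->
  size (cnrm (p + p') (q + q')) = size (cnrm p q).
Proof.
rewrite !size_cnrm => H.
have Hp := size_polyD p p'; have Hq := size_polyD q q'.
have Hp' : (size p' < size p)%N -> size (p + p') = size p by apply: size_polyDl.
have Hq' : (size q' < size q)%N -> size (q + q') = size q by apply: size_polyDl.
move: H Hp Hq Hp' Hq'; rewrite -[q == 0]size_poly_eq0 -[q' == 0]size_poly_eq0.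
rewrite -[q + q' == 0]size_poly_eq0.
move: (size p) (size p') (size (p + p')) (size q) (size q') (size (q + q')).
by move=> a b c d e f; do 3![case: ifP]; lia.
Qed.


Lemma cev_opp p q x y : cev p (- q) x y = cev p q x (- y).
Proof. by rewrite /cev hornerN mulrN mulNr. Qed.

Definition cregular (G : K -> K -> K) := forall x0 y0, y0 ^+ 2 = cub.[x0] ->
  exists p q p' q', cev p q x0 y0 != 0 /\
    forall x y, y ^+ 2 = cub.[x] -> cev p q x y * G x y = cev p' q' x y.

(* The polynomials h(x) such that h(x) G is polynomial form an ideal of K[x]; *)
(* norms of local denominators show that it has no zero.                       *)
Lemma cregular_poly G : cregular G ->
  exists p q, forall x y, y ^+ 2 = cub.[x] -> G x y = cev p q x y.
Proof.
move=> Greg.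
pose I h := exists p' q', forall x y, y ^+ 2 = cub.[x] -> h.[x] * G x y = cev p' q' x y.
have ID h h' : I h -> I h' -> I (h + h').
  move=> [p [q H]] [p' [q' H']]; exists (p + p'), (q + q') => x y yE.
  by rewrite hornerD mulrDl H // H' // cevD.
have IM h k : I h -> I (k * h).
  move=> [p [q H]]; exists (k * p), (k * q) => x y yE.
  by rewrite hornerM -mulrA H // /cev !hornerM; ring.
have Inz x0 : exists2 h, I h & h.[x0] != 0.
  have [y0 y0E] := sqrt_exists cub.[x0].
  have y0E' : (- y0) ^+ 2 = cub.[x0] by rewrite sqrrN.
  suff [p [q [p' [q' [n1 n2 H]]]]] : exists p q p' q',
      [/\ cev p q x0 y0 != 0, cev p q x0 (- y0) != 0 &
       forall x y, y ^+ 2 = cub.[x] -> cev p q x y * G x y = cev p' q' x y].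
    exists (cnrm p q); last by rewrite (cnrm_ev _ _ y0E) mulf_neq0.
    exists (p' * p + cub * q' * (- q)), (p' * (- q) + p * q') => x y yE.
    by rewrite (cnrm_ev _ _ yE) -cevM // cev_opp -H // mulrAC.
  have [p1 [q1 [r1 [s1 [n1 H1]]]]] := Greg x0 y0 y0E.
  have [p2 [q2 [r2 [s2 [n2 H2]]]]] := Greg x0 (- y0) y0E'.
  (* One of the two local denominators, or else their sum, is nonzero at both points above [x0]. *)
  have [z1|z1] := eqVneq (cev p1 q1 x0 (- y0)) 0; last by exists p1, q1, r1, s1.
  have [z2|z2] := eqVneq (cev p2 q2 x0 y0) 0; last by exists p2, q2, r2, s2.
  exists (p1 + p2), (q1 + q2), (r1 + r2), (s1 + s2); split.
  - by rewrite -cevD z2 addr0.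
  - by rewrite -cevD z1 add0r.
  by move=> x y yE; rewrite -!cevD mulrDl H1 // H2.
have I1 n (h : {poly K}) : (size h < n)%N -> h != 0 -> I h -> I 1.
  elim: n h => // n IHn h; rewrite ltnS => hn h0 Ih.
  have [/eqP/size_poly1P[c c0 hE]|/closed_rootP[x0 rx0]] := eqVneq (size h) 1%N.
    have -> : 1 = c^-1%:P * h by rewrite hE -polyCM mulVf.
    exact: IM.
  (* The gcd with an element [k] of the ideal that does not vanish at the root [x0] of [h] is in the
     ideal and smaller than [h]. *)
  have [k Ik kx0] := Inz x0.
  have [[u v] /= /eqpP[[c d] /= /andP[c0 d0] E]] := Bezoutp h k.
  have g0 : gcdp h k != 0 by rewrite gcdp_eq0 negb_and h0.
  have Ig : I (gcdp h k).
    have -> : gcdp h k = d^-1%:P * (c *: (u * h + v * k)).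
      by rewrite E -mul_polyC mulrA -polyCM mulVf // mul1r.
    by apply/IM; rewrite -mul_polyC; apply/IM/ID; apply/IM.
  apply: (IHn (gcdp h k)) => //; apply: leq_trans hn.
  rewrite ltn_neqAle dvdp_leq ?dvdp_gcdl // andbT.
  apply/negP=> sE; have := dvdp_size_eqp (dvdp_gcdl h k); rewrite sE => /esym gh.
  have hk : h %| k by rewrite -(eqp_dvdl _ gh) dvdp_gcdr.
  case/negP: kx0; move: rx0; rewrite -[k.[x0] == 0]/(root k x0) !root_factor_theorem.
  by move/dvdp_trans; apply.
have [h Ih h0] := Inz 0.
have h0' : h != 0 by apply: contraNneq h0 => ->; rewrite horner0.
have [p [q H]] := I1 _ _ (ltnSn _) h0' Ih.
by exists p, q => x y yE; rewrite -H // hornerC mul1r.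
Qed.

Definition cdeg p q := (size (cnrm p q)).-1.

Lemma cdegM p q p' q' : cnrm p q != 0 -> cnrm p' q' != 0 ->
  cdeg (p * p' + cub * q * q') (p * q' + p' * q) = (cdeg p q + cdeg p' q')%N.
Proof.
move=> n0 n0'; rewrite /cdeg cnrmM size_mul //.
have : (0 < size (cnrm p q))%N by rewrite size_poly_gt0.
have : (0 < size (cnrm p' q'))%N by rewrite size_poly_gt0.
by case: (size (cnrm p q)) (size (cnrm p' q')) => [|n] [|k] //= _ _; rewrite addnS.
Qed.

Lemma cdeg0 p q : cdeg p q = 0%N -> exists2 c, p = c%:P & q = 0.
Proof.
rewrite /cdeg size_cnrm; case: eqP => [-> H|_ H]; last by lia.
have /size1_polyC pE : (size p <= 1)%N by lia.
by exists p`_0.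
Qed.

(** [P] splits into linear factors over [K], and subtracting a constant from a nonconstant function
    keeps its pole order. *)
Lemma cdeg_comp X1 X2 (P : {poly K}) : (0 < cdeg X1 X2)%N -> P != 0 ->
  exists u v, [/\ cnrm u v != 0, cdeg u v = ((size P).-1 * cdeg X1 X2)%N &
    forall x y, y ^+ 2 = cub.[x] -> P.[cev X1 X2 x y] = cev u v x y].
Proof.
move=> X0 P0; have [r ->] := closed_field_poly_normal P.
have lc0 : lead_coef P != 0 by rewrite lead_coef_eq0.
move: (lead_coef P) lc0 => c c0; rewrite size_scale // size_prod_XsubC /=.
elim: r => [|r rs [u [v [n0 dE evE]]]].
  exists c%:P, 0; rewrite mul0n; have nE : cnrm c%:P 0 = (c ^+ 2)%:P.
    by rewrite /cnrm expr0n mulr0 subr0 rmorphXn.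
  split; first by rewrite nE polyC_eq0 expf_neq0.
    by rewrite /cdeg nE size_polyC expf_neq0.
  by move=> x y _; rewrite big_nil hornerZ hornerC /cev horner0 mulr0 addr0 hornerC mulr1.
have sE : size (cnrm (X1 - r%:P) (X2 + 0)) = size (cnrm X1 X2).
  apply: cnrm_ultra; apply: leq_ltn_trans (_ : (1 < _)%N); last first.
    by move: X0; rewrite /cdeg; case: (size _) => [|[]].
  rewrite /cnrm expr0n mulr0 subr0 sqrrN -rmorphXn; exact: size_polyC_leq1.
rewrite addr0 in sE.
have n0' : cnrm (X1 - r%:P) X2 != 0.
  by rewrite -size_poly_eq0 sE; move: X0; rewrite /cdeg; case: (size _).
exists (u * (X1 - r%:P) + cub * v * X2), (u * X2 + (X1 - r%:P) * v); split.
- by rewrite cnrmM mulf_neq0.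
- by rewrite cdegM // dE mulSn addnC /cdeg sE.
move=> x y yE; rewrite big_cons -cevM // -evE // !hornerZ hornerM hornerXsubC.
have -> : cev (X1 - r%:P) X2 x y = cev X1 X2 x y - r.
  by rewrite /cev hornerD hornerN hornerC addrAC.
by ring.
Qed.

(** With [n], [m] the pole orders of [X] and [Y], the first hypothesis gives [2 m = 3 n]. In
    [x = P(X) + Y Q(X)] the two terms have different orders, so nothing cancels and the larger order
    is 2. This forces [n = 2] and [m = 3]. *)
Lemma cdeg_rigid X1 X2 Y1 Y2 P Q :
  (forall x y, y ^+ 2 = cub.[x] -> cev Y1 Y2 x y ^+ 2 = cub.[cev X1 X2 x y]) ->
  (forall x y, y ^+ 2 = cub.[x] -> cev P Q (cev X1 X2 x y) (cev Y1 Y2 x y) = x) ->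
  [/\ X2 = 0, size X1 = 2%N, (size Y1 <= 2)%N & size Y2 = 1%N].
Proof.
move=> HY HX.
have YY x y : y ^+ 2 = cub.[x] ->
    cev (Y1 * Y1 + cub * Y2 * Y2) (Y1 * Y2 + Y1 * Y2) x y = cub.[cev X1 X2 x y].
  by move=> yE; rewrite -cevM // -expr2 HY.
have noconst c : ~ (forall x y, y ^+ 2 = cub.[x] -> x = c).
  move=> H; have [] := @cev_inj 'X 0 c%:P 0.
    by move=> x y /H E; rewrite /cev !hornerE.
  by move/(congr1 (fun p : {poly K} => size p)); rewrite size_polyX size_polyC; case: (c != 0).
have XN : (0 < cdeg X1 X2)%N.
  (* If [X] were constant, so would be [Y], and then [x] by the second hypothesis. *)
  rewrite lt0n; apply/eqP=> /cdeg0[c X1E X2E].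
  have Xc x y : cev X1 X2 x y = c by rewrite /cev X1E X2E !hornerE.
  have [] := @cev_inj (Y1 * Y1 + cub * Y2 * Y2) (Y1 * Y2 + Y1 * Y2) cub.[c]%:P 0.
    by move=> x y /YY ->; rewrite Xc /cev !hornerE.
  move=> E1 E2; have : cnrm Y1 Y2 * cnrm Y1 Y2 = (cub.[c] ^+ 2)%:P.
    by rewrite -cnrmM E1 E2 /cnrm expr0n mulr0 subr0 rmorphXn.
  move/(congr1 (fun p : {poly K} => size p)); have := size_polyC_leq1 (cub.[c] ^+ 2).
  rewrite -expr2 size_sq => + E; rewrite -E => sN.
  have /cdeg0[d Y1E Y2E] : cdeg Y1 Y2 = 0%N by rewrite /cdeg; lia.
  apply: (noconst (P.[c] + d * Q.[c])) => x y yE.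
  by rewrite -[LHS](HX x y yE) Xc /cev Y1E Y2E !hornerE.
have cub0 := cub_neq0.
have [u [v [n0 dE uvE]]] := cdeg_comp XN cub0.
have [E1 E2] : Y1 * Y1 + cub * Y2 * Y2 = u /\ Y1 * Y2 + Y1 * Y2 = v.
  by apply: cev_inj => x y yE; rewrite YY // uvE.
have NY : cnrm Y1 Y2 != 0.
  by apply: contraNneq n0 => NY; rewrite -E1 -E2 cnrmM NY mul0r.
have := cdegM NY NY; rewrite E1 E2 dE size_cub /= => /esym m23.
have xdeg : cdeg 'X 0 = 2%N.
  by rewrite /cdeg size_cnrm eqxx size_polyX.
have xE u' v' : (forall x y, y ^+ 2 = cub.[x] -> cev u' v' x y = x) -> cdeg u' v' = 2%N.
  move=> H; have [] := @cev_inj u' v' 'X 0; last by move=> -> ->.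
  by move=> x y yE; rewrite H // /cev !hornerE.
have dX : cdeg X1 X2 = 2%N.
  have Yq w z : cnrm w z != 0 ->
      cdeg (Y1 * w + cub * Y2 * z) (Y1 * z + w * Y2) = (cdeg Y1 Y2 + cdeg w z)%N.
    by move=> wz0; rewrite cdegM.
  have [P0|P0] := eqVneq P 0; have [Q0|Q0] := eqVneq Q 0.
  - by case: (noconst 0) => x y yE; rewrite -[LHS](HX x y yE) P0 Q0 /cev !hornerE.
  - have [w [z [wz0 wzd wzE]]] := cdeg_comp XN Q0.
    have : cdeg (Y1 * w + cub * Y2 * z) (Y1 * z + w * Y2) = 2%N.
      by apply: xE => x y yE; rewrite -cevM // -wzE // -[RHS](HX x y yE) P0 /cev !hornerE.
    by rewrite Yq // wzd => /(deg_odd m23 XN).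
  - have [w [z [wz0 wzd wzE]]] := cdeg_comp XN P0.
    have : cdeg w z = 2%N.
      by apply: xE => x y yE; rewrite -wzE // -[RHS](HX x y yE) Q0 /cev !hornerE.
    by rewrite wzd => /(deg_even m23 XN).
  have [w [z [wz0 wzd wzE]]] := cdeg_comp XN Q0.
  have [s [t [st0 std stE]]] := cdeg_comp XN P0.
  have : cdeg (s + (Y1 * w + cub * Y2 * z)) (t + (Y1 * z + w * Y2)) = 2%N.
    by apply: xE => x y yE; rewrite -cevD -cevM // -wzE // -stE // -[RHS](HX x y yE).
  have := Yq w z wz0; rewrite wzd.
  have ysz : (0 < size (cnrm (Y1 * w + cub * Y2 * z) (Y1 * z + w * Y2)))%N.
    by rewrite size_poly_gt0 cnrmM mulf_neq0.
  have ssz : (0 < size (cnrm s t))%N by rewrite size_poly_gt0.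
  move: std; rewrite /cdeg in m23 XN * => std yd.
  case: (ltngtP (size (cnrm s t)) (size (cnrm (Y1 * w + cub * Y2 * z) (Y1 * z + w * Y2)))) => lt.
  - by rewrite [s + _]addrC [t + _]addrC cnrm_ultra // yd => /(deg_odd m23 XN).
  - by rewrite cnrm_ultra // std => /(deg_even m23 XN).
  by move: std; rewrite lt yd => /esym/(deg_parity m23 XN).
have dY : cdeg Y1 Y2 = 3%N by lia.
move: dX dY; rewrite /cdeg !size_cnrm -(size_poly_eq0 X2) -(size_poly_eq0 Y2) => dX dY.
have /eqP sX2 : size X2 = 0%N by move: dX; case: eqP => //; lia.
rewrite size_poly_eq0 in sX2; move: dX; rewrite (eqP sX2) size_poly0 /= => dX.
move: dX dY; move: (size X1) (size Y1) (size Y2) => n m k; case: k => [|k] /= dX dY.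
  by exfalso; lia.
by split=> //; lia.
Qed.

End CoordRing.

(** * Automorphisms of the curve that fix [O] are scalings *)

Section CurveMorphisms.
Variables (F : finFieldType) (K : closedFieldType) (iota : {rmorphism F -> K}).
Variables (a b : F).
Hypotheses (two_neq0 : 2 != 0 :> F) (three_neq0 : 3 != 0 :> F).

Local Notation A := (iota a).
Local Notation B := (iota b).
Local Notation EK := (ecpoint A B).

Definition wcub : {poly K} := 'X^3 + A *: 'X + B%:P.

Lemma wcubE x : wcub.[x] = x ^+ 3 + A * x + B.
Proof. by rewrite /wcub !hornerE. Qed.

Lemma size_wcub : size wcub = 4%N.
Proof.
rewrite /wcub -addrA size_polyDl ?size_polyXn //.
rewrite (leq_ltn_trans (size_polyD _ _)) // gtn_max.
rewrite (leq_ltn_trans (size_scale_leq _ _)) ?size_polyX //= ltnS.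
by rewrite (leq_trans (size_polyC_leq1 _)).
Qed.

Lemma twoK : 2 != 0 :> K.
Proof. by rewrite -(rmorph_nat iota) fmorph_eq0. Qed.

Lemma threeK : 3 != 0 :> K.
Proof. by rewrite -(rmorph_nat iota) fmorph_eq0. Qed.

Lemma mpoly_cev (f : {mpoly K[3]}) : exists p q, forall x y, y ^+ 2 = wcub.[x] ->
  f.@[hcoord (Some (x, y)) 0] = cev p q x y.
Proof.
pose P (g : (K -> K -> K)) := exists p q, forall x y, y ^+ 2 = wcub.[x] -> g x y = cev p q x y.
have PM g h : P g -> P h -> P (fun x y => g x y * h x y).
  move=> [p [q H]] [p' [q' H']]; exists (p * p' + wcub * q * q'), (p * q' + p' * q).
  by move=> x y yE; rewrite -cevM // H // H'.
have PC c : P (fun _ _ => c).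
  by exists c%:P, 0 => x y _; rewrite /cev !hornerE.
have PX g n : P g -> P (fun x y => g x y ^+ n).
  move=> Pg; elim: n => [|n IH]; first by apply: PC.
  by have := PM _ _ Pg IH; congr P; apply/funext=> x; apply/funext=> y; rewrite exprS.
have Pv i : P (fun x y => hcoord (Some (x, y)) 0 i).
  case: (ord3P i) => ->.
  - by exists 'X, 0 => x y _; rewrite mxE /cev !hornerE.
  - by exists 0, 1 => x y _; rewrite mxE /cev !hornerE.
  - by exists 1, 0 => x y _; rewrite mxE /cev !hornerE.
suff [p [q H]] : P (fun x y => f.@[hcoord (Some (x, y)) 0]) by exists p, q.
elim/mpolyind: f => [|c m f _ _ [p [q H]]].
  by exists 0, 0 => x y _; rewrite meval0 /cev !hornerE.
have [p' [q' H']] : P (fun x y => ('X_[m] : {mpoly K[3]}).@[hcoord (Some (x, y)) 0]).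
  have := PM _ _ (PX _ (m ord0) (Pv ord0)) (PM _ _ (PX _ (m (lift ord0 ord0)) (Pv (lift ord0 ord0)))
     (PX _ (m (lift ord0 (lift ord0 ord0))) (Pv (lift ord0 (lift ord0 ord0))))).
  congr P; apply/funext=> x; apply/funext=> y.
  by rewrite mevalX !big_ord_recl big_ord0 mulr1.
exists (c *: p' + p), (c *: q' + q) => x y yE.
by rewrite mevalD mevalZ H // H' // /cev !(hornerD, hornerZ); ring.
Qed.

Lemma ecpoint_some (Q : EK) : Q != ec_zero A B ->
  exists x y, val Q = Some (x, y) /\ y ^+ 2 = wcub.[x].
Proof.
case: Q => [[[x y]|]] //= onQ _; exists x, y; split=> //.
by rewrite wcubE; apply/eqP.
Qed.

Lemma ecpoint_ex x y : y ^+ 2 = wcub.[x] -> exists2 Q : EK, Q != ec_zero A B & val Q = Some (x, y).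
Proof.
rewrite wcubE => /eqP onQ.
by exists (exist (on_curve A B) (Some (x, y)) onQ).
Qed.

Lemma hcoordE x y : [/\ hcoord (Some (x, y)) 0 0 = x, hcoord (Some (x, y)) 0 1 = y
   & hcoord (Some (x, y)) 0 2%:R = 1 :> K].
Proof. by split; rewrite mxE. Qed.

(** Near each finite point the coordinates of the image are quotients by the third form, which is
    nonzero there because the image is finite too. So they are regular, and [cregular_poly] makes
    them polynomial. *)
Lemma morphism_cev (phi : EK -> EK) : ec_morphism phi ->
  (forall Q, Q != ec_zero A B -> phi Q != ec_zero A B) ->
  exists X1 X2 Y1 Y2, forall Q x y, val Q = Some (x, y) ->
    val (phi Q) = Some (cev X1 X2 x y, cev Y1 Y2 x y).
Proof.
move=> phi_mor phi0.
pose G i x y := if insub (Some (x, y)) is Some Q then hcoord (val (phi Q)) 0 i else 0.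
have GE i Q x y : val Q = Some (x, y) -> G i x y = hcoord (val (phi Q)) 0 i.
  by move=> QE; rewrite /G -QE valK.
have reg i : cregular wcub (G i).
  move=> x0 y0 y0E; have [R R0 RE] := ecpoint_ex y0E.
  have [d [f [_ fR fQ]]] := phi_mor R.
  have [p [q pq]] := mpoly_cev (map_mpoly iota (f 2%:R)).
  have [p' [q' pq']] := mpoly_cev (map_mpoly iota (f i)).
  have third Q : Q != ec_zero A B -> hcoord (val (phi Q)) 0 2%:R = 1.
    by move/phi0/ecpoint_some => [x [y [-> _]]]; case: (hcoordE x y).
  exists p, q, p', q'; split.
    rewrite -pq // -RE; have [c cE] := fQ R fR.
    have /rowP/(_ 2%:R) := cE; rewrite !mxE third // mulr1 => ->.
    by apply: contraNneq fR => c0; rewrite cE c0 scale0r.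
  move=> x y yE; have [Q Q0 QE] := ecpoint_ex yE.
  rewrite (GE _ _ _ _ QE) -pq // -pq' // -QE.
  (* Where all three forms vanish, the required identity reads [0 = 0]. *)
  have [z|/fQ[c cE]] := eqVneq (heval f Q) 0.
    have /rowP z' := z; have := z' 2%:R; rewrite !mxE => ->.
    by have := z' i; rewrite !mxE => ->; rewrite mul0r.
  have /rowP cE' := cE; have := cE' 2%:R; rewrite !mxE third // mulr1 => ->.
  by have := cE' i; rewrite !mxE => ->.
have [X1 [X2 XE]] := cregular_poly (reg 0).
have [Y1 [Y2 YE]] := cregular_poly (reg 1).
exists X1, X2, Y1, Y2 => Q x y QE.
have Q0 : Q != ec_zero A B by apply: contra_eq_neq QE => ->.
have [x1 [y1 [E1 yE]]] := ecpoint_some Q0; rewrite QE in E1.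
case: E1 => ex ey; rewrite -{}ex -{}ey in yE.
rewrite -XE // -YE // !(GE _ _ _ _ QE).
by have [u [v [-> _]]] := ecpoint_some (phi0 _ Q0); have [-> -> _] := hcoordE u v.
Qed.

(** [cdeg_rigid], with the inverse supplying [x], gives [X = al x + be] and [Y = Y1 + ga y]. As
    [Y^2] has no term in [y], [Y1 = 0]; the coefficient of [x^2] in the transformed equation gives
    [be = 0]. *)
Lemma automorphism_linear (phi : EK -> EK) : ec_automorphism phi ->
  phi (ec_zero A B) = ec_zero A B ->
  exists al ga, [/\ al != 0, ga != 0,
    forall Q x y, val Q = Some (x, y) -> val (phi Q) = Some (al * x, ga * y) &
    [/\ ga ^+ 2 = al ^+ 3, ga ^+ 2 * A = al * A & ga ^+ 2 * B = B]].
Proof.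
case=> phi_mor [psi [psi_mor phiK psiK]] phiO.
have psiO : psi (ec_zero A B) = ec_zero A B by rewrite -phiO phiK.
have phi0 Q : Q != ec_zero A B -> phi Q != ec_zero A B.
  by apply: contra_neq => E; rewrite -[Q]phiK E psiO.
have psi0 Q : Q != ec_zero A B -> psi Q != ec_zero A B.
  by apply: contra_neq => E; rewrite -[Q]psiK E phiO.
have [X1 [X2 [Y1 [Y2 phiE]]]] := morphism_cev phi_mor phi0.
have [P [Q [P' [Q' psiE]]]] := morphism_cev psi_mor psi0.
have HY x y : y ^+ 2 = wcub.[x] -> cev Y1 Y2 x y ^+ 2 = wcub.[cev X1 X2 x y].
  move=> yE; have [R R0 RE] := ecpoint_ex yE.
  have [u [v [E vE]]] := ecpoint_some (phi0 R R0).
  by move: E vE; rewrite (phiE _ _ _ RE) => -[-> ->].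
have HX x y : y ^+ 2 = wcub.[x] -> cev P Q (cev X1 X2 x y) (cev Y1 Y2 x y) = x.
  move=> yE; have [R R0 RE] := ecpoint_ex yE.
  have := psiE _ _ _ (phiE _ _ _ RE).
  by rewrite phiK RE => -[].
have [X20 sX1 _ sY2] := cdeg_rigid twoK size_wcub HY HX.
have /size1_polyC Y2E : (size Y2 <= 1)%N by rewrite sY2.
set ga := Y2`_0 in Y2E; pose al := X1`_1; pose be := X1`_0.
have ga0 : ga != 0.
  by move: sY2; rewrite Y2E size_polyC; case: eqP.
have al0 : al != 0.
  have : lead_coef X1 != 0 by rewrite lead_coef_eq0 -size_poly_gt0 sX1.
  by rewrite /lead_coef sX1.
have X1E x : X1.[x] = al * x + be.
  by rewrite horner_coef sX1 !big_ord_recl big_ord0 /= expr0 expr1 mulr1 addr0 addrC.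
have [E1 E2] : Y1 * Y1 + wcub * Y2 * Y2 = wcub \Po X1 /\ Y1 * Y2 + Y1 * Y2 = 0.
  apply: (cev_inj twoK size_wcub) => x y yE; rewrite -cevM // -expr2 HY //.
  by rewrite /cev X20 !horner0 !mulr0 !addr0 horner_comp.
have Y10 : Y1 = 0.
  move/eqP: E2; rewrite -mulr2n -mulr_natl -polyC_natr mulrA mulf_eq0 Y2E.
  rewrite polyC_eq0 (negPf ga0) orbF.
  by rewrite mulf_eq0 polyC_eq0 (negPf twoK) => /eqP.
have E3 x : ga ^+ 2 * wcub.[x] = wcub.[al * x + be].
  rewrite -X1E -horner_comp -E1 Y10 Y2E mul0r add0r !hornerM !hornerC; ring.
have : (ga ^+ 2 * B - be ^+ 3 - A * be - B)%:P + 'X *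
   ((ga ^+ 2 * A - 3 * al * be ^+ 2 - A * al)%:P + 'X *
   ((- 3 * al ^+ 2 * be)%:P + 'X * ((ga ^+ 2 - al ^+ 3)%:P + 'X * 0))) = 0.
  apply: poly_eq0_all => x; have := E3 x; rewrite !wcubE => /eqP.
  rewrite -subr_eq0 => /eqP <-; rewrite !(hornerD, hornerM, hornerC, hornerX, horner0); ring.
case/polyCX_eq0=> c0 /polyCX_eq0[c1 /polyCX_eq0[c2 /polyCX_eq0[c3 _]]].
have be0 : be = 0.
  have c20 : - 3 * al ^+ 2 != 0 by rewrite mulf_neq0 ?oppr_eq0 ?threeK ?expf_neq0.
  by apply: (mulfI c20); rewrite c2 mulr0.
exists al, ga; split=> //.
  move=> R x y RE; rewrite (phiE _ _ _ RE) /cev X20 Y10 Y2E !horner0 hornerC X1E be0.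
  by rewrite mulr0 !addr0 add0r mulrC [y * _]mulrC mulrC.
split; apply/eqP; rewrite -subr_eq0; apply/eqP.
- by [].
- by rewrite -c1 be0; ring.
by rewrite -c0 be0; ring.
Qed.

Variables (p e : nat).
Hypotheses (charF : p \in [pchar F]) (cardF : #|F| = (p ^ e)%N).

Lemma frobenius_ex : exists tau : {rmorphism K -> K}, forall x, tau x = x ^+ #|F|.
Proof.
have pK : p \in [pchar K] := rmorph_pchar iota charF.
have pp : prime p := pcharf_prime charF.
have tB : zmod_morphism (fun x : K => x ^+ #|F|).
  have qn : ([pchar K]).-nat #|F| by rewrite cardF pnatX pnatE // pK.
  move=> x y /=; have := exprDn_pchar (x - y) y qn; rewrite subrK => ->.
  by rewrite addrK.
have tM : monoid_morphism (fun x : K => x ^+ #|F|).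
  by split; [rewrite expr1n|move=> x y; rewrite exprMn].
pose sa := GRing.isZmodMorphism.Build K K (fun x : K => x ^+ #|F|) tB.
pose sm := GRing.isMonoidMorphism.Build K K (fun x : K => x ^+ #|F|) tM.
by exists (HB.pack (fun x : K => x ^+ #|F|) sa sm : {rmorphism K -> K}).
Qed.

(** [X^q - X] is the product of all [X - d] with [d] in [F], so its roots in [K] come from [F]. *)
Lemma fixed_frobenius (c : K) : c ^+ #|F| = c -> exists d, c = iota d.
Proof.
move=> cE; have : (map_poly iota ('X^#|F| - 'X)).[c] = 0.
  by rewrite rmorphB rmorphXn /= map_polyX !hornerE cE subrr.
rewrite finField_genPoly rmorph_prod horner_prod => /eqP/prodf_eq0[d _].
by rewrite rmorphB /= map_polyX map_polyC !hornerE subr_eq0 => /eqP ->; exists d.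
Qed.

Lemma meval_frobenius (tau : {rmorphism K -> K}) (f : {mpoly F[3]}) (v w : 'I_3 -> K) :
  (forall c, tau (iota c) = iota c) -> (forall i, tau (v i) = w i) ->
  tau (map_mpoly iota f).@[v] = (map_mpoly iota f).@[w].
Proof.
move=> tauF tv; elim/mpolyind: f => [|c m f _ _ IH].
  by rewrite !raddf0 ?meval0 ?rmorph0.
rewrite !raddfD /= IH; congr (_ + _).
rewrite map_mpolyZ map_mpolyX !mevalZ !mevalX rmorphM tauF rmorph_prod; congr (_ * _).
by apply: eq_bigr => i _; rewrite rmorphXn tv.
Qed.

(** The local forms have coefficients in [F], which [tau] fixes, so they commute with [tau]. *)
Lemma morphism_frobenius (tau : {rmorphism K -> K}) (phi : EK -> EK) (Q Q' : EK) :
  (forall c, tau (iota c) = iota c) -> ec_morphism phi ->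
  val Q' = omap (fun xy => (tau xy.1, tau xy.2)) (val Q) ->
  val (phi Q') = omap (fun xy => (tau xy.1, tau xy.2)) (val (phi Q)).
Proof.
move=> tauF phi_mor QQ'.
have hc (R : option (K * K)) i :
    tau (hcoord R 0 i) = hcoord (omap (fun xy => (tau xy.1, tau xy.2)) R) 0 i.
  case: R => [[x y]|]; rewrite !mxE /=;
    by case: (ord3P i) => -> /=; rewrite ?rmorph0 ?rmorph1.
have [d [f [_ fQ0 fQ]]] := phi_mor Q.
have [c cE] := fQ Q fQ0.
have c0 : c != 0 by apply: contraNneq fQ0 => c0; rewrite cE c0 scale0r.
have E : heval f Q' = tau c *: hcoord (omap (fun xy => (tau xy.1, tau xy.2)) (val (phi Q))).
  apply/rowP=> i; rewrite !mxE -hc -rmorphM.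
  have /rowP/(_ i) := cE; rewrite !mxE => <-; symmetry.
  by apply: meval_frobenius => // j; rewrite QQ' hc.
have Q'0 : heval f Q' != 0.
  rewrite E scaler_eq0 fmorph_eq0 (negPf c0) /=.
  case: (val (phi Q)) => [[x y]|] /=; apply/eqP=> /rowP H.
    by have := H 2%:R; rewrite !mxE /= => /eqP; rewrite oner_eq0.
  by have := H 1; rewrite !mxE /= => /eqP; rewrite oner_eq0.
have [c' c'E] := fQ Q' Q'0.
have c'0 : c' != 0 by apply: contraNneq Q'0 => c'0; rewrite c'E c'0 scale0r.
apply: (@hcoord_inj _ _ _ (c'^-1 * tau c)).
by rewrite -scalerA -E c'E scalerA mulVf // scale1r.
Qed.

Definition ec_scale_raw (u : F) (Q : option (K * K)) : option (K * K) :=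
  omap (fun xy => (iota u ^+ 2 * xy.1, iota u ^+ 3 * xy.2)) Q.

(** At such a point the factors of a scaling can be read off from both coordinates. *)
Lemma point_nonzero : exists x y, [/\ y ^+ 2 = wcub.[x], x != 0 & y != 0].
Proof.
have [x] : exists x, ('X * wcub).[x] != 0.
  apply: contrapT => H; have : 'X * wcub = 0.
    by apply: poly_eq0_all => x; apply/eqP; apply: contrapT => /negP ?; apply: H; exists x.
  by apply/eqP; rewrite mulf_neq0 ?polyX_eq0 // -size_poly_eq0 size_wcub.
rewrite hornerM hornerX mulf_eq0 negb_or => /andP[x0 w0].
have [y yE] := sqrt_exists wcub.[x]; exists x, y; split=> //.
by apply: contraNneq w0 => y0; rewrite -yE y0 expr0n.
Qed.

Lemma AutO_shape (phi : EK -> EK) : ec_automorphism phi ->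
  phi (ec_zero A B) = ec_zero A B ->
  exists2 u, u \in ec_units a b & forall Q, val (phi Q) = ec_scale_raw u (val Q).
Proof.
move=> phiA phiO; have [al [ga [al0 ga0 phiE [E1 E2 E3]]]] := automorphism_linear phiA phiO.
have [tau tauE] := frobenius_ex.
have tauF c : tau (iota c) = iota c by rewrite tauE -rmorphXn expf_card.
have [x [y [yE x0 y0]]] := point_nonzero.
have [Q Q0 QE] := ecpoint_ex yE.
have yE' : tau y ^+ 2 = wcub.[tau x].
  rewrite wcubE -(tauF a) -(tauF b) -!(rmorphXn, rmorphM, rmorphD) yE wcubE.
  by rewrite !(rmorphXn, rmorphM, rmorphD).
have [Q' Q0' QE'] := ecpoint_ex yE'.
have := morphism_frobenius (Q := Q) (Q' := Q') tauF (proj1 phiA).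
rewrite QE QE' (phiE _ _ _ QE) (phiE _ _ _ QE') => /(_ erefl) [].
rewrite !rmorphM => /(mulIf _) eal /(mulIf _) ega.
have [al1 al1E] : exists d, al = iota d.
  by apply: fixed_frobenius; rewrite -tauE -eal // fmorph_eq0.
have [ga1 ga1E] : exists d, ga = iota d.
  by apply: fixed_frobenius; rewrite -tauE -ega // fmorph_eq0.
rewrite al1E ga1E in al0 ga0 E1 E2 E3 phiE.
rewrite !fmorph_eq0 in al0 ga0.
have {}E1 : ga1 ^+ 2 = al1 ^+ 3 by apply: (fmorph_inj iota); rewrite !rmorphXn.
have {}E2 : ga1 ^+ 2 * a = al1 * a.
  by apply: (fmorph_inj iota); rewrite rmorphM rmorphXn E2 rmorphM.
have {}E3 : ga1 ^+ 2 * b = b by apply: (fmorph_inj iota); rewrite rmorphM rmorphXn.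
(* From [ga1^2 = al1^3] one gets [u^2 = al1] and [u^3 = ga1]. *)
pose u := ga1 / al1.
have u2 : u ^+ 2 = al1 by rewrite expr_div_n E1; field.
have u3 : u ^+ 3 = ga1 by rewrite exprSr u2 /u mulrC divfK.
exists u.
  rewrite inE mulf_neq0 ?invr_neq0 //= (exprM u 2 2) (exprM u 3 2) u2 u3 E3 eqxx andbT.
  apply/eqP/(mulfI al0); rewrite -E2 E1; ring.
case=> [[[x1 y1]|]] onR; last by rewrite /= (_ : exist _ _ _ = ec_zero A B) ?phiO //; apply/val_inj.
by rewrite /= (phiE _ x1 y1) // -!rmorphXn u2 u3.
Qed.

End CurveMorphisms.

Lemma card_fset_set_imset (U : finType) (T : choiceType) (f : U -> T) (S : {set U}) :
  {in S &, injective f} -> #|` fset_set (f @` [set` S])%classic| = #|S|.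
Proof.
move=> f_inj.
have -> : fset_set (f @` [set` S])%classic = [fset f x | x in S]%fset.
  apply/fsetP=> y; rewrite in_fset_set; last exact/finite_image/finite_finset.
  apply/idP/imfsetP => [|[x /= xS ->]].
    by rewrite inE => -[x /= xS <-]; exists x.
  by rewrite inE; exists x.
by rewrite card_in_imfset //= cardE.
Qed.

(** * The orders of the automorphism group and of the orbit of [P] *)

Section CardAutO.
Variables (F : finFieldType) (K : closedFieldType) (iota : {rmorphism F -> K}).
Variables (a b : F) (p e : nat).
Hypotheses (two_neq0 : 2 != 0 :> F) (three_neq0 : 3 != 0 :> F).
Hypotheses (charF : p \in [pchar F]) (cardF : #|F| = (p ^ e)%N).

Local Notation A := (iota a).
Local Notation B := (iota b).
Local Notation EK := (ecpoint A B).

(** The default [O] of [insubd] is never taken for [u] in [ec_units], as [val_ec_scale] shows. *)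
Definition ec_scale (u : F) (Q : EK) : EK :=
  insubd (ec_zero A B) (ec_scale_raw iota u (val Q)).

Lemma val_ec_scale u Q : u \in ec_units a b -> val (ec_scale u Q) = ec_scale_raw iota u (val Q).
Proof.
rewrite inE => /and3P[u0 /eqP u4 /eqP u6]; rewrite val_insubd.
suff -> : on_curve A B (ec_scale_raw iota u (val Q)) by [].
case: Q => [[[x y]|]] //= /eqP E; apply/eqP.
have {}u4 : iota u ^+ 4 * A = A by rewrite -rmorphXn -rmorphM u4.
have {}u6 : iota u ^+ 6 * B = B by rewrite -rmorphXn -rmorphM u6.
rewrite exprMn E.
have -> : A * (iota u ^+ 2 * x) = iota u ^+ 6 * (A * x) by rewrite -{1}u4; ring.
by rewrite -[X in _ = _ + X]u6; ring.
Qed.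

Lemma ec_units1V u : u \in ec_units a b -> u^-1 \in ec_units a b.
Proof.
rewrite !inE => /and3P[u0 /eqP u4 /eqP u6]; rewrite invr_eq0 u0 !exprVn.
by rewrite -{1}u4 -{1}u6 !mulKf ?expf_neq0 // !eqxx.
Qed.

Lemma ec_scale_zero u : u \in ec_units a b -> ec_scale u (ec_zero A B) = ec_zero A B.
Proof. by move=> uU; apply/val_inj; rewrite val_ec_scale. Qed.

Lemma ec_scaleK u : u \in ec_units a b -> cancel (ec_scale u) (ec_scale u^-1).
Proof.
move=> uU Q; apply/val_inj; rewrite !val_ec_scale ?ec_units1V //.
case: Q => [[[x y]|]] //= _; move: uU; rewrite inE => /andP[u0 _].
by rewrite fmorphV !exprVn !mulKf ?expf_neq0 ?fmorph_eq0.
Qed.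

Lemma ec_scale_morphism u : u \in ec_units a b -> ec_morphism (ec_scale u).
Proof.
move=> uU R; have := uU; rewrite inE => /andP[u0 _].
pose c (i : 'I_3) := [:: u ^+ 2; u ^+ 3; 1]`_i.
have E (Q : EK) i : heval (fun i => c i *: 'X_i) Q 0 i = iota (c i) * hcoord (val Q) 0 i.
  by rewrite mxE map_mpolyZ map_mpolyX mevalZ mevalXU.
exists 1%N, (fun i => c i *: 'X_i); split.
- by move=> i; apply: dhomogZ; rewrite dhomogX /= mdeg1.
- case: R => [[[x y]|]] onR; apply/eqP=> /rowP H.
    by have := H 2%:R; rewrite E !mxE /= rmorph1 mulr1 => /eqP; rewrite oner_eq0.
  have := H 1; rewrite E !mxE /= mulr1 => /eqP; rewrite fmorph_eq0.
  by rewrite expf_eq0 (negPf u0).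
move=> Q _; rewrite val_ec_scale //; case: Q => [[[x y]|]] onQ /=.
  exists 1; rewrite scale1r; apply/rowP=> i; rewrite E !mxE.
  by case: (ord3P i) => -> /=; rewrite ?rmorphXn ?rmorph1 ?mulr1.
exists (iota u ^+ 3); apply/rowP=> i; rewrite E !mxE.
by case: (ord3P i) => -> /=; rewrite ?rmorphXn ?mulr0 ?mulr1.
Qed.

Lemma ec_AutOE : ec_AutO iota a b = (ec_scale @` [set` ec_units a b])%classic.
Proof.
apply/seteqP; split=> phi.
  move=> [phiA phiO].
  have [u uU uE] := AutO_shape two_neq0 three_neq0 charF cardF phiA phiO.
  exists u => //; apply/funext=> Q; apply/val_inj.
  by rewrite val_ec_scale // uE.
case=> u /= uU <-; split; last exact: ec_scale_zero.
split; first exact: ec_scale_morphism.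
exists (ec_scale u^-1); split; first by apply/ec_scale_morphism/ec_units1V.
  exact: ec_scaleK.
by rewrite -{2}[u]invrK; apply/ec_scaleK/ec_units1V.
Qed.

Lemma card_AutO : #|` fset_set (ec_AutO iota a b)| = #|ec_units a b|.
Proof.
rewrite ec_AutOE card_fset_set_imset // => u u' uU uU' E.
have [x [y [yE x0 y0]]] := point_nonzero iota a b.
have [Q Q0 QE] := ecpoint_ex yE.
have := congr1 (fun f => val (f Q)) E; rewrite !val_ec_scale // QE => -[].
move=> /(mulIf x0) E2 /(mulIf y0) E3; apply: (fmorph_inj iota).
have u0 : iota u != 0 by move: uU; rewrite inE fmorph_eq0 => /andP[].
by apply: (mulfI (expf_neq0 2 u0)); rewrite -exprSr E3 E2 exprSr.
Qed.

Variables (l m : F).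
Hypothesis onP : on_curve a b (Some (l, m)).
Let P : ecpoint a b := exist (on_curve a b) (Some (l, m)) onP.

Lemma card_ec_orbit_imset : #|` fset_set (ec_orbit iota P)| =
  #|[set (u ^+ 2 * l, u ^+ 3 * m) | u in ec_units a b]|.
Proof.
pose f (q : F * F) : EK := insubd (ec_zero A B) (Some (iota q.1, iota q.2)).
have fE u : u \in ec_units a b -> f (u ^+ 2 * l, u ^+ 3 * m) = ec_scale u (ec_map iota P).
  by move=> uU; rewrite /f /ec_scale /= (rmorphM iota (u ^+ 2)) (rmorphM iota (u ^+ 3)) !rmorphXn.
have fV u : u \in ec_units a b ->
    val (f (u ^+ 2 * l, u ^+ 3 * m)) = Some (iota (u ^+ 2 * l), iota (u ^+ 3 * m)).
  move=> uU; rewrite fE // val_ec_scale //=.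
  by rewrite (rmorphM iota (u ^+ 2)) (rmorphM iota (u ^+ 3)) !rmorphXn.
rewrite -(@card_fset_set_imset _ _ f); last first.
  move=> q q' /imsetP[u uU ->] /imsetP[u' uU' ->] /(congr1 val).
  by rewrite !fV // => -[/fmorph_inj -> /fmorph_inj ->].
congr #|` fset_set _|; rewrite /ec_orbit ec_AutOE; apply/seteqP; split=> R.
  case=> phi [u /= uU <-] <-; exists (u ^+ 2 * l, u ^+ 3 * m); last exact: fE.
  by apply/imsetP; exists u.
case=> q /= /imsetP[u uU ->] <-; rewrite fE //; exists (ec_scale u) => //.
by exists u.
Qed.

(** Orbit and stabiliser: the fibre of [g] over the image of [u] is the coset of [u], shifted to the
    stabiliser by division by [u]. *)
Lemma card_ec_orbit :
  (#|` fset_set (ec_orbit iota P)| * #|ec_units_stab a b l m|)%N = #|ec_units a b|.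
Proof.
rewrite card_ec_orbit_imset.
set g := fun u : F => (u ^+ 2 * l, u ^+ 3 * m).
rewrite -[RHS]sum1_card (partition_big_imset g) /= -sum_nat_const.
apply: eq_bigr => q /imsetP[u uU ->].
have := uU; rewrite inE => /and3P[u0 /eqP u4 /eqP u6].
rewrite -sum1_card (reindex_onto (fun v => v / u) (fun v => v * u)) /=; last first.
  by move=> v _; rewrite mulfK.
apply: eq_bigl => v; rewrite divfK // eqxx andbT.
rewrite !inE mulf_eq0 invr_eq0 (negPf u0) orbF !expr_div_n -!andbA.
have sc k (c d : F) : (v ^+ k / u ^+ k * c == d) = (v ^+ k * c == u ^+ k * d).
  have uk0 : u ^+ k != 0 by rewrite expf_neq0.
  by rewrite -[RHS](inj_eq (mulfI (invr_neq0 uk0))) mulKf // mulrA [_^-1 * _]mulrC.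
by rewrite !sc u4 u6 xpair_eqE.
Qed.

End CardAutO.

Theorem theorem2 (F : finFieldType) (p e : nat)
    (charF : p \in [pchar F]) (p_ge5 : (5 <= p)%N) (cardF : #|F| = (p ^ e)%N)
    (K : closedFieldType) (iota : {rmorphism F -> K}) (algK : integralRange iota)
    (a b : F) (smoothE : 4 * a ^+ 3 + 27 * b ^+ 2 != 0)
    (lambda mu : F) (onE : on_curve a b (Some (lambda, mu))) :
  let P : ecpoint a b := exist (on_curve a b) (Some (lambda, mu)) onE in
  exists S : {group gal_of {: pPrimeCharType charF}},
    (S \subset 'Gal({: pPrimeCharType charF} / 1))%g /\
    #|Aut [set: GEP a lambda mu]|%:R / p%:R ^+ (18 * e ^ 2) =
      #|S|%:R * #|ec_tors a b 3|%:R
      * (#|` fset_set (ec_AutO iota a b)|%:R / #|` fset_set (ec_orbit iota P)|%:R)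
      * (if P \in ec_tors a b 2 then #|('GL_2[F])%g|%:R
         else 2 * (p%:R ^+ e - 1) ^+ 2) :> rat.
Proof.
have natF_neq0 n : (0 < n < p)%N -> n%:R != 0 :> F.
  case/andP=> n0 np; rewrite -(dvdn_pcharf charF).
  by rewrite gtnNdvd.
have two_neq0 : 2 != 0 :> F by apply: natF_neq0; rewrite (leq_trans _ p_ge5).
have three_neq0 : 3 != 0 :> F by apply: natF_neq0; rewrite (leq_trans _ p_ge5).
move=> P; have [S cardAut] := card_Aut_GEP charF cardF a lambda mu two_neq0.
exists S; split; first exact: gal_full.
have onP : mu ^+ 2 = lambda ^+ 3 + a * lambda + b by apply/eqP.
have pp : prime p := pcharf_prime charF.
have p0 : p%:R != 0 :> rat by rewrite Num.Theory.pnatr_eq0 -lt0n prime_gt0.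
have orb := card_ec_orbit iota two_neq0 three_neq0 charF cardF onE.
rewrite -/P in orb.
rewrite (card_AutO iota a b two_neq0 three_neq0 charF cardF) -orb.
set O := #|` fset_set (ec_orbit iota P)| in orb *.
have O0 : O%:R != 0 :> rat.
  rewrite Num.Theory.pnatr_eq0; apply/eqP=> O0; move: orb; rewrite O0 mul0n => /esym/eqP.
  (* [1] lies in [ec_units], so the orbit cannot have size zero. *)
  rewrite cards_eq0 => /eqP/setP/(_ 1); rewrite !inE oner_neq0 !expr1n !mul1r !eqxx.
  by [].
rewrite natrM [O%:R * _]mulrC mulfK //.
rewrite cardAut (card_pisom_self two_neq0 three_neq0 smoothE onP).
rewrite (card_pisomO_stab two_neq0 three_neq0 onP).
rewrite (natrM _ _ (p ^ _)) natrX mulfK ?expf_neq0 // !natrM.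
rewrite (ec_tors2P two_neq0) /= !mulrA; congr (_ * _).
have qE : #|F|.-1%:R = p%:R ^+ e - 1 :> rat.
  by rewrite cardF -subn1 natrB ?natrX // expn_gt0 prime_gt0.
by case: ifP => _ //; rewrite natrM natrX qE expr2 mulrA.
Qed.
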